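(* Let $G_{\mathcal C}$ be the multiclass random tree Markov chain with finite class set $\mathcal C$, birth rates $\lambda_{cc'}\ge0$ and death rates $\mu_{cc'}>0$. Put $\rho_{cc'}=\lambda_{cc'}/\mu_{cc'}$ for $c,c'\in\mathcal C$, $\rho_c=\sum_{c'\in\mathcal C}\rho_{cc'}$ for $c\in\mathcal C$, and let $\rho\ge0$ be the Perron–Frobenius eigenvalue of the non-negative matrix $(\rho_{cc'})_{c,c'\in\mathcal C}$. 1. The Markov chain $G_{\mathcal C}$ is ergodic if, and only if, the nonlinear system \[ y_c=\sum_{d\in\mathcal C}\rho_{cd}\exp\{y_d\},\qquad \forall c\in\mathcal C, \] has at least one real-valued (and obviously non-negative) solution. In this case, the mean lifetime of a vertex of class $c$ with a direct ascendant of class $b$ can be written as \[ m_{bc}=\frac{1}{\mu_{bc}}\exp\{r_c\}, \] where $(r_c)_{c\in\mathcal C}$ is the smallest solution of the system, that is, $r_c\le y_c$ for all $c\in\mathcal C$ and every solution $(y_c)$. (The system implies $r_c\ge\rho_c$.) 2. A sufficient condition for ergodicity is \[ \rho_c\le\frac1e,\qquad\forall c\in\mathcal C, \] in which case $r_c\le\rho_c e$ for all $c\in\mathcal C$. 3. A necessary condition for ergodicity is \[ \rho\le\frac1e. \]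
   Context: The multiclass chain $G_{\mathcal C}$ is a continuous-time Markov chain on finite directed rooted trees whose vertices carry classes in a finite set $\mathcal C$, started from the single root vertex $v_0$. It evolves as follows. At any given vertex of class $c$, a new edge of class $c'\in\mathcal C$, leading to a new leaf of class $c'$, is added at the epochs of a Poisson process with parameter $\lambda_{cc'}\ge0$. Any leaf (other than the root) of class $c'$ whose direct ancestor is of class $c$ is deleted at rate $\mu_{cc'}>0$. The root is never deleted and belongs to class $c\in\mathcal C$ with probability $\pi_c$, $\sum_{c}\pi_c=1$. ''Ergodic'' means positive recurrent. The lifetime of a non-root vertex is the length of time between its birth and its deletion. *)

(* Defs.v *)
From HB Require Import structures.
From mathcomp Require Import all_boot all_order all_algebra.
From mathcomp Require Import finmap.
From mathcomp Require Import complex.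
From mathcomp Require Import all_classical all_reals all_analysis.
From mathcomp Require Import measurable_realfun.

Set Implicit Arguments.
Unset Strict Implicit.
Unset Printing Implicit Defensive.

Import Order.TTheory GRing.Theory Num.Theory.

Local Open Scope classical_set_scope.
Local Open Scope fset_scope.
Local Open Scope fmap_scope.
Local Open Scope ring_scope.

(* Trees.  A vertex is named by its address: [::] is the root v0, and the
   children of v are the vertices i :: v with i : nat, so the direct ancestor
   of v != [::] is behead v.  A tree maps its vertices to their classes. *)

Definition vertex := seq nat.

Definition tree (C : finType) := {fmap vertex -> C}.

Section Trees.
Variable C : finType.
Implicit Types (T : tree C) (v : vertex) (c : C).

Definition is_tree T : Prop :=
  [::] \in domf T /\ forall v, v \in domf T -> behead v \in domf T.

Definition root_tree c : tree C := [fmap].[([::] : vertex) <- c].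

Definition children T v : seq vertex :=
  [seq w <- domf T | (w != [::]) && (behead w == v)].

Definition leaf T v : bool := (v \in domf T) && (children T v == [::]).

(* Addresses only serve to name vertices.  A newborn takes the index following
   the largest one among its living siblings, so that an address stays attached
   to one and the same vertex for as long as this vertex lives. *)
Definition newborn T v : vertex :=
  (\max_(w <- children T v) (head 0%N w).+1)%N :: v.

Definition birth T v c : tree C := T.[newborn T v <- c].

Definition death T v : tree C := T.[~ v].

End Trees.

Section Rates.
Variables (R : realType) (C : finType) (lam mu : C -> C -> R).
Implicit Types (T : tree C) (v : vertex) (c : C).

Definition birth_rate T v c : R :=
  if T.[? v] is Some b then lam b c else 0.

Definition death_rate T v : R :=
  match T.[? behead v], T.[? v] with
  | Some b, Some c => mu b c
  | _, _ => 0
  end.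

(* the possible jumps out of T, listed as pairs (target, rate) *)
Definition jumps T : seq (tree C * R) :=
  [seq (birth T v c, birth_rate T v c) | v <- domf T, c <- enum C] ++
  [seq (death T v, death_rate T v)
     | v <- [seq v <- domf T | leaf T v && (v != [::])]].

Definition rate T T' : R := \sum_(j <- jumps T | j.1 == T') j.2.

Definition exit_rate T : R := \sum_(j <- jumps T) j.2.

(* transition matrix of the embedded jump chain; absorbing states loop *)
Definition jump_prob T T' : R :=
  if exit_rate T == 0 then (T == T')%:R else rate T T' / exit_rate T.

Definition reachable T T' : Prop :=
  exists p : seq (tree C),
    path (fun A B : tree C => 0 < rate A B) T p /\ last T p = T'.

End Rates.

Section Chain.
Variables (R : realType) (C : finType) (lam mu : C -> C -> R).
Variables (d : measure_display) (W : measurableType d).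
Variables (Y : nat -> W -> tree C) (H : nat -> W -> \bar R).

(* Under the probability P, the successive states Y 0, Y 1, ... and holding
   times H 0, H 1, ... are those of a Markov jump process with initial law nu
   and the above rates: Y is a Markov chain with transition matrix jump_prob
   and, given Y, the H k are independent exponential variables with parameters
   exit_rate (Y k) (equal to +oo when the parameter is 0). *)
Definition is_chain (P : probability W R) (nu : tree C -> R) : Prop :=
  [/\ forall n T, measurable [set w | Y n w = T],
      forall n, measurable_fun [set: W] (H n) &
      forall n (T : nat -> tree C) (t : nat -> R), (forall k, 0 <= t k) ->
        P [set w | forall k, (k <= n)%N -> Y k w = T k /\ ((t k)%:E < H k w)%E]
        = (nu (T 0%N)
           * \prod_(k < n) jump_prob lam mu (T k) (T k.+1)
           * \prod_(k < n.+1) expR (- (exit_rate lam mu (T k) * t k)))%:E].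

Definition jump_time (n : nat) (w : W) : \bar R := (\sum_(k < n) H k w)%E.

(* X_t = T *)
Definition state_at (t : R) (w : W) (T : tree C) : Prop :=
  exists n, [/\ (jump_time n w <= t%:E)%E, (t%:E < jump_time n.+1 w)%E
              & Y n w = T].

(* inf {t >= jump_time n : X_t \in A}, which is +oo if there is no such t *)
Definition first_time (n : nat) (A : set (tree C)) (w : W) : \bar R :=
  ereal_inf [set t%:E | t in
    [set t : R | (jump_time n w <= t%:E)%E
                 /\ exists T, state_at t w T /\ A T]].

Definition return_time (T : tree C) : W -> \bar R := first_time 1 [set T].

Definition positive_recurrent (P : tree C -> probability W R) (T : tree C) :=
  exit_rate lam mu T = 0 \/ (\int[P T]_w return_time T w < +oo)%E.

Definition ergodic (P : tree C -> probability W R) : Prop :=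
  forall c T, reachable lam mu (root_tree c) T -> positive_recurrent P T.

(* the (n+1)-st jump is the birth of a vertex of class c, with address v, whose
   direct ancestor is of class b *)
Definition birth_event (n : nat) (v : vertex) (b c : C) : set W :=
  [set w | [/\ v != [::], v \notin domf (Y n w), (Y n.+1 w).[? v] = Some c
             & (Y n.+1 w).[? behead v] = Some b]].

Definition lifetime (n : nat) (v : vertex) (w : W) : \bar R :=
  (first_time n.+1 [set T : tree C | v \notin domf T] w - jump_time n.+1 w)%E.

Definition mean_lifetime (P : probability W R) n v b c : \bar R :=
  ((fine (P (birth_event n v b c)))^-1%:E
   * \int[P]_(w in birth_event n v b c) lifetime n v w)%E.

End Chain.

Definition dirac_law (R : realType) (C : finType) (T T' : tree C) : R :=
  (T' == T)%:R.

Definition root_law (R : realType) (C : finType) (pi : C -> R) (T : tree C) : R :=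
  \sum_c pi c * (T == root_tree c)%:R.

Section System.
Variables (R : realType) (C : finType) (rho : C -> C -> R).

Definition solution (y : C -> R) : Prop :=
  forall c, y c = \sum_d rho c d * expR (y d).

Definition smallest_solution (r : C -> R) : Prop :=
  solution r /\ forall y, solution y -> forall c, r c <= y c.

End System.

Definition class_mx (R : realType) (C : finType) (rho : C -> C -> R) : 'M[R]_#|C| :=
  \matrix_(i, j) rho (enum_val i) (enum_val j).

(* the non-negative eigenvalue that dominates all complex eigenvalues *)
Definition perron_frobenius (R : realType) (n : nat) (A : 'M[R]_n) (r : R) : Prop :=
  let AC : 'M[complex R]_n := map_mx (real_complex R) A in
  [/\ 0 <= r, eigenvalue A r
    & forall z : complex R, eigenvalue AC z -> `|z| <= real_complex R r].

(* Main.v *)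
(* Up to relabelling siblings, the chain is reversible: a tree has the weight
   w(T) = \prod rho / |Aut T|, where the product ranges over its edges, and the
   births and deaths of leaves are in detailed balance. Enumerating isomorphism
   classes through plane trees with the weights \prod rho / \prod (number of
   children)!, the total mass Z_c of the trees with a root of class c satisfies
   Z_c = exp (\sum_d rho_cd Z_d), so that the masses are finite if and only if
   the system has a solution, and then Z_c = exp r_c for the smallest one.

   Let a root of class c be killed at rate mu when it is alone. On trees of size
   at most m, let h be the mean time spent before being killed or exceeding the
   size m, and f the probability that the former happens first. Green's identity
   for the reversible weights gives mu h(root) = \sum_T w(T) f(T). As m grows, h
   at the root increases to the mean lifetime, which is thus at most Z_c / mu; and
   if this lifetime is almost surely finite then f tends to 1 and equality holds.
   Finiteness follows from that of the mean because the size grows by at most one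
   per jump, which bounds the exit rates linearly and makes the harmonic series
   appear. Since the evolution of the subtree at a vertex is not influenced by the
   rest of the tree, this computes all the lifetimes; finiteness of the masses
   yields positive recurrence by comparison with the time needed to come back to
   the single root. *)
Require Import Defs.
From HB Require Import structures.
From mathcomp Require Import all_boot all_order all_algebra.
From mathcomp Require Import finmap.
From mathcomp Require Import complex.
From mathcomp Require Import all_classical all_reals all_analysis.
From mathcomp Require Import measurable_realfun.
From mathcomp Require Import ring lra zify.

Import Order.TTheory GRing.Theory Num.Theory.
Import numFieldNormedType.Exports.

Local Open Scope fset_scope.
Local Open Scope fmap_scope.
Local Open Scope classical_set_scope.
Local Open Scope ring_scope.

Set Implicit Arguments.
Unset Strict Implicit.
Unset Printing Implicit Defensive.

(** * Addressed trees *)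

Section TreeBasics.
Variable C : finType.
Implicit Types (T : tree C) (u v w x : vertex) (c : C).

(** All measures on trees are finite lists. The weights are truncated at depth [D] and at fewer than
    [K] children, and Green's identity concerns functions that vanish beyond size [m], so that it is
    exact as soon as [m <= D] and [m <= K]; infinite sums enter only as limits of real sequences.
    The chain does not stay within plane trees, since a death leaves a gap among the sibling
    indices. Hence only functions invariant under relabelling are integrated, and a dying child is
    first moved to the last place. The main obstacle is explosion: a finite mean for the total
    holding time before absorption does not yet bound the number of jumps, and [first_time] is +oo
    on a trajectory that explodes first. The bookkeeping is therefore by jumps: [spent] and
    [survive] are real recursions along the embedded chain, compared with the truncated problems by
    induction on the number of jumps. The probability space comes in afterwards, through events
    fixing the first states. The constant 1/e comes from e * y <= exp y, with equality at y = 1. *)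

Definition tree_size T : nat := #|` domf T|.

Definition fresh T v : nat := \max_(w <- children T v) (head 0%N w).+1.

Lemma newbornE T v : newborn T v = fresh T v :: v. Proof. by []. Qed.

Lemma mem_children T v w :
  (w \in children T v) = [&& w != [::], behead w == v & w \in domf T].
Proof. by rewrite mem_filter andbA. Qed.

Lemma fresh_leP T v k :
  reflect (forall i, i :: v \in domf T -> (i < k)%N) (fresh T v <= k)%N.
Proof.
rewrite /fresh; apply: (iffP (bigmax_leqP_seq _ _ _ _)) => H.
  by move=> i iT; apply: (H (i :: v)) => //; rewrite mem_children /= eqxx.
by case=> [|i w]; rewrite mem_children //= => /andP[/eqP-> /H].
Qed.

(** Only the occupied indices matter; this makes births commute with passing to a subtree. *)
Lemma eq_fresh T v T' v' :
  (forall i, (i :: v \in domf T) = (i :: v' \in domf T')) ->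
  fresh T v = fresh T' v'.
Proof.
move=> H; apply/eqP; rewrite eqn_leq; apply/andP; split.
  by apply/fresh_leP => i; rewrite H; apply/fresh_leP.
by apply/fresh_leP => i; rewrite -H; apply/fresh_leP.
Qed.

Lemma newborn_notin T v : newborn T v \notin domf T.
Proof.
apply/negP => H; have /fresh_leP/(_ _ H) := leqnn (fresh T v).
by rewrite ltnn.
Qed.

Lemma leafP T v :
  reflect (v \in domf T /\ forall i, i :: v \notin domf T) (leaf T v).
Proof.
apply: (iffP andP) => -[vT H]; split => //.
  by move=> i; apply/negP => iv; have := mem_children T v (i :: v);
    rewrite (eqP H) in_nil /= eqxx iv.
case E: (children T v) => [//|w s].
have : w \in children T v by rewrite E mem_head.
by rewrite mem_children; case: w {E} => //= i w /andP[/eqP->]; rewrite (negPf (H i)).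
Qed.

Lemma fnd_mem T v : (v \in domf T) = (T.[? v] != None).
Proof. by case: fndP. Qed.

Lemma fnd_notin T v : v \notin domf T -> T.[? v] = None.
Proof. by rewrite fnd_mem negbK => /eqP. Qed.

Lemma fnd_birth T v c u :
  (birth T v c).[? u] = if u == newborn T v then Some c else T.[? u].
Proof. exact: fnd_set. Qed.

Lemma fnd_death T v u : (death T v).[? u] = if u == v then None else T.[? u].
Proof. by rewrite fnd_rem1; case: eqP. Qed.

Lemma mem_birth T v c u :
  (u \in domf (birth T v c)) = (u == newborn T v) || (u \in domf T).
Proof. by rewrite !fnd_mem fnd_birth; case: ifP. Qed.

Lemma mem_death T v u : (u \in domf (death T v)) = (u != v) && (u \in domf T).
Proof. by rewrite !fnd_mem fnd_death; case: ifP. Qed.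

Lemma fnd_root_tree c u :
  (root_tree c).[? u] = if u == [::] then Some c else None.
Proof. by rewrite fnd_set fnd_fmap0. Qed.

Lemma mem_root_tree c u : (u \in domf (root_tree c)) = (u == [::]).
Proof. by rewrite fnd_mem fnd_root_tree; case: ifP. Qed.

Lemma domf_birth T v c : domf (birth T v c) = (newborn T v |` domf T)%fset.
Proof. by apply/fsetP => u; rewrite mem_birth. Qed.

Lemma tree_size_birth T v c : tree_size (birth T v c) = (tree_size T).+1.
Proof. by rewrite /tree_size domf_birth cardfsU1 newborn_notin. Qed.

Lemma tree_size_death T v : v \in domf T -> tree_size T = (tree_size (death T v)).+1.
Proof.
move=> vT; rewrite /tree_size (cardfsD1 v) vT; congr (_ + #|` _|)%N.
by apply/fsetP => u; rewrite mem_death in_fsetD1.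
Qed.

Lemma tree_size_root_tree c : tree_size (root_tree c) = 1%N.
Proof.
rewrite /tree_size -(cardfs1 ([::] : vertex)); congr #|` _|.
by apply/fsetP => u; rewrite mem_root_tree in_fset1.
Qed.

Lemma is_tree_root_tree c : is_tree (root_tree c).
Proof.
by split=> [|v]; rewrite !mem_root_tree // => /eqP->.
Qed.

Lemma is_tree_birth T v c : is_tree T -> v \in domf T -> is_tree (birth T v c).
Proof.
move=> [T0 Tb] vT; split=> [|u]; rewrite !mem_birth.
  by rewrite T0 orbT.
by case/orP=> [/eqP->|/Tb->]; rewrite ?vT orbT.
Qed.

Lemma is_tree_death T v :
  is_tree T -> leaf T v -> v != [::] -> is_tree (death T v).
Proof.
move=> [T0 Tb] /leafP[_ lf] v0; split=> [|u]; rewrite !mem_death.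
  by rewrite eq_sym v0.
case/andP=> uv uT; rewrite Tb // andbT; apply/eqP => bu.
case: u => [|i u] /= in uv uT bu; first by rewrite bu eqxx in uv.
by move: (lf i); rewrite -bu uT.
Qed.

Lemma tree_size_gt0 T : is_tree T -> (0 < tree_size T)%N.
Proof.
by move=> [T0 _]; rewrite /tree_size cardfs_gt0; apply/fset0Pn; exists [::].
Qed.

Lemma tree_size1 T c : is_tree T -> T.[? [::]] = Some c -> tree_size T = 1%N ->
  T = root_tree c.
Proof.
move=> [T0 _] Tc /eqP/cardfs1P[v Tv]; apply/fmapP => u.
rewrite fnd_root_tree; case: ifPn => [/eqP->//|u0].
apply: fnd_notin; move: T0; rewrite Tv !in_fset1 => /eqP <-.
by rewrite u0.
Qed.

Lemma tree_root T : is_tree T -> exists c, T.[? [::]] = Some c.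
Proof. by case; rewrite fnd_mem; case: fnd => // c; exists c. Qed.

(** An address lists the indices from the vertex up to the root, so the ancestors of a vertex are
    the suffixes of its address. *)
Lemma mem_suffix_tree T u v : is_tree T -> u ++ v \in domf T -> v \in domf T.
Proof. by move=> [_ Tb]; elim: u => //= i u IH /Tb /IH. Qed.

(** A vertex of maximal depth has no child, and it is the root only when nothing else is present. *)
Lemma exists_leaf T : is_tree T -> tree_size T != 1%N ->
  exists2 v, leaf T v & v != [::].
Proof.
move=> tT T1.
have [v vT vmax] : exists2 v, v \in domf T &
    forall u, u \in domf T -> (size u <= size v)%N.
  have : exists n, `[< exists2 v, v \in domf T & size v = n >].
    by exists 0%N; apply/asboolP; exists [::] => //; case: tT.
  move/ex_maxnP => /(_ (\max_(u <- domf T) size u)%N)[].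
    by move=> n /asboolP[v vT <-]; apply: leq_bigmax_seq.
  move=> n /asboolP[v vT <-] H; exists v => // u uT; apply: H.
  by apply/asboolP; exists u.
exists v.
  by apply/leafP; split=> // i; apply/negP => /vmax; rewrite /= ltnn.
apply: contra T1 => /eqP v0; rewrite /tree_size -(cardfs1 ([::] : vertex)).
apply/eqP; congr #|` _|; apply/fsetP => u; rewrite in_fset1.
apply/idP/eqP => [/vmax|->]; last by case: tT.
by rewrite v0 leqn0 size_eq0 => /eqP.
Qed.

End TreeBasics.

(** * Subtrees and grafting *)

Section Grafting.
Variable C : finType.
Implicit Types (T S : tree C) (u v w x : vertex) (c : C) (l : seq (tree C)).

(** [D] only has to cover the support of [g]: repetitions, and points where [g] is undefined, change
    nothing. *)
Definition mkmap (g : vertex -> option C) (D : seq vertex) : tree C :=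
  foldr (fun x m => if g x is Some c then m.[x <- c] else m) [fmap] D.

Lemma fnd_mkmap g D x : (mkmap g D).[? x] = if x \in D then g x else None.
Proof.
elim: D => [|y D IH] /=; first by rewrite fnd_fmap0.
rewrite in_cons; case: (eqVneq x y) IH => [->|xy] IH /=; last first.
  by case: (g y) => // c; rewrite fnd_set (negPf xy).
case E: (g y) => [c|]; first by rewrite fnd_set eqxx.
by rewrite IH E if_same.
Qed.

Lemma eqseq_cat2r (x y v : vertex) : (x ++ v == y ++ v) = (x == y).
Proof.
apply/eqP/eqP => [xy|->//].
have /eqP : size x = size y.
  by apply: (@addIn (size v)); rewrite -!size_cat xy.
by move=> sxy; move/eqP: xy; rewrite eqseq_cat ?(eqP sxy) // => /andP[/eqP].
Qed.

(** The candidates strip the length of [v] off every address; those coming from vertices outside the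
    subtree are sorted out by the lookup at [x ++ v]. *)
Definition subtree v T : tree C :=
  mkmap (fun x => T.[? x ++ v]) [seq take (size u - size v) u | u <- domf T].

Lemma fnd_sub v T x : (subtree v T).[? x] = T.[? x ++ v].
Proof.
rewrite fnd_mkmap; case: ifPn => // /negP H; rewrite fnd_notin //.
apply/negP => xT; apply: H; apply/mapP; exists (x ++ v) => //.
by rewrite size_cat addnK take_size_cat.
Qed.

Lemma mem_sub v T x : (x \in domf (subtree v T)) = (x ++ v \in domf T).
Proof. by rewrite !fnd_mem fnd_sub. Qed.

Lemma is_tree_sub v T : is_tree T -> v \in domf T -> is_tree (subtree v T).
Proof.
by move=> [_ Tb] vT; split=> [|[|i x]]; rewrite ?mem_sub // => /Tb.
Qed.

Lemma tree_size_sub v T : (tree_size (subtree v T) <= tree_size T)%N.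
Proof.
rewrite /tree_size -(size_map (cat^~ v) (domf (subtree v T))); apply: uniq_leq_size.
  by rewrite map_inj_uniq ?fset_uniq // => x y /eqP; rewrite eqseq_cat2r => /eqP.
by move=> u /mapP[x xS ->]; rewrite -mem_sub.
Qed.

Lemma sum_suffix (R : nmodType) v T (F : vertex -> R) :
  \sum_(u <- domf T | suffix v u) F u = \sum_(x <- domf (subtree v T)) F (x ++ v).
Proof.
rewrite -big_filter -[RHS](big_map (cat^~ v) xpredT F); apply: perm_big.
apply: uniq_perm; first by rewrite filter_uniq ?fset_uniq.
  by rewrite map_inj_uniq ?fset_uniq // => x y /eqP; rewrite eqseq_cat2r => /eqP.
move=> u; rewrite mem_filter; apply/andP/mapP => [[/suffixP[x ->] xT]|[x xS ->]].
  by exists x => //; rewrite mem_sub.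
by rewrite suffix_suffix -mem_sub.
Qed.

Lemma newborn_sub v T x : newborn T (x ++ v) = newborn (subtree v T) x ++ v.
Proof.
rewrite !newbornE /= (@eq_fresh _ T (x ++ v) (subtree v T) x) // => i.
by rewrite mem_sub.
Qed.

Lemma leaf_sub v T x : leaf T (x ++ v) = leaf (subtree v T) x.
Proof.
by apply/leafP/leafP => -[xT lf]; split; move: xT lf;
  rewrite ?mem_sub // => _ lf i; have := lf i; rewrite mem_sub.
Qed.

Lemma sub_birth v T x c : subtree v (birth T (x ++ v) c) = birth (subtree v T) x c.
Proof.
apply/fmapP => y; rewrite fnd_sub !fnd_birth fnd_sub newborn_sub.
by rewrite eqseq_cat2r.
Qed.

Lemma sub_death v T x : subtree v (death T (x ++ v)) = death (subtree v T) x.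
Proof. by apply/fmapP => y; rewrite fnd_sub !fnd_death fnd_sub eqseq_cat2r. Qed.

Lemma sub_birth_out v T u c :
  v \in domf T -> ~~ suffix v u -> subtree v (birth T u c) = subtree v T.
Proof.
move=> vT vu; apply/fmapP => y; rewrite !fnd_sub fnd_birth.
case: eqP => // yv; case: y yv => [|i y] /= yv.
  by have := newborn_notin T u; rewrite -yv vT.
by case: yv => _ yv; rewrite -yv suffix_suffix in vu.
Qed.

Lemma sub_death_out v T u : ~~ suffix v u -> subtree v (death T u) = subtree v T.
Proof.
move=> vu; apply/fmapP => y; rewrite !fnd_sub fnd_death.
by case: eqP => // yv; rewrite -yv suffix_suffix in vu.
Qed.

Definition node_dom l : seq vertex :=
  flatten [seq [seq rcons u i | u <- domf (nth [fmap] l i)] | i <- iota 0 (size l)].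

(** The entry of an address closest to the root is its last one, so the vertex [u] of the i-th
    grafted tree becomes [rcons u i]; hence [last] and [belast]. *)
Definition node c l : tree C :=
  mkmap (fun x => if x is i :: u then (nth [fmap] l (last i u)).[? belast i u]
                  else Some c) ([::] :: node_dom l).

Lemma fnd_node0 c l : (node c l).[? [::]] = Some c.
Proof. by rewrite fnd_mkmap mem_head. Qed.

Lemma mem_node_dom l x i :
  (rcons x i \in node_dom l) = (x \in domf (nth [fmap] l i)).
Proof.
apply/flatten_mapP/idP => [[j _ /mapP[u uj /rcons_inj[-> ->]]] //|xi].
exists i; last by apply/mapP; exists x.
rewrite mem_iota /= add0n ltnNge; apply: contraL xi => li.
by rewrite nth_default // domf0 in_fset0.
Qed.

Lemma fnd_node c l x i : (node c l).[? rcons x i] = (nth [fmap] l i).[? x].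
Proof.
rewrite fnd_mkmap in_cons mem_node_dom.
have -> : (rcons x i == [::]) = false by case: (x).
case: ifPn => [_|/fnd_notin//].
by case E: (rcons x i) => [|k y]; [case: (x) E | move: E; rewrite lastI => /rcons_inj[-> ->]].
Qed.

Lemma sub_node c l i : subtree [:: i] (node c l) = nth [fmap] l i.
Proof. by apply/fmapP => x; rewrite fnd_sub cats1 fnd_node. Qed.

Lemma mem_node0 c l : [::] \in domf (node c l).
Proof. by rewrite fnd_mem fnd_node0. Qed.

Lemma mem_node c l x i :
  (rcons x i \in domf (node c l)) = (x \in domf (nth [fmap] l i)).
Proof. by rewrite !fnd_mem fnd_node. Qed.

Lemma sum_node (R : nmodType) c l (F : vertex -> R) :
  \sum_(u <- domf (node c l)) F u =
  F [::] + \sum_(0 <= i < size l) \sum_(u <- domf (nth [fmap] l i)) F (rcons u i).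
Proof.
transitivity (\sum_(u <- [::] :: node_dom l) F u); last first.
  rewrite big_cons big_flatten big_map /index_iota subn0; congr (_ + _).
  by apply: eq_bigr => i _; rewrite big_map.
apply: perm_big; apply: uniq_perm; first exact: fset_uniq.
  rewrite /=; apply/andP; split.
    by apply/flatten_mapP => -[i _ /mapP[[|? ?]]].
  apply: allpairs_uniq_dep.
  - exact: iota_uniq.
  - by move=> i _; exact: fset_uniq.
  - by move=> [i x] [j y] /= _ _ /rcons_inj[-> ->].
move=> u; case/lastP: u => [|u i]; first by rewrite mem_node0 mem_head.
rewrite mem_node in_cons mem_node_dom.
by case: u.
Qed.

Lemma is_tree_node c l : (forall T, T \in l -> is_tree T) -> is_tree (node c l).
Proof.
move=> tl; split=> [|u]; first exact: mem_node0.
case/lastP: u => [|u i]; first by rewrite mem_node0.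
rewrite mem_node => ui.
have il : (i < size l)%N.
  rewrite ltnNge; apply: contraL ui => li.
  by rewrite nth_default // domf0 in_fset0.
case: u ui => [|j u] ui /=; first by rewrite mem_node0.
by rewrite mem_node; case: (tl _ (mem_nth [fmap] il)) => _ /(_ _ ui).
Qed.

Lemma tree_size_node c l :
  (forall T, T \in l -> is_tree T) ->
  tree_size (node c l) = (\sum_(T <- l) tree_size T).+1.
Proof.
move=> tl; have -> T : tree_size T = (\sum_(u <- domf T) 1)%N.
  by rewrite sum1_size.
rewrite (@sum_node nat) /= -[RHS]add1n; congr (_ + _)%N.
rewrite (big_nth [fmap]); apply: eq_bigr => i _.
by rewrite /tree_size -sum1_size.
Qed.

Lemma birth_node c l i u d : (i < size l)%N ->
  birth (node c l) (rcons u i) d =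
  node c (set_nth [fmap] l i (birth (nth [fmap] l i) u d)).
Proof.
move=> il; apply/fmapP => x; rewrite fnd_birth -cats1 newborn_sub sub_node.
case/lastP: x => [|x j]; first by rewrite !fnd_node0.
rewrite !fnd_node cats1 eqseq_rcons nth_set_nth /=.
case: (eqVneq j i) => [->|ji]; last by rewrite andbF.
by rewrite andbT fnd_birth.
Qed.

Lemma death_node c l i u : (i < size l)%N ->
  death (node c l) (rcons u i) =
  node c (set_nth [fmap] l i (death (nth [fmap] l i) u)).
Proof.
move=> il; apply/fmapP => x; rewrite fnd_death.
case/lastP: x => [|x j]; first by rewrite !fnd_node0; case: u.
rewrite !fnd_node nth_set_nth /= eqseq_rcons.
case: (eqVneq j i) => [->|ji]; last by rewrite andbF.
by rewrite andbT fnd_death.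
Qed.

(** As trees are non-empty, the children of the root occupy the indices below [size l] without gaps,
    and the newborn comes right after them. *)
Lemma birth_node0 c l d : (forall T, T \in l -> is_tree T) ->
  birth (node c l) [::] d = node c (rcons l (root_tree d)).
Proof.
move=> tl; have nb : newborn (node c l) [::] = [:: size l].
  rewrite newbornE; congr cons; apply/eqP; rewrite eqn_leq; apply/andP; split.
    apply/fresh_leP => i; rewrite -[[:: i]]/(rcons [::] i) mem_node.
    by apply: contraTltn => li; rewrite nth_default // domf0 in_fset0.
  case E: (size l) => [//|k]; have /fresh_leP := leqnn (fresh (node c l) [::]).
  apply; rewrite -[[:: k]]/(rcons [::] k) mem_node.
  by case: (tl (nth [fmap] l k)) => //; apply: mem_nth; rewrite E.
apply/fmapP => x; rewrite fnd_birth nb.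
case/lastP: x => [|x j]; first by rewrite !fnd_node0.
rewrite !fnd_node nth_rcons -[[:: size l]]/(rcons [::] (size l)) eqseq_rcons.
case: ltngtP => jl; rewrite ?andbF //.
  by rewrite nth_default ?(ltnW jl) // fnd_fmap0.
by rewrite jl nth_default // fnd_root_tree fnd_fmap0 andbT.
Qed.

(** Among the lone children of the root, the last one is deleted without leaving an empty slot in
    the list; the others are first moved to the end by an isomorphism. *)
Lemma death_rcons c l d :
  death (node c (rcons l (root_tree d))) [:: size l] = node c l.
Proof.
apply/fmapP => x; rewrite fnd_death.
case/lastP: x => [|x j]; first by rewrite !fnd_node0.
rewrite !fnd_node nth_rcons -[[:: size l]]/(rcons [::] (size l)) eqseq_rcons.
case: ltngtP => jl; rewrite ?andbF //.
  by rewrite nth_default ?(ltnW jl) // fnd_fmap0.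
rewrite andbT fnd_root_tree jl nth_default // fnd_fmap0.
by case: eqP.
Qed.

Lemma node_nil c : node c [::] = root_tree c.
Proof.
apply/fmapP => x; rewrite [RHS]fnd_root_tree.
case/lastP: x => [|x j]; first by rewrite fnd_node0.
by rewrite fnd_node nth_nil fnd_fmap0; case: x.
Qed.

End Grafting.

(** * Isomorphisms and the generator *)

Section Isomorphism.
Variable C : finType.
Implicit Types (T S : tree C) (u v w x : vertex) (c : C) (l : seq (tree C)).

(** [s] is constrained on the vertices of [T] only. Preserving just [behead] and the classes forgets
    the order of siblings and the gaps in their numbering. *)
Definition isom (s : vertex -> vertex) T T' : Prop :=
  [/\ {in domf T &, injective s}, s [::] = [::],
      {in domf T, forall u, s (behead u) = behead (s u)},
      {in domf T, forall u, T'.[? s u] = T.[? u]}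
    & forall w, w \in domf T' -> exists2 u, u \in domf T & s u = w].

Definition iso T T' : Prop := exists s, isom s T T'.

Lemma isom_id T : isom id T T.
Proof. by split=> // w wT; exists w. Qed.

Lemma isom_mem s T T' u : isom s T T' -> u \in domf T -> s u \in domf T'.
Proof. by move=> [_ _ _ H _] uT; rewrite fnd_mem H // -fnd_mem. Qed.

Lemma isom_perm s T T' : isom s T T' -> perm_eq [seq s u | u <- domf T] (domf T').
Proof.
move=> sT; have [sI _ _ _ sS] := sT; apply: uniq_perm; rewrite ?fset_uniq //.
  by rewrite map_inj_in_uniq ?fset_uniq.
move=> w; apply/mapP/idP => [[u uT ->]|/sS[u uT <-]]; last by exists u.
exact: isom_mem uT.
Qed.

Lemma isom_card s T T' : isom s T T' -> tree_size T' = tree_size T.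
Proof. by move=> /isom_perm/perm_size; rewrite size_map. Qed.

Lemma isom_nil s T T' u : is_tree T -> isom s T T' -> u \in domf T ->
  (s u == [::]) = (u == [::]).
Proof.
move=> [T0 _] [sI s0 _ _ _] uT; apply/eqP/eqP => [su|->//].
by apply: sI => //; rewrite s0.
Qed.

Lemma isom_leaf s T T' v : is_tree T -> isom s T T' -> v \in domf T ->
  leaf T' (s v) = leaf T v.
Proof.
move=> tT sT vT; have [sI s0 sb _ sS] := sT; have [T0 Tb] := tT.
apply/leafP/leafP => -[_ lf]; split; rewrite ?(isom_mem sT) // => i; apply/negP => iT.
  have := sb _ iT; have := isom_nil tT sT iT; have := isom_mem sT iT.
  by case: (s (i :: v)) => [|j y] //= jT _ sv; move: (lf j); rewrite sv jT.
have [[|j u] uT su] := sS _ iT; first by rewrite s0 in su.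
have := sb _ uT; rewrite su /= => /sI-/(_ (Tb _ uT) vT) uv.
by move: (lf j); rewrite -uv uT.
Qed.

(** The newborns on both sides receive unrelated indices, so the relabelling is extended by sending
    one to the other. *)
Lemma isom_birth s T T' v c : is_tree T -> isom s T T' -> v \in domf T ->
  iso (birth T v c) (birth T' (s v) c).
Proof.
move=> [T0 Tb] sT vT; have [sI s0 sb sf sS] := sT.
have nT u : u \in domf T -> (u == newborn T v) = false.
  by move=> uT; apply: contraTF uT => /eqP->; exact: newborn_notin.
have nT' u : u \in domf T -> (s u == newborn T' (s v)) = false.
  move=> uT; apply: contraTF (isom_mem sT uT) => /eqP->.
  exact: newborn_notin.
exists (fun u => if u == newborn T v then newborn T' (s v) else s u).
split.
- move=> u w; rewrite !mem_birth.
  case: eqP => [->|_] /= uT; case: eqP => [->|_] //= wT.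
  + by move/eqP; rewrite eq_sym nT'.
  + by move/eqP; rewrite nT'.
  + exact: sI.
- by [].
- move=> u; rewrite mem_birth; case: eqP => [->|_] /= uT; first by rewrite nT.
  by rewrite nT ?sb //; exact: Tb.
- move=> u; rewrite mem_birth !fnd_birth; case: eqP => /= [_|_] uT.
    by rewrite eqxx.
  by rewrite nT' // sf.
- move=> w; rewrite mem_birth; case/orP => [/eqP->|/sS[u uT <-]].
    by exists (newborn T v); rewrite ?mem_birth eqxx.
  by exists u; rewrite ?mem_birth ?uT ?orbT // nT.
Qed.

Lemma isom_death s T T' v : is_tree T -> isom s T T' -> v \in domf T ->
  isom s (death T v) (death T' (s v)).
Proof.
move=> [T0 Tb] sT vT; have [sI s0 sb sf sS] := sT; split => //.
- by move=> u w; rewrite !mem_death => /andP[_ uT] /andP[_ wT]; exact: sI.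
- by move=> u; rewrite !mem_death => /andP[_ uT]; exact: sb.
- move=> u; rewrite !mem_death !fnd_death => /andP[/negPf uv uT].
  by rewrite (inj_in_eq sI) // uv sf.
- move=> w; rewrite mem_death => /andP[wv /sS[u uT uw]]; exists u => //.
  by rewrite mem_death uT andbT; apply: contraNneq wv => <-; rewrite uw.
Qed.

Definition relabel (g : nat -> vertex -> vertex) (s0 : nat -> nat) (w : vertex) :=
  if w is k :: x then rcons (g (last k x) (belast k x)) (s0 (last k x)) else [::].

Lemma relabel_rcons g s0 u j : relabel g s0 (rcons u j) = rcons (g j u) (s0 j).
Proof.
case E: (rcons u j) => [|k x]; first by case: (u) E.
by have /rcons_inj[-> ->] : rcons u j = rcons (belast k x) (last k x) by rewrite -lastI.
Qed.

Lemma isom_node c l l' (g : nat -> vertex -> vertex) (s0 : nat -> nat) :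
  (forall T, T \in l -> is_tree T) ->
  (forall j, (j < size l)%N -> isom (g j) (nth [fmap] l j) (nth [fmap] l' (s0 j))) ->
  {in gtn (size l) &, injective s0} ->
  (forall i, (i < size l')%N -> exists2 j, (j < size l)%N & s0 j = i) ->
  isom (relabel g s0) (node c l) (node c l').
Proof.
move=> tl gi s0I s0S; set s := relabel g s0.
have sE u j : s (rcons u j) = rcons (g j u) (s0 j) by exact: relabel_rcons.
have lt u j : u \in domf (nth [fmap] l j) -> (j < size l)%N.
  by rewrite ltnNge; apply: contraL => li; rewrite nth_default // domf0 in_fset0.
have lt' u j : u \in domf (nth [fmap] l' j) -> (j < size l')%N.
  by rewrite ltnNge; apply: contraL => li; rewrite nth_default // domf0 in_fset0.
split => //.
- move=> u w; case/lastP: u => [|u j]; case/lastP: w => [|w k] //.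
  + by move=> _ _ /(congr1 size); rewrite sE size_rcons.
  + by move=> _ _ /(congr1 size); rewrite sE size_rcons.
  rewrite !mem_node !sE => uj wk /rcons_inj[guw] /s0I jk.
  have {}jk : j = k by apply: jk; apply: lt; eauto.
  rewrite -jk in guw wk *; congr rcons.
  by case: (gi j (lt _ _ uj)) => sI _ _ _ _; exact: sI.
- move=> u; case/lastP: u => [|u j] //; rewrite mem_node sE => uj.
  have jl := lt _ _ uj; have := gi j jl => sj; have [sI g0 gb _ _] := sj.
  case: u uj => [|i u] uj; first by rewrite g0.
  rewrite /= sE -[u]/(behead (i :: u)) gb //.
  have := isom_nil (tl _ (mem_nth _ jl)) sj uj.
  by case: (g j (i :: u)).
- move=> u; case/lastP: u => [|u j]; first by rewrite !fnd_node0.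
  rewrite mem_node sE !fnd_node => uj.
  by case: (gi j (lt _ _ uj)) => _ _ _ sf _; exact: sf.
- move=> w; case/lastP: w => [|w k]; first by exists [::]; rewrite ?mem_node0.
  rewrite mem_node => wk; have [j jl jk] := s0S k (lt' _ _ wk).
  have [_ _ _ _ sS] := gi j jl; rewrite -jk in wk *.
  by have [u uj <-] := sS _ wk; exists (rcons u j); rewrite ?mem_node ?sE.
Qed.

Lemma iso_node_set c l1 (x x' : tree C) l2 :
  (forall T, T \in l1 ++ x :: l2 -> is_tree T) ->
  iso x x' -> iso (node c (l1 ++ x :: l2)) (node c (l1 ++ x' :: l2)).
Proof.
move=> tl [s sx]; exists (relabel (fun j => if j == size l1 then s else id) id).
apply: isom_node => //.
  move=> j jl; case: eqP => [->|/eqP jl1]; first by rewrite !nth_cat ltnn subnn.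
  rewrite !nth_cat; case: ltnP => l1j; first exact: isom_id.
  case E: (j - size l1)%N => [|k] /=; last exact: isom_id.
  have : j == size l1 by rewrite eqn_leq l1j -subn_eq0 E.
  by rewrite (negPf jl1).
by move=> i; rewrite !size_cat /= => il; exists i.
Qed.

Definition rem_at (i : nat) l : seq (tree C) := take i l ++ drop i.+1 l.

Lemma size_rem_at l i : (i < size l)%N -> size (rem_at i l) = (size l).-1.
Proof. by move=> il; rewrite size_cat size_drop size_takel ?(ltnW il) //; lia. Qed.

(** This brings the child that is about to die to the last place, where [death_rcons] applies. *)
Lemma iso_rem_at c l i : (forall T, T \in l -> is_tree T) -> (i < size l)%N ->
  exists2 s, isom s (node c l) (node c (rcons (rem_at i l) (nth [fmap] l i)))
    & s [:: i] = [:: (size l).-1].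
Proof.
move=> tl il.
(* [unbump i] lowers the indices above [i] by one, which fills the slot left by the i-th tree. *)
pose s0 j := if j == i then (size l).-1 else unbump i j.
have s0i : s0 i = (size l).-1 by rewrite /s0 eqxx.
exists (relabel (fun=> id) s0); last first.
  by rewrite -[[:: i]]/(rcons [::] i) relabel_rcons /s0 eqxx.
have sr := size_rem_at il.
have nr j : (j < size l)%N -> j != i -> nth [fmap] (rem_at i l) (unbump i j) = nth [fmap] l j.
  move=> jl ji; rewrite /rem_at nth_cat size_takel ?(ltnW il) //.
  case: (ltnP j i) => ij.
    have -> : unbump i j = j by rewrite /unbump; lia.
    by rewrite ij nth_take.
  have -> : unbump i j = j.-1 by rewrite /unbump; lia.
  have -> : (j.-1 < i)%N = false by lia.
  by rewrite nth_drop; congr nth; lia.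
have s0lt j : (j < size l)%N -> j != i -> (s0 j < (size l).-1)%N.
  by move=> jl ji; rewrite /s0 (negPf ji) /unbump; lia.
apply: isom_node => //.
- move=> j jl; rewrite nth_rcons sr.
  case: (eqVneq j i) => [->|ji].
    by rewrite /s0 eqxx ltnn eqxx; exact: isom_id.
  by rewrite s0lt // /s0 (negPf ji) nr //; exact: isom_id.
- move=> j k jl kl; case: (eqVneq j i) => [->|ji]; case: (eqVneq k i) => [->|ki] //.
  + by move=> E; have := s0lt k kl ki; rewrite -E s0i ltnn.
  + by move=> E; have := s0lt j jl ji; rewrite E s0i ltnn.
  + by rewrite /s0 (negPf ji) (negPf ki) /unbump; lia.
- move=> j; rewrite size_rcons sr => jl.
  have {}jl : (j < size l)%N by lia.
  case: (eqVneq j (size l).-1) => [->|jl1]; first by exists i; rewrite // /s0 eqxx.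
  exists (bump i j); first by rewrite /bump; lia.
  by rewrite /s0 eq_sym (negPf (neq_bump i j)) bumpK.
Qed.

Lemma lone_card T : is_tree T -> leaf T [::] = (tree_size T == 1%N).
Proof.
move=> tT; have [c Tc] := tree_root tT; apply/leafP/eqP => [[_ lf]|T1].
  apply/eqP; apply/negPn/negP => /(exists_leaf tT)[v /leafP[vT _] v0].
  case/lastP: v vT v0 => [//|v i] vT _; move: (lf i).
  by rewrite (mem_suffix_tree (u := v)) // cats1.
rewrite (tree_size1 tT Tc T1); split; first by rewrite mem_root_tree.
by move=> i; rewrite mem_root_tree.
Qed.

Lemma not_loneP T : is_tree T -> ~~ leaf T [::] -> exists2 v, leaf T v & v != [::].
Proof. by move=> tT; rewrite lone_card //; exact: exists_leaf. Qed.

End Isomorphism.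

(** * The generator acting on functions of trees *)

Section Generator.
Variables (R : realType) (C : finType) (lam mu : C -> C -> R).
Implicit Types (T S : tree C) (u v w x : vertex) (c : C) (f : tree C -> R).

(** The generator maps [f] to [Jsum f T - exit_rate T * f T]; births and deaths are kept apart
    because detailed balance exchanges them. *)
Definition Bsum f T : R :=
  \sum_(v <- domf T) \sum_c birth_rate lam T v c * f (birth T v c).

Definition Dsum f T : R :=
  \sum_(v <- domf T | leaf T v && (v != [::])) death_rate mu T v * f (death T v).

Definition Jsum f T : R := Bsum f T + Dsum f T.

Lemma sum_jumps f T : \sum_(j <- jumps lam mu T) j.2 * f j.1 = Jsum f T.
Proof.
rewrite /jumps big_cat big_allpairs_dep /= big_map big_filter; congr (_ + _).
by apply: eq_bigr => v _; rewrite big_enum.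
Qed.

Lemma exit_rateE T : exit_rate lam mu T = Jsum (fun=> 1) T.
Proof. by rewrite -sum_jumps; apply: eq_bigr => j _; rewrite mulr1. Qed.

Lemma rateE T T' : rate lam mu T T' = Jsum (fun S => (S == T')%:R) T.
Proof.
rewrite -sum_jumps /rate big_mkcond; apply: eq_bigr => j _.
by case: eqP; rewrite ?mulr1 ?mulr0.
Qed.

Lemma BsumD f g T : Bsum (fun S => f S + g S) T = Bsum f T + Bsum g T.
Proof.
rewrite -big_split; apply: eq_bigr => v _; rewrite -big_split.
by apply: eq_bigr => c _; rewrite mulrDr.
Qed.

Lemma DsumD f g T : Dsum (fun S => f S + g S) T = Dsum f T + Dsum g T.
Proof. by rewrite -big_split; apply: eq_bigr => v _; rewrite mulrDr. Qed.

Lemma JsumD f g T : Jsum (fun S => f S + g S) T = Jsum f T + Jsum g T.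
Proof. by rewrite /Jsum BsumD DsumD addrACA. Qed.

Lemma BsumZ k f T : Bsum (fun S => k * f S) T = k * Bsum f T.
Proof.
rewrite /Bsum mulr_sumr; apply: eq_bigr => v _; rewrite mulr_sumr.
by apply: eq_bigr => c _; rewrite mulrCA.
Qed.

Lemma DsumZ k f T : Dsum (fun S => k * f S) T = k * Dsum f T.
Proof. by rewrite /Dsum mulr_sumr; apply: eq_bigr => v _; rewrite mulrCA. Qed.

Lemma JsumZ k f T : Jsum (fun S => k * f S) T = k * Jsum f T.
Proof. by rewrite /Jsum BsumZ DsumZ mulrDr. Qed.

Lemma Jsum_cst k T : Jsum (fun=> k) T = k * exit_rate lam mu T.
Proof. by rewrite exit_rateE -JsumZ mulr1. Qed.

Hypotheses (lam_ge0 : forall c c', 0 <= lam c c') (mu_gt0 : forall c c', 0 < mu c c').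

Lemma birth_rate_ge0 T v c : 0 <= birth_rate lam T v c.
Proof. by rewrite /birth_rate; case: fnd. Qed.

Lemma death_rate_ge0 T v : 0 <= death_rate mu T v.
Proof. by rewrite /death_rate; case: fnd => // b; case: fnd => // c; exact: ltW. Qed.

Lemma ler_Bsum f g T :
  (forall v c, v \in domf T -> 0 < birth_rate lam T v c ->
     f (birth T v c) <= g (birth T v c)) ->
  Bsum f T <= Bsum g T.
Proof.
move=> fg; rewrite /Bsum !big_seq; apply: ler_sum => v vT; apply: ler_sum => c _.
have := birth_rate_ge0 T v c; rewrite le_eqVlt => /orP[/eqP<-|r0].
  by rewrite !mul0r.
by rewrite ler_wpM2l ?(ltW r0) // fg.
Qed.

Lemma ler_Dsum f g T :
  (forall v, leaf T v -> v != [::] -> f (death T v) <= g (death T v)) ->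
  Dsum f T <= Dsum g T.
Proof.
move=> fg; apply: ler_sum => v /andP[vT v0].
by rewrite ler_wpM2l ?death_rate_ge0 // fg.
Qed.

Lemma ler_Jsum f g T :
  (forall v c, v \in domf T -> 0 < birth_rate lam T v c ->
     f (birth T v c) <= g (birth T v c)) ->
  (forall v, leaf T v -> v != [::] -> f (death T v) <= g (death T v)) ->
  Jsum f T <= Jsum g T.
Proof. by move=> fgB fgD; rewrite lerD ?ler_Bsum ?ler_Dsum. Qed.

Lemma ler_Jsum_tree f g T : is_tree T -> (forall S, is_tree S -> f S <= g S) ->
  Jsum f T <= Jsum g T.
Proof.
move=> tT fg; apply: ler_Jsum => [v c vT _|v vT v0]; apply: fg.
  exact: is_tree_birth.
exact: is_tree_death.
Qed.

Lemma eq_Jsum_tree f g T : is_tree T -> (forall S, is_tree S -> f S = g S) ->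
  Jsum f T = Jsum g T.
Proof.
by move=> tT fg; apply/eqP; rewrite eq_le !ler_Jsum_tree // => S tS; rewrite fg.
Qed.

Definition iso_inv f : Prop :=
  forall S S', is_tree S -> is_tree S' -> iso S S' -> f S = f S'.

Lemma Bsum_iso f T T' : iso_inv f -> is_tree T -> is_tree T' -> iso T T' ->
  Bsum f T = Bsum f T'.
Proof.
move=> fi tT tT' [s sT]; have [_ _ _ sf _] := sT.
rewrite /Bsum -[RHS](perm_big _ (isom_perm sT)) big_map /= !big_seq.
apply: eq_bigr => v vT; apply: eq_bigr => c _.
rewrite /birth_rate sf //; congr (_ * _); apply: fi; last exact: isom_birth.
  exact: is_tree_birth.
by apply: is_tree_birth => //; exact: isom_mem vT.
Qed.

Lemma Dsum_iso f T T' : iso_inv f -> is_tree T -> is_tree T' -> iso T T' ->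
  Dsum f T = Dsum f T'.
Proof.
move=> fi tT tT' [s sT]; have [_ _ sb sf _] := sT.
rewrite /Dsum -[RHS](perm_big _ (isom_perm sT)) big_map /= [LHS]big_seq_cond [RHS]big_seq_cond.
apply: eq_big => [v|v /andP[vT /andP[lv v0]]].
  by case vT: (v \in domf T) => //=; rewrite (isom_leaf tT sT) // (isom_nil tT sT).
rewrite /death_rate sf // -sb // sf; last by case: tT => _; exact.
congr (_ * _); apply: fi.
- exact: is_tree_death.
- by apply: is_tree_death; rewrite // ?(isom_leaf tT sT) // (isom_nil tT sT).
- by exists s; exact: isom_death.
Qed.

Lemma Jsum_iso f T T' : iso_inv f -> is_tree T -> is_tree T' -> iso T T' ->
  Jsum f T = Jsum f T'.
Proof. by move=> fi tT tT' TT'; rewrite /Jsum (Bsum_iso fi tT tT') // (Dsum_iso fi tT tT'). Qed.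

Lemma exit_rate_iso T T' : is_tree T -> is_tree T' -> iso T T' ->
  exit_rate lam mu T = exit_rate lam mu T'.
Proof. by move=> *; rewrite !exit_rateE; apply: Jsum_iso. Qed.

Lemma lone_iso T T' : is_tree T -> is_tree T' -> iso T T' -> leaf T [::] = leaf T' [::].
Proof. by move=> tT tT' [s sT]; rewrite !lone_card // (isom_card sT). Qed.

(* Jumps outside the subtree at v do not move it. *)
Lemma Jsum_sub f T v b c : is_tree T -> v != [::] ->
  T.[? behead v] = Some b -> T.[? v] = Some c -> f (subtree v T) = 0 ->
  Jsum (fun S => f (subtree v S)) T =
  Jsum f (subtree v T) + (leaf (subtree v T) [::])%:R * (mu b c * f [fmap]).
Proof.
move=> tT v0 Tb Tc f0; have vT : v \in domf T by rewrite fnd_mem Tc.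
rewrite /Jsum -addrA; congr (_ + _).
  (* As [f] vanishes at the present subtree, the jumps that leave it unchanged contribute
     nothing. *)
  rewrite /Bsum (bigID (suffix v)) /= addrC big1 ?add0r; last first.
    move=> u vu; apply: big1 => d _.
    by rewrite sub_birth_out // f0 mulr0.
  rewrite sum_suffix; apply: eq_bigr => x _; apply: eq_bigr => d _.
  by rewrite sub_birth /birth_rate fnd_sub.
rewrite /Dsum (bigID (suffix v)) /= addrC big1 ?add0r; last first.
  by move=> u /andP[_ vu]; rewrite sub_death_out // f0 mulr0.
under eq_bigl => u do rewrite andbC.
rewrite big_mkcondr sum_suffix -big_mkcond.
(* The deletion of [v] itself is the one death that the chain on the subtree lacks, as its root is
   never deleted. It yields the killing term and leaves the empty map. *)
rewrite (bigID (pred1 [::])) /= addrC; congr (_ + _).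
  apply: eq_big => [[|i x]|[|i x]] /=; rewrite ?andbF ?andbT //.
    by rewrite -cat_cons leaf_sub.
  by move=> _; rewrite -cat_cons sub_death /death_rate /= !fnd_sub.
have -> : leaf (subtree v T) [::] = leaf T v by rewrite -leaf_sub.
rewrite big_mkcond (bigD1_seq [::]) ?fset_uniq ?mem_sub //= big1 ?addr0.
  rewrite eqxx v0 !andbT; case: ifP => lv; last by rewrite mul0r.
  rewrite mul1r /death_rate Tb Tc; congr (_ * f _).
  apply/fmapP => y; rewrite fnd_sub fnd_death fnd_fmap0.
  case: eqP => // yv; apply/fnd_notin/negP; case/lastP: y yv => // y i _.
  rewrite cat_rcons => /(mem_suffix_tree tT); apply/negP.
  by case/leafP: lv => _; exact.
by move=> x /negPf->; rewrite andbF.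
Qed.

End Generator.

(** * Weighted plane trees and Green's identity *)

Definition trees (C : finType) (l : seq (tree C)) : Prop :=
  forall T, T \in l -> is_tree T.

Lemma trees_cons (C : finType) (T : tree C) l : is_tree T -> trees l -> trees (T :: l).
Proof. by move=> tT tl S; rewrite inE => /orP[/eqP->|/tl]. Qed.

Section Integ.
Variables (R : realType) (A : Type).
Implicit Types (s : seq (R * A)) (f g : A -> R).

(** A list of weighted points stands for a finite measure; exchanging two integrals is exchanging
    two finite sums. *)
Definition integ s f : R := \sum_(p <- s) p.1 * f p.2.

Lemma integD s f g : integ s (fun x => f x + g x) = integ s f + integ s g.
Proof. by rewrite /integ -big_split; apply: eq_bigr => p _; rewrite mulrDr. Qed.

Lemma integZ s k f : integ s (fun x => k * f x) = k * integ s f.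
Proof. by rewrite /integ mulr_sumr; apply: eq_bigr => p _; rewrite mulrCA. Qed.

Lemma integ_sum s (I : Type) (r : seq I) (P : pred I) (F : I -> A -> R) :
  integ s (fun x => \sum_(i <- r | P i) F i x) = \sum_(i <- r | P i) integ s (F i).
Proof.
by rewrite /integ exchange_big; apply: eq_bigr => p _; rewrite mulr_sumr.
Qed.

Lemma integ0 s : integ s (fun=> 0) = 0.
Proof. by apply: big1 => p _; rewrite mulr0. Qed.

End Integ.

Lemma integ_swap (R : realType) (A B : Type) (s : seq (R * A)) (t : seq (R * B))
    (F : A -> B -> R) :
  integ s (fun x => integ t (F x)) = integ t (fun y => integ s (F^~ y)).
Proof.
rewrite /integ; under eq_bigr => p _ do rewrite mulr_sumr.
rewrite exchange_big; apply: eq_bigr => q _; rewrite mulr_sumr.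
by apply: eq_bigr => p _; rewrite mulrCA.
Qed.

Lemma eq_integ (R : realType) (A : eqType) (s : seq (R * A)) (f g : A -> R) :
  (forall p, p \in s -> f p.2 = g p.2) -> integ s f = integ s g.
Proof. by move=> fg; rewrite /integ !big_seq; apply: eq_bigr => p /fg->. Qed.

Section Weights.
Variables (R : realType) (C : finType) (rho : C -> C -> R) (K : nat).
Implicit Types (c d : C) (T : tree C) (l : seq (tree C)).

Section Forest.
Variable s : C -> seq (R * tree C).

Fixpoint forest c k : seq (R * seq (tree C)) :=
  if k is k'.+1 then
    flatten [seq [seq (rho c d * p.1 * q.1, p.2 :: q.2) | p <- s d, q <- forest c k']
            | d <- enum C]
  else [:: (1, [::])].

Lemma integ_forest0 c g : integ (forest c 0) g = g [::].
Proof. by rewrite /integ big_seq1 mul1r. Qed.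

Lemma integ_forestS c k g : integ (forest c k.+1) g =
  \sum_d rho c d * integ (s d) (fun x => integ (forest c k) (fun l => g (x :: l))).
Proof.
rewrite /integ big_flatten big_map big_enum; apply: eq_bigr => d _.
rewrite big_allpairs_dep /= mulr_sumr; apply: eq_bigr => p _.
by rewrite !mulr_sumr; apply: eq_bigr => q _; rewrite !mulrA.
Qed.

Lemma forest_trees c k q : (forall d p, p \in s d -> is_tree p.2) ->
  q \in forest c k -> trees q.2 /\ size q.2 = k.
Proof.
move=> st; elim: k q => [|k IH] q /=; first by rewrite inE => /eqP->.
case/flatten_mapP => d _ /allpairsP[[p r] /= [/st tp /IH[tr sr] ->]] /=.
by split; [exact: trees_cons | rewrite sr].
Qed.

End Forest.

(* The plane trees with a root of class c, depth at most D and fewer than K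
   children per vertex, with the weight \prod rho / \prod (number of children)!
   where the products range over the edges and over the vertices. *)
Fixpoint plane (D : nat) c : seq (R * tree C) :=
  if D is D'.+1 then
    flatten [seq [seq (p.1 / k`!%:R, node c p.2) | p <- forest (plane D') c k]
            | k <- iota 0 K]
  else [:: (1, node c [::])].

Lemma integ_plane0 c f : integ (plane 0 c) f = f (node c [::]).
Proof. by rewrite /integ big_seq1 mul1r. Qed.

Lemma integ_planeS D c f : integ (plane D.+1 c) f =
  \sum_(0 <= k < K) (k`!%:R)^-1 * integ (forest (plane D) c k) (fun l => f (node c l)).
Proof.
rewrite /integ big_flatten big_map /index_iota subn0; apply: eq_bigr => k _.
by rewrite big_map mulr_sumr; apply: eq_bigr => p _ /=; rewrite mulrA [_^-1 * _]mulrC.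
Qed.

Lemma plane_tree D c p : p \in plane D c -> is_tree p.2.
Proof.
elim: D c p => [|D IH] c p /=.
  by rewrite inE => /eqP-> /=; apply: is_tree_node => T.
case/flatten_mapP => k _ /mapP[q /(forest_trees IH)[tq _] ->] /=.
exact: is_tree_node.
Qed.

Lemma forest_plane D c k q : q \in forest (plane D) c k -> trees q.2 /\ size q.2 = k.
Proof. by apply: forest_trees => d p; exact: plane_tree. Qed.

Lemma leaf_node c l : trees l -> leaf (node c l) [::] = (l == [::]).
Proof.
move=> tl; rewrite lone_card ?tree_size_node //; last exact: is_tree_node.
case: l tl => [|T l] tl; first by rewrite big_nil.
have /tree_size_gt0 : is_tree T by apply: tl; rewrite mem_head.
by rewrite big_cons eqSS addn_eq0 lt0n => /negPf->.
Qed.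

(** At positive depth a lone root arises only from the term with no child, whose weight is 1;
    [0 < K] guarantees that this term is present. *)
Lemma integ_lone D c f : (0 < K)%N ->
  (forall S, is_tree S -> ~~ leaf S [::] -> f S = 0) ->
  integ (plane D c) f = f (root_tree c).
Proof.
move=> K0 f0; rewrite -node_nil; case: D => [|D]; first by rewrite integ_plane0.
rewrite integ_planeS big_ltn // fact0 invr1 mul1r integ_forest0.
rewrite big_nat_cond big1 ?addr0 // => k /andP[/andP[k0 _] _].
rewrite (eq_integ (g := fun=> 0)) ?integ0 ?mulr0 // => q /forest_plane[tq sq].
apply: f0; first exact: is_tree_node.
by rewrite leaf_node // -size_eq0 sq -lt0n.
Qed.

(** Exchangeability of the k+1 trees of a forest: a marked tree may be drawn first, independently of
    the others. The factor k+1 is what relates k! to (k+1)! in [green]. *)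
Lemma integ_pick D c k (F : tree C -> seq (tree C) -> R) :
  integ (forest (plane D) c k.+1)
    (fun l => \sum_(0 <= i < size l) F (nth [fmap] l i) (rem_at i l)) =
  k.+1%:R * \sum_d rho c d *
    integ (plane D d) (fun x => integ (forest (plane D) c k) (F x)).
Proof.
elim: k F => [|k IH] F.
  rewrite integ_forestS mul1r; apply: eq_bigr => d _; congr (_ * _).
  by apply: eq_integ => p _; rewrite !integ_forest0 /= big_nat1.
rewrite integ_forestS.
transitivity (\sum_d rho c d * integ (plane D d) (fun x =>
   integ (forest (plane D) c k.+1) (F x)) +
  \sum_d rho c d * integ (plane D d) (fun x =>
   integ (forest (plane D) c k.+1) (fun l =>
     \sum_(0 <= i < size l) F (nth [fmap] l i) (x :: rem_at i l)))).
  rewrite -big_split; apply: eq_bigr => d _ /=; rewrite -mulrDr -integD.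
  congr (_ * _); apply: eq_integ => p _; rewrite -integD; apply: eq_integ => q _.
  rewrite /= big_nat_recl //=; congr (F _ _ + _).
  by rewrite /rem_at /= drop0.
rewrite [k.+2%:R]mulrS mulrDl mul1r; congr (_ + _).
under eq_bigr => d _.
  rewrite (eq_integ (g := fun x => k.+1%:R * \sum_e rho c e *
    integ (plane D e) (fun y => integ (forest (plane D) c k) (fun l => F y (x :: l))))).
    rewrite integZ integ_sum mulrCA.
    over.
  by move=> p _; rewrite (IH (fun y l => F y (p.2 :: l))).
rewrite -mulr_sumr; congr (_ * _).
under [RHS]eq_bigr => e _.
  rewrite (eq_integ (g := fun y => \sum_d rho c d * integ (plane D d) (fun x =>
    integ (forest (plane D) c k) (fun l => F y (x :: l))))); last first.
    by move=> p _; rewrite integ_forestS.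
  rewrite integ_sum mulr_sumr.
  over.
rewrite exchange_big; apply: eq_bigr => d _; rewrite mulr_sumr; apply: eq_bigr => e _.
by rewrite !integZ integ_swap mulrCA.
Qed.

End Weights.

(** * Green's identity: births and deaths are in detailed balance *)

Section Green.
Variables (R : realType) (C : finType) (lam mu rho : C -> C -> R) (K : nat).
Hypothesis lamE : forall c d, lam c d = rho c d * mu c d.
Implicit Types (c d : C) (T : tree C) (l : seq (tree C)) (f h : tree C -> R).

Local Notation Bsum := (Bsum lam).
Local Notation Dsum := (Dsum mu).
Local Notation plane := (plane rho K).

(** A tree of size at most [m] has depth below [m] and fewer than [m] children, so functions
    vanishing beyond this size do not feel the truncations of [plane] when [m <= D] and [m <= K]. *)
Definition good m f : Prop :=
  iso_inv f /\ forall S, is_tree S -> (m < tree_size S)%N -> f S = 0.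

Definition good_forest m (g : seq (tree C) -> R) : Prop :=
  forall l1 l2, trees l1 -> trees l2 -> good m (fun x => g (l1 ++ x :: l2)).

Lemma trees_cat l1 T l2 : trees l1 -> is_tree T -> trees l2 -> trees (l1 ++ T :: l2).
Proof.
move=> t1 tT t2 S; rewrite mem_cat inE => /or3P[/t1//|/eqP->//|/t2//].
Qed.

(** The root accounts for one unit of size, hence the drop from [m.+1] to [m] that drives the
    induction of [green]. *)
Lemma good_node m c f : good m.+1 f -> good_forest m (fun l => f (node c l)).
Proof.
move=> [fi f0] l1 l2 t1 t2; split.
  move=> S S' tS tS' SS'; apply: fi; last apply: iso_node_set => //.
  - by apply: is_tree_node; apply: trees_cat.
  - by apply: is_tree_node; apply: trees_cat.
  - exact: trees_cat.
move=> S tS mS; have tl := trees_cat t1 tS t2.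
apply: f0; first exact: is_tree_node.
by rewrite tree_size_node // ltnS (leq_trans mS) // big_cat big_cons /=; lia.
Qed.

Lemma Bsum_node c l h : trees l -> Bsum h (node c l) =
  \sum_d lam c d * h (node c (rcons l (root_tree d))) +
  \sum_(0 <= i < size l) Bsum (fun x => h (node c (set_nth [fmap] l i x))) (nth [fmap] l i).
Proof.
move=> tl; rewrite /Bsum sum_node; congr (_ + _).
  by apply: eq_bigr => d _; rewrite birth_node0 // /birth_rate fnd_node0.
rewrite !big_nat; apply: eq_bigr => i /= il; apply: eq_bigr => u _.
by apply: eq_bigr => d _; rewrite birth_node // /birth_rate fnd_node.
Qed.

Lemma leaf_node_rcons c l u i : leaf (node c l) (rcons u i) = leaf (nth [fmap] l i) u.
Proof. by rewrite -cats1 leaf_sub sub_node. Qed.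

Definition root_mu c T : R := if T.[? [::]] is Some d then mu c d else 0.

(** The deletion of a lone child of the root is not a death for the grafted tree alone, whose root
    is never deleted; these deletions form the first sum. *)
Lemma Dsum_node c l h : trees l -> Dsum h (node c l) =
  \sum_(0 <= i < size l | leaf (nth [fmap] l i) [::])
     root_mu c (nth [fmap] l i) * h (death (node c l) [:: i]) +
  \sum_(0 <= i < size l) Dsum (fun x => h (node c (set_nth [fmap] l i x))) (nth [fmap] l i).
Proof.
move=> tl; rewrite /Dsum big_mkcond sum_node andbF add0r.
rewrite [X in _ = X + _]big_mkcond -big_split !big_nat; apply: eq_bigr => i /= il.
set T := nth _ _ _.
have T0 : [::] \in domf T by case: (tl T) => //; exact: mem_nth.
rewrite (bigD1_seq [::]) ?fset_uniq //=; congr (_ + _).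
  rewrite -[[:: i]]/(rcons [::] i) leaf_node_rcons -/T andbT; case: ifP => // _.
  by rewrite /death_rate /root_mu /= fnd_node0 -[[:: i]]/(rcons [::] i) fnd_node.
rewrite -big_mkcondr; apply: eq_big => [u|u /and3P[u0 _ _]].
  by rewrite leaf_node_rcons -/T; case: u => //=; rewrite andbF.
rewrite death_node //; congr (_ * _).
by case: u u0 => // k u _; rewrite /death_rate /= -rcons_cons !fnd_node.
Qed.

(** The balance assumed for a single tree is used with all the others frozen, one position after the
    other. *)
Lemma integ_coord D c k m (g h : seq (tree C) -> R) :
  (forall d f1 f2, good m f1 -> good m f2 ->
    integ (plane D d) (fun S => f1 S * Bsum f2 S) =
    integ (plane D d) (fun S => f2 S * Dsum f1 S)) ->
  good_forest m g -> good_forest m h ->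
  integ (forest rho (plane D) c k) (fun l => g l *
    \sum_(0 <= i < size l) Bsum (fun x => h (set_nth [fmap] l i x)) (nth [fmap] l i)) =
  integ (forest rho (plane D) c k) (fun l => h l *
    \sum_(0 <= i < size l) Dsum (fun x => g (set_nth [fmap] l i x)) (nth [fmap] l i)).
Proof.
move=> HD; elim: k g h => [|k IH] g h gg gh.
  by rewrite !integ_forest0 !big_geq // !mulr0.
rewrite !integ_forestS; apply: eq_bigr => d _; congr (_ * _).
transitivity (integ (plane D d) (fun x => integ (forest rho (plane D) c k) (fun l =>
    g (x :: l) * Bsum (fun y => h (y :: l)) x)) +
  integ (plane D d) (fun x => integ (forest rho (plane D) c k) (fun l => g (x :: l) *
    \sum_(0 <= i < size l) Bsum (fun y => h (x :: set_nth [fmap] l i y)) (nth [fmap] l i)))).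
  rewrite -integD; apply: eq_integ => p _; rewrite -integD; apply: eq_integ => q _.
  by rewrite /= big_nat_recl // mulrDr.
transitivity (integ (plane D d) (fun x => integ (forest rho (plane D) c k) (fun l =>
    h (x :: l) * Dsum (fun y => g (y :: l)) x)) +
  integ (plane D d) (fun x => integ (forest rho (plane D) c k) (fun l => h (x :: l) *
    \sum_(0 <= i < size l) Dsum (fun y => g (x :: set_nth [fmap] l i y)) (nth [fmap] l i)))); last first.
  rewrite -integD; apply: eq_integ => p _; rewrite -integD; apply: eq_integ => q _.
  by rewrite /= big_nat_recl // mulrDr.
congr (_ + _).
  rewrite integ_swap [RHS]integ_swap; apply: eq_integ => q /forest_plane[tq _].
  by apply: HD; [apply: (gg [::]) | apply: (gh [::])].
apply: eq_integ => p /plane_tree tp.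
apply: (IH (fun l => g (p.2 :: l)) (fun l => h (p.2 :: l))) => l1 l2 t1 t2.
  by apply: (gg (p.2 :: l1)) => //; exact: trees_cons.
by apply: (gh (p.2 :: l1)) => //; exact: trees_cons.
Qed.

(** Moves inside the subtrees at the root balance by induction on the depth. Births at a root with k
    children balance the deaths of lone children at a root with k+1 children, by [lam = rho * mu]
    and the exchangeability of the children. *)
Lemma green D m c f h : (m <= D)%N -> (m <= K)%N -> good m f -> good m h ->
  integ (plane D c) (fun S => f S * Bsum h S) =
  integ (plane D c) (fun S => h S * Dsum f S).
Proof.
elim: D m c f h => [|D IH] [|m] c f h // mD mK gf gh.
- have [[_ f0] [_ h0]] := (gf, gh).
  by rewrite !integ_plane0 f0 ?h0 ?mul0r ?tree_size_gt0 //; apply: is_tree_node.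
- have [[_ f0] [_ h0]] := (gf, gh).
  by apply: eq_integ => p /plane_tree tp; rewrite f0 ?h0 ?mul0r ?tree_size_gt0.
rewrite !integ_planeS.
pose FP := forest rho (plane D) c.
pose birth0 l := f (node c l) * \sum_d lam c d * h (node c (rcons l (root_tree d))).
pose death0 l := h (node c l) * \sum_(0 <= i < size l | leaf (nth [fmap] l i) [::])
     root_mu c (nth [fmap] l i) * f (death (node c l) [:: i]).
suff H : \sum_(0 <= k < K) (k`!%:R)^-1 * integ (FP k) birth0 =
         \sum_(0 <= k < K) (k`!%:R)^-1 * integ (FP k) death0.
  transitivity (\sum_(0 <= k < K) (k`!%:R)^-1 * integ (FP k) birth0 +
    \sum_(0 <= k < K) (k`!%:R)^-1 * integ (FP k) (fun l => f (node c l) *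
    \sum_(0 <= i < size l) Bsum (fun x => h (node c (set_nth [fmap] l i x))) (nth [fmap] l i))).
    rewrite -big_split; apply: eq_bigr => k _ /=; rewrite -mulrDr -integD; congr (_ * _).
    by apply: eq_integ => q /forest_plane[tq _]; rewrite Bsum_node // mulrDr.
  rewrite H; symmetry.
  transitivity (\sum_(0 <= k < K) (k`!%:R)^-1 * integ (FP k) death0 +
    \sum_(0 <= k < K) (k`!%:R)^-1 * integ (FP k) (fun l => h (node c l) *
    \sum_(0 <= i < size l) Dsum (fun x => f (node c (set_nth [fmap] l i x))) (nth [fmap] l i))).
    rewrite -big_split; apply: eq_bigr => k _ /=; rewrite -mulrDr -integD; congr (_ * _).
    by apply: eq_integ => q /forest_plane[tq _]; rewrite Dsum_node // mulrDr.
  congr (_ + _); apply: eq_bigr => k _; congr (_ * _); symmetry.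
  apply: (@integ_coord _ _ _ m); try exact: good_node.
  by move=> d f1 f2 *; apply: (IH m) => //; lia.
(* Contribution of the death of the lone child [x] placed last, leaving the forest [l]. *)
pose F x l := if leaf x [::] then
  root_mu c x * (f (node c l) * h (node c (rcons l x))) else 0.
have death0E k q : q \in FP k ->
    death0 q.2 = \sum_(0 <= i < size q.2) F (nth [fmap] q.2 i) (rem_at i q.2).
  case/forest_plane => tq _; rewrite /death0 mulr_sumr big_mkcond !big_nat.
  apply: eq_bigr => i /= il; rewrite /F; case: ifP => // lf.
  rewrite mulrCA; congr (_ * _); rewrite mulrC.
  set x := nth _ _ _ in lf *; set l' := rem_at _ _.
  have tx : is_tree x by apply: tq; exact: mem_nth.
  have tl' : trees l'.
    by move=> T; rewrite mem_cat => /orP[/mem_take|/mem_drop]; exact: tq.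
  have tlx : trees (rcons l' x) by rewrite -cats1; exact: trees_cat.
  have [s sq si] := iso_rem_at c tq il; rewrite -/x -/l' in sq.
  have [[fi _] [hi _]] := (gf, gh).
  have tn := is_tree_node c tq; have tn' := is_tree_node c tlx.
  have iq : [:: i] \in domf (node c q.2).
    by rewrite -[[:: i]]/(rcons [::] i) mem_node; case: tx.
  have lq : leaf (node c q.2) [:: i].
    by rewrite -[[:: i]]/(rcons [::] i) leaf_node_rcons.
  congr (_ * _); last by apply: hi => //; exists s.
  have [d xd] := tree_root tx.
  have xE : x = root_tree d.
    by apply: tree_size1 => //; apply/eqP; rewrite -lone_card.
  have sl' : (size q.2).-1 = size l'.
    by rewrite size_rem_at.
  rewrite -[in RHS](death_rcons c l' d) -sl' -si -xE; apply: fi.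
  - exact: is_tree_death.
  - by apply: is_tree_death; rewrite // ?(isom_leaf tn sq) // (isom_nil tn sq).
  - by exists s; apply: isom_death.
have K0 : (0 < K)%N by lia.
have -> : K = K.-1.+1 by lia.
(* Births with k children are matched with deaths with k+1 children. The last birth term vanishes
   because a root with [K] children is larger than [m], and the first death term is an empty sum. *)
rewrite big_nat_recr // [RHS]big_nat_recl //=.
rewrite [X in _ + X](_ : _ = 0) ?addr0; last first.
  rewrite (eq_integ (g := fun=> 0)) ?integ0 ?mulr0 // => q /forest_plane[tq sq].
  rewrite /birth0 big1 ?mulr0 // => d _; have [_ h0] := gh.
  have tr : trees (rcons q.2 (root_tree d)).
    by rewrite -cats1; apply: trees_cat => //; exact: is_tree_root_tree.
  rewrite h0 ?mulr0 ?tree_size_node //; first exact: is_tree_node.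
  rewrite ltnS; apply: (leq_trans mK).
  apply: (@leq_trans (\sum_(T <- rcons q.2 (root_tree d)) 1)%N).
    by rewrite sum1_size size_rcons sq; lia.
  by rewrite big_seq [leqRHS]big_seq; apply: leq_sum => T /tr; exact: tree_size_gt0.
have -> : integ (FP 0%N) death0 = 0.
  by rewrite integ_forest0 /death0 big_geq // mulr0.
rewrite mulr0 add0r; apply: eq_bigr => k _.
rewrite [in RHS](eq_integ (g := fun l => \sum_(0 <= i < size l)
  F (nth [fmap] l i) (rem_at i l)) (@death0E k.+1)).
(* The k+1 positions of the dying child cancel the last factor of (k+1)!. *)
rewrite integ_pick factS natrM invfM -mulrA.
rewrite [RHS]mulrCA mulKf ?pnatr_eq0 //; congr (_ * _).
rewrite (eq_integ (g := fun l => \sum_d f (node c l) *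
  (lam c d * h (node c (rcons l (root_tree d)))))); last first.
  by move=> q _; rewrite /birth0 mulr_sumr.
rewrite integ_sum; apply: eq_bigr => d _.
rewrite integ_lone //; last first.
  move=> x _ /negPf lx; rewrite (eq_integ (g := fun=> 0)) ?integ0 // => q _.
  by rewrite /F lx.
rewrite -integZ; apply: eq_integ => q _; rewrite /F.
have -> : leaf (root_tree d) [::].
  apply/leafP; split; first by rewrite mem_root_tree.
  by move=> i; rewrite mem_root_tree.
by rewrite /root_mu fnd_root_tree eqxx mulrCA lamE -!mulrA [mu c d * _]mulrCA.
Qed.

End Green.

(** * Total mass of the weights *)

Section RealSequences.
Variable R : realType.
Implicit Types (u : R ^nat) (x B : R).

Lemma cvg_sum_seq (I : eqType) (r : seq I) (f : I -> R ^nat) (l : I -> R) :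
  (forall i, i \in r -> f i @ \oo --> l i) ->
  (fun n => \sum_(i <- r) f i n) @ \oo --> \sum_(i <- r) l i.
Proof.
elim: r => [|i r IH] fl.
  by under eq_fun do rewrite big_nil; rewrite big_nil; exact: cvg_cst.
under eq_fun do rewrite big_cons; rewrite big_cons; apply: cvgD.
  by apply: fl; exact: mem_head.
by apply: IH => j jr; apply: fl; rewrite in_cons jr orbT.
Qed.

Lemma cvg_expr u x k : u @ \oo --> x -> (fun n => u n ^+ k) @ \oo --> x ^+ k.
Proof.
move=> ux; elim: k => [|k IH].
  by under eq_fun do rewrite expr0; exact: cvg_cst.
by under eq_fun do rewrite exprS; rewrite exprS; apply: cvgM.
Qed.

Lemma bounded_cvg u B : nondecreasing_seq u -> (forall n, u n <= B) -> cvgn u.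
Proof. by move=> u_nd uB; apply: nondecreasing_is_cvgn => //; exists B => _ [n _ <-]. Qed.

Lemma bounded_lim_le u B : nondecreasing_seq u -> (forall n, u n <= B) -> limn u <= B.
Proof. by move=> u_nd uB; apply: limr_le; [exact: bounded_cvg uB | exact: nearW]. Qed.

Definition exp_trunc K x : R := \sum_(0 <= k < K) (k`!%:R)^-1 * x ^+ k.

Lemma exp_truncE K x : exp_trunc K x = series (exp_coeff x) K.
Proof. by apply: eq_bigr => k _; rewrite /exp_coeff /= mulrC. Qed.

Lemma exp_trunc_le K x : 0 <= x -> exp_trunc K x <= expR x.
Proof.
move=> x0; rewrite exp_truncE; apply: nondecreasing_cvgn_le; last first.
  exact: is_cvg_series_exp_coeff.
apply/nondecreasing_seqP => n; rewrite seriesSr lerDl.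
by rewrite /exp_coeff /= mulr_ge0 ?exprn_ge0.
Qed.

Lemma exp_trunc_lim x B : (forall K, exp_trunc K x <= B) -> expR x <= B.
Proof.
move=> xB; apply: limr_le; first exact: is_cvg_series_exp_coeff.
by apply: nearW => K; rewrite -exp_truncE.
Qed.

Lemma ler_exp_trunc K K' x y : (K <= K')%N -> 0 <= x -> x <= y ->
  exp_trunc K x <= exp_trunc K' y.
Proof.
move=> KK' x0 xy; rewrite /exp_trunc [leRHS](@big_cat_nat _ _ _ K) //= -[leLHS]addr0.
have y0 := le_trans x0 xy.
rewrite lerD //; last by apply: sumr_ge0 => k _; rewrite mulr_ge0 ?exprn_ge0.
by apply: ler_sum => k _; rewrite ler_wpM2l ?lerXn2r.
Qed.

End RealSequences.

Section Mass.
Variables (R : realType) (C : finType) (rho : C -> C -> R).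
Hypothesis rho_ge0 : forall c d, 0 <= rho c d.
Implicit Types (c d : C) (K D m n : nat).

Lemma forest_ge0 s c k q : (forall d p, p \in s d -> 0 <= p.1) ->
  q \in @forest R C rho s c k -> 0 <= q.1.
Proof.
move=> s0; elim: k q => [|k IH] q /=; first by rewrite inE => /eqP->.
case/flatten_mapP => d _ /allpairsP[[p r] /= [/s0 p0 /IH r0 ->]] /=.
by rewrite !mulr_ge0.
Qed.

Lemma plane_ge0 K D c p : p \in plane rho K D c -> 0 <= p.1.
Proof.
elim: D c p => [|D IH] c p /=; first by rewrite inE => /eqP->.
case/flatten_mapP => k _ /mapP[q /(forest_ge0 IH) q0 ->] /=.
by rewrite divr_ge0.
Qed.

Lemma ler_integ (A : eqType) (s : seq (R * A)) (f g : A -> R) :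
  (forall p, p \in s -> 0 <= p.1) -> (forall p, p \in s -> f p.2 <= g p.2) ->
  integ s f <= integ s g.
Proof.
move=> s0 fg; rewrite /integ !big_seq; apply: ler_sum => p ps.
by rewrite ler_wpM2l ?s0 ?fg.
Qed.

Lemma integ_ge0 (A : eqType) (s : seq (R * A)) (f : A -> R) :
  (forall p, p \in s -> 0 <= p.1) -> (forall p, p \in s -> 0 <= f p.2) ->
  0 <= integ s f.
Proof. by move=> s0 f0; rewrite -(integ0 s); apply: ler_integ. Qed.

(** Every tree counted for the smaller parameters is counted with the same weight for the larger
    ones. [0 < K] matters: at positive depth and [K = 0] the list is empty, whereas depth 0 always
    carries the lone root. *)
Lemma integ_plane_mono K K' D D' c f : (0 < K)%N -> (K <= K')%N -> (D <= D')%N ->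
  (forall T, is_tree T -> 0 <= f T) ->
  integ (plane rho K D c) f <= integ (plane rho K' D' c) f.
Proof.
move=> K0 KK'; elim: D D' c f => [|D IH] [|D'] // c f DD' f0.
- rewrite integ_plane0 integ_planeS big_ltn ?(leq_trans K0) // fact0 invr1 mul1r.
  rewrite integ_forest0 lerDl; apply: sumr_ge0 => k _; rewrite mulr_ge0 //.
  apply: integ_ge0 => q; first by apply: forest_ge0 => d p; exact: plane_ge0.
  by move=> /forest_plane[tq _]; apply: f0; exact: is_tree_node.
rewrite !integ_planeS [leRHS](@big_cat_nat _ _ _ K) //= -[leLHS]addr0 lerD //; last first.
  apply: sumr_ge0 => k _; rewrite mulr_ge0 //.
  apply: integ_ge0 => q; first by apply: forest_ge0 => d p; exact: plane_ge0.
  by move=> /forest_plane[tq _]; apply: f0; exact: is_tree_node.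
apply: ler_sum => k _; rewrite ler_wpM2l //.
suff H (g : seq (tree C) -> R) : (forall l, trees l -> 0 <= g l) ->
    integ (forest rho (plane rho K D) c k) g <= integ (forest rho (plane rho K' D') c k) g.
  by apply: H => l tl; apply: f0; exact: is_tree_node.
elim: k g => [|k IHk] g g0.
  by rewrite !integ_forest0.
rewrite !integ_forestS; apply: ler_sum => d _; rewrite ler_wpM2l //.
apply: (@le_trans _ _ (integ (plane rho K D d)
   (fun x => integ (forest rho (plane rho K' D') c k) (fun l => g (x :: l))))).
  apply: ler_integ => p; first exact: plane_ge0.
  move=> /plane_tree tp; apply: IHk => l tl; apply: g0.
  exact: trees_cons.
apply: IH => // T tT; apply: integ_ge0 => q.
  by apply: forest_ge0 => e p; exact: plane_ge0.
move=> /forest_plane[tq _]; apply: g0.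
exact: trees_cons.
Qed.

Definition mass K D c : R := integ (plane rho K D c) (fun=> 1).

Lemma mass0 K c : mass K 0 c = 1.
Proof. by rewrite /mass integ_plane0. Qed.

(** The truncated form of Z_c = exp (\sum_d rho_cd Z_d): the mass of forests is a product over the
    positions of their trees. *)
Lemma massS K D c : mass K D.+1 c = exp_trunc K (\sum_d rho c d * mass K D d).
Proof.
rewrite /mass integ_planeS; apply: eq_bigr => k _; congr (_ * _).
elim: k => [|k IH]; first by rewrite integ_forest0 expr0.
rewrite integ_forestS exprS mulr_suml; apply: eq_bigr => d _.
rewrite -mulrA; congr (_ * _); rewrite IH mulrC -integZ.
by apply: eq_integ => p _; rewrite mulr1.
Qed.

Lemma mass_mono K K' D D' c : (0 < K)%N -> (K <= K')%N -> (D <= D')%N ->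
  mass K D c <= mass K' D' c.
Proof. by move=> *; apply: integ_plane_mono. Qed.

Lemma mass_ge0 K D c : 0 <= mass K D c.
Proof. by apply: integ_ge0 => p // /plane_ge0. Qed.

(** Induction on the depth. A supersolution is enough, which serves for the solutions of the system
    and also for the explicit bound of the sufficient condition. *)
Lemma mass_le_super y K D c :
  (forall c, \sum_d rho c d * expR (y d) <= y c) -> mass K D c <= expR (y c).
Proof.
move=> yS; have y0 c' : 0 <= y c'.
  by apply: le_trans (yS c'); apply: sumr_ge0 => d _; rewrite mulr_ge0 ?expR_ge0.
elim: D c => [|D IH] c; first by rewrite mass0 -expR0 ler_expR.
rewrite massS; apply: (le_trans (exp_trunc_le _ _)).
  by apply: sumr_ge0 => d _; rewrite mulr_ge0 ?mass_ge0.
rewrite ler_expR; apply: le_trans (yS c); apply: ler_sum => d _.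
by rewrite ler_wpM2l.
Qed.

Lemma diag_mass_nd c : nondecreasing_seq (fun m => mass m.+1 m c).
Proof. by move=> m n mn; apply: mass_mono. Qed.

(* The exponential generating function of the trees solves the system. *)
Lemma mass_solution :
  (forall c, exists B, forall m, mass m.+1 m c <= B) ->
  exists2 r, smallest_solution rho r &
    forall c, (fun m => mass m.+1 m c) @ \oo --> expR (r c).
Proof.
move=> /choice[B mB].
pose L c := limn (fun m => mass m.+1 m c).
have mL c : (fun m => mass m.+1 m c) @ \oo --> L c.
  exact: bounded_cvg (diag_mass_nd c) (mB c).
have mleL m c : mass m.+1 m c <= L c.
  by apply: (nondecreasing_cvgn_le (diag_mass_nd c)); apply/cvg_ex; exists (L c).
have L0 c : 0 <= L c by apply: le_trans (mleL 0%N c); exact: mass_ge0.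
pose r c := \sum_d rho c d * L d.
have rE c : expR (r c) = L c.
  apply/eqP; rewrite eq_le; apply/andP; split.
    (* The order [K] of the exponential series is fixed while the masses converge, and only then
       sent to infinity. *)
    apply: exp_trunc_lim => K.
    have : (fun m => exp_trunc K (\sum_d rho c d * mass m.+1 m d)) @ \oo -->
        exp_trunc K (r c).
      apply: cvg_sum_seq => k _; apply: cvgM; first exact: cvg_cst.
      apply: cvg_expr; apply: cvg_sum_seq => d _.
      by apply: cvgM; [exact: cvg_cst | exact: mL].
    move=> /cvgr_to_le; apply; exists K => // m /= Km.
    apply: (le_trans _ (mleL m.+1 c)); rewrite massS.
    apply: ler_exp_trunc; first by rewrite (leq_trans Km) // leqW.
      by apply: sumr_ge0 => d _; rewrite mulr_ge0 ?mass_ge0.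
    by apply: ler_sum => d _; rewrite ler_wpM2l ?mass_mono.
  apply: bounded_lim_le; first exact: diag_mass_nd.
  case=> [|m].
    by rewrite mass0 -expR0 ler_expR; apply: sumr_ge0 => d _; rewrite mulr_ge0.
  rewrite massS; apply: (le_trans (exp_trunc_le _ _)).
    by apply: sumr_ge0 => d _; rewrite mulr_ge0 ?mass_ge0.
  rewrite ler_expR; apply: ler_sum => d _; rewrite ler_wpM2l //.
  by apply: le_trans (mleL m.+1 d); exact: mass_mono.
exists r; last by move=> c; rewrite rE.
split=> [c|y ys c]; first by apply: eq_bigr => d _; rewrite rE.
rewrite ys; apply: ler_sum => d _; rewrite ler_wpM2l //.
apply: bounded_lim_le; first exact: diag_mass_nd.
by move=> m; apply: mass_le_super => c'; rewrite -ys.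
Qed.

End Mass.

(** * Absorption problems on trees of bounded size *)

Section Dirichlet.
Variables (R : realType) (C : finType) (lam mu : C -> C -> R) (kap : R).
Hypotheses (lam_ge0 : forall c c', 0 <= lam c c') (mu_gt0 : forall c c', 0 < mu c c').
Hypothesis kap_gt0 : 0 < kap.
Implicit Types (c d : C) (T : tree C) (f h : tree C -> R) (m n : nat).

Local Notation Bsum := (Bsum lam).
Local Notation Dsum := (Dsum mu).
Local Notation Jsum := (Jsum lam mu).
Local Notation q := (exit_rate lam mu).

Lemma Bsum_ge0 f T : (forall S, 0 <= f S) -> 0 <= Bsum f T.
Proof.
by move=> f0; do 2![apply: sumr_ge0 => ? _]; rewrite mulr_ge0 ?birth_rate_ge0.
Qed.

Lemma Dsum_ge0 f T : (forall S, 0 <= f S) -> 0 <= Dsum f T.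
Proof. by move=> f0; apply: sumr_ge0 => v _; rewrite mulr_ge0 ?death_rate_ge0. Qed.

Lemma Jsum_ge0 f T : (forall S, 0 <= f S) -> 0 <= Jsum f T.
Proof. by move=> f0; rewrite addr_ge0 ?Bsum_ge0 ?Dsum_ge0. Qed.

Lemma exit_rate_ge0 T : 0 <= q T.
Proof. by rewrite exit_rateE Jsum_ge0. Qed.

Lemma Dsum1_ge del T : (forall c d, del <= mu c d) -> is_tree T ->
  ~~ leaf T [::] -> del <= Dsum (fun=> 1) T.
Proof.
move=> delmu tT /(not_loneP tT)[v lv v0].
have vT : v \in domf T by case/leafP: lv.
rewrite /Dsum big_mkcond (bigD1_seq v) ?fset_uniq //= lv v0 mulr1 -[del]addr0 lerD //.
  have : behead v \in domf T by case: tT => _; exact.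
  move: vT; rewrite !fnd_mem /death_rate.
  by case: (T.[? v]) => // c; case: (T.[? _]) => // b _ _.
by apply: sumr_ge0 => w _; case: ifP => // _; rewrite mulr1 death_rate_ge0.
Qed.

Lemma mu_lower : exists2 del, 0 < del & forall c d, del <= mu c d.
Proof.
exists (\big[Num.min/1]_(p : C * C) mu p.1 p.2).
  by elim/big_ind: _ => // x y x0 y0; rewrite lt_min x0.
by move=> c d; rewrite (bigD1 (c, d)) //= ge_min lexx.
Qed.

Lemma exit_rate_gt0 T : is_tree T -> ~~ leaf T [::] -> 0 < q T.
Proof.
move=> tT lT; have [del del0 H] := mu_lower.
rewrite exit_rateE; apply: lt_le_trans del0 _; rewrite -[del]add0r.
by rewrite lerD ?Bsum_ge0 ?Dsum1_ge.
Qed.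

Definition lone T : R := (leaf T [::])%:R.

(** Exit rate of the chain killed at rate [kap] when it is a lone root. It is positive on every
    tree, even where the lone root has no birth. *)
Definition den T : R := q T + kap * lone T.

Lemma den_gt0 T : is_tree T -> 0 < den T.
Proof.
move=> tT; rewrite /den /lone; case lT: (leaf T [::]).
  by rewrite mulr1 ltr_wpDl ?exit_rate_ge0.
by rewrite mulr0 addr0 exit_rate_gt0 ?lT.
Qed.

Section Iteration.
Variables (m : nat) (s b : tree C -> R).
Hypotheses (s_iso : iso_inv s) (s_ge0 : forall T, 0 <= s T) (b_ge0 : forall T, 0 <= b T).
Hypothesis b_super : forall T, is_tree T -> (tree_size T <= m)%N ->
  s T + Jsum b T <= den T * b T.

Definition inside T : bool := (tree_size T <= m)%N && `[< is_tree T >].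

(** Value iteration for [den * f = s + Jsum f], with value 0 beyond size [m] and on maps that are
    not trees, in particular the empty one. It increases from 0 and stays below the supersolution
    [b]. *)
Fixpoint diter n T : R :=
  if n is n'.+1 then
    if inside T then (s T + Jsum (diter n') T) / den T else 0
  else 0.

Lemma diter_ge0 n T : 0 <= diter n T.
Proof.
elim: n T => [|n IH] T //=; case: ifP => // /andP[_ /asboolP tT].
apply: divr_ge0; last exact/ltW/den_gt0.
by apply: addr_ge0 => //; exact: Jsum_ge0.
Qed.

Lemma diter_nd T : nondecreasing_seq (diter^~ T).
Proof.
apply/nondecreasing_seqP => n; elim: n T => [|n IH] T; first exact: diter_ge0.
rewrite [leLHS]/= [leRHS]/=; case: ifP => // /andP[_ /asboolP tT].
by rewrite ler_pM2r ?invr_gt0 ?den_gt0 // lerD2l ler_Jsum.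
Qed.

Lemma diter_le n T : diter n T <= b T.
Proof.
elim: n T => [|n IH] T //=; case: ifP => // /andP[mT /asboolP tT].
rewrite ler_pdivrMr ?den_gt0 // mulrC; apply: le_trans (b_super tT mT).
by rewrite lerD2l ler_Jsum.
Qed.

Lemma diter_iso n : iso_inv (diter n).
Proof.
elim: n => [|n IH] S S' tS tS' SS' //=.
have cS : tree_size S' = tree_size S by case: SS' => f /isom_card.
have -> : inside S' = inside S.
  by rewrite /inside cS; congr andb; apply/asboolP/asboolP.
rewrite (s_iso tS tS' SS') (Jsum_iso lam mu IH tS tS' SS').
by rewrite /den /lone (exit_rate_iso lam mu tS tS' SS') (lone_iso tS tS' SS').
Qed.

Lemma diter_cvg T : diter^~ T @ \oo --> limn (diter^~ T).
Proof. by apply: bounded_cvg (diter_nd T) _ => n; exact: diter_le. Qed.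

(** The solution is the limit of the increasing iterates; the equation passes to it because [Jsum]
    is a finite sum. *)
Lemma dirichlet : exists f, [/\ good m f, f [fmap] = 0,
  forall T, is_tree T -> (tree_size T <= m)%N -> den T * f T = s T + Jsum f T
  & forall T, 0 <= f T <= b T].
Proof.
have d0 T : ~~ inside T -> limn (diter^~ T) = 0.
  move=> /negPf iT; apply/lim_near_cst => //; apply: nearW => -[|n] //=.
  by rewrite iT.
exists (fun T => limn (diter^~ T)); split.
- split=> [S S' tS tS' SS'|S tS mS].
    by congr (limn _); apply/funext => n; exact: diter_iso.
  by apply: d0; rewrite /inside leqNgt mS.
- by apply: d0; rewrite negb_and orbC asboolF // => -[]; rewrite domf0.
- move=> T tT mT.
  have : (fun n => s T + Jsum (diter n) T) @ \oo -->
      s T + Jsum (fun T => limn (diter^~ T)) T.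
    apply: cvgD; first exact: cvg_cst.
    under eq_fun do rewrite -sum_jumps; rewrite -sum_jumps.
    by apply: cvg_sum_seq => j _; apply: cvgM; [exact: cvg_cst | exact: diter_cvg].
  apply: cvg_unique => //=.
  have -> : (fun n => s T + Jsum (diter n) T) = fun n => den T * diter n.+1 T.
    apply/funext => n /=; rewrite /inside mT asboolT //=.
    by rewrite mulrC mulfVK // gt_eqF ?den_gt0.
  apply: cvgM; first exact: cvg_cst.
  by have := @diter_cvg T; rewrite -cvg_shiftS.
move=> T; rewrite bounded_lim_le ?andbT; first last.
- by move=> n; exact: diter_le.
- exact: diter_nd.
by apply: limr_ge; [exact: diter_cvg | apply: nearW => n; exact: diter_ge0].
Qed.

End Iteration.

Lemma birth_total_le T : Bsum (fun=> 1) T <= (\sum_b \sum_c lam b c) * (tree_size T)%:R.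
Proof.
rewrite /tree_size -sum1_size natr_sum mulr_sumr; apply: ler_sum => v _; rewrite mulr1.
rewrite /birth_rate; case: fnd => [b|]; last first.
  rewrite big1 => [|c _]; last by rewrite mul0r.
  by do 2![apply: sumr_ge0 => ? _].
under eq_bigr do rewrite mulr1.
rewrite [leRHS](bigD1 b) //= lerDl; by do 2![apply: sumr_ge0 => ? _].
Qed.

(** The supersolution is A (1 - th^size). A death lowers it from size k+1 by A th^k (1 - th), and a
    birth raises it by [th] times as much. For [th] small, deaths thus outweigh births up to size
    [m], however large the birth rates are. *)
Lemma exit_super m : exists M b, [/\ forall T, 0 <= b T, forall T, b T <= M
  & forall T, is_tree T -> (tree_size T <= m)%N -> 1 + Jsum b T <= den T * b T].
Proof.
have [del0 del00 delmu0] := mu_lower.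
pose del := Num.min del0 kap.
have del_gt0 : 0 < del by rewrite lt_min del00.
have delmu c d : del <= mu c d by rewrite ge_min delmu0.
pose Lam := \sum_b \sum_c lam b c.
have Lam0 : 0 <= Lam by do 2![apply: sumr_ge0 => ? _].
(* The denominator gives both [th <= 1/2] and [th * (Lam * m) <= del / 2], where [Lam * m] bounds
   the total birth rate up to size [m]. *)
pose th := del / (2 * (Lam * m%:R + del)).
have Lm0 : 0 <= Lam * m%:R by rewrite mulr_ge0.
have den0 : 0 < 2 * (Lam * m%:R + del) by rewrite mulr_gt0 // ltr_wpDl.
have th0 : 0 < th by rewrite divr_gt0.
have th12 : th <= 2^-1.
  by rewrite ler_pdivrMr // mulrA mulVf ?mul1r ?lerDr.
have thL : th * (Lam * m%:R) <= del / 2.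
  rewrite /th mulrAC ler_pdivrMr //; nra.
(* With [1 - th >= 1/2] and a net rate of at least [del / 2], the decrease is at least
   [A * th ^+ m * del / 4], which is 1. *)
pose A := 4 / (del * th ^+ m).
have A0 : 0 < A by rewrite divr_gt0 // mulr_gt0 // exprn_gt0.
have th1 : th <= 1 by lra.
exists A, (fun T => A * (1 - th ^+ tree_size T)); split.
- by move=> T; rewrite mulr_ge0 ?(ltW A0) // subr_ge0 exprn_ile1 // ltW.
- by move=> T; rewrite ger_pMr // lerBlDr lerDl exprn_ge0 // ltW.
move=> T tT mT; set b := fun T => _.
have [k kE] : exists k, tree_size T = k.+1 by exists (tree_size T).-1; rewrite prednK ?tree_size_gt0.
have -> : Jsum b T = A * (1 - th ^+ k.+2) * Bsum (fun=> 1) T +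
                     A * (1 - th ^+ k) * Dsum (fun=> 1) T.
  rewrite -BsumZ -DsumZ /Jsum; congr (_ + _).
    apply: eq_bigr => v _; apply: eq_bigr => c _.
    by rewrite mulr1 /b tree_size_birth kE.
  rewrite /Dsum big_seq_cond [RHS]big_seq_cond; apply: eq_bigr => v /andP[vT _].
  by rewrite mulr1 /b; have := tree_size_death vT; rewrite kE => -[<-].
have Bq : th * Bsum (fun=> 1) T <= del / 2.
  apply: le_trans thL; rewrite ler_wpM2l ?(ltW th0) //.
  apply: le_trans (birth_total_le T) _; rewrite -/Lam ler_wpM2l // ler_nat //.
have Dq : del <= Dsum (fun=> 1) T + kap * lone T.
  rewrite /lone; case lT: (leaf T [::]); last by rewrite mulr0 addr0 Dsum1_ge ?lT.
  by rewrite mulr1 (@le_trans _ _ kap) ?ge_min ?lexx ?orbT // lerDr Dsum_ge0.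
(* Killing acts only at size 1, that is [k = 0], where it costs [A * (1 - th)], the same as a
   death. *)
have lk : kap * lone T * th ^+ k = kap * lone T.
  rewrite /lone; case lT: (leaf T [::]); last by rewrite mulr0 mul0r.
  by move: lT; rewrite lone_card // kE eqSS => /eqP->; rewrite expr0 mulr1.
have thk : th ^+ m <= th ^+ k.
  have km : (k <= m)%N by move: mT; rewrite kE; exact: ltnW.
  by rewrite ler_wiXn2l // ltW.
have key : 1 <= A * th ^+ k * (1 - th) * (del / 2).
  have Am : A * (del * th ^+ m) = 4 by rewrite divfK // gt_eqF // mulr_gt0 // exprn_gt0.
  have : A * (del * th ^+ m) <= A * (del * th ^+ k) by rewrite ler_pM2l // ler_pM2l.
  rewrite Am; set X := A * _ => X4.
  have -> : A * th ^+ k * (1 - th) * (del / 2) = X * (1 - th) / 2 by rewrite /X; field.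
  have : X * 2^-1 <= X * (1 - th) by rewrite ler_wpM2l; lra.
  lra.
rewrite /den exit_rateE /b kE /Jsum !exprS.
move: Bq Dq lk key; set B1 := Bsum _ _; set D1 := Dsum _ _; set L1 := kap * lone T.
set t := th ^+ k => Bq Dq lk key.
have t0 : 0 < t by rewrite exprn_gt0.
have H : A * t * (1 - th) * (del / 2) <= A * t * (1 - th) * (D1 + L1 - th * B1).
  rewrite ler_wpM2l //; last lra.
  by rewrite mulr_ge0 ?subr_ge0 // mulr_ge0 // ltW.
have Lt : (1 - th * t) * L1 = t * (1 - th) * L1.
  have -> : (1 - th * t) * L1 = L1 - th * (L1 * t) by ring.
  have -> : t * (1 - th) * L1 = L1 * t - th * (L1 * t) by ring.
  by rewrite lk.
have -> : (B1 + D1 + L1) * (A * (1 - th * t)) =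
    (B1 + D1) * (A * (1 - th * t)) + A * ((1 - th * t) * L1) by ring.
by rewrite Lt; lra.
Qed.

Lemma exit_problem m : exists M h, [/\ good m h, h [fmap] = 0,
  forall T, is_tree T -> (tree_size T <= m)%N -> den T * h T = 1 + Jsum h T
  & forall T, 0 <= h T <= M].
Proof.
have [M [b [b0 bM bs]]] := exit_super m.
have [h [gh h0 hE hb]] := @dirichlet m (fun=> 1) b (fun _ _ _ _ _ => erefl)
  (fun=> ler01) b0 bs.
exists M, h; split=> // T; have /andP[-> hT] := hb T.
exact: le_trans (bM T).
Qed.

Lemma absorption_problem m : exists f, [/\ good m f, f [fmap] = 0,
  forall T, is_tree T -> (tree_size T <= m)%N -> den T * f T = kap * lone T + Jsum f T
  & forall T, 0 <= f T <= 1].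
Proof.
apply: dirichlet.
- by move=> S S' tS tS' SS'; rewrite /lone (lone_iso tS tS' SS').
- by move=> T; rewrite mulr_ge0 ?(ltW kap_gt0) // /lone.
- by move=> T.
- by move=> T _ _; rewrite -exit_rateE mulr1 addrC.
Qed.

Variables (rho : C -> C -> R).
Hypothesis lamE : forall c d, lam c d = rho c d * mu c d.

(* Green's identity: the mean absorption time from the single root is the
   integral of the absorption probabilities. *)
Lemma exit_root K D m c h f : (0 < m)%N -> (m <= D)%N -> (m <= K)%N ->
  good m h -> good m f ->
  (forall T, is_tree T -> (tree_size T <= m)%N -> den T * h T = 1 + Jsum h T) ->
  (forall T, is_tree T -> (tree_size T <= m)%N -> den T * f T = kap * lone T + Jsum f T) ->
  kap * h (root_tree c) = integ (plane rho K D c) f.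
Proof.
move=> m0 mD mK gh gf hE fE.
have [[_ h0] [_ f0]] := (gh, gf).
have : integ (plane rho K D c) (fun S => f S * Jsum h S) =
       integ (plane rho K D c) (fun S => h S * Jsum f S).
  transitivity (integ (plane rho K D c) (fun S => f S * Bsum h S) +
                integ (plane rho K D c) (fun S => f S * Dsum h S)).
    by rewrite -integD; apply: eq_integ => p _; rewrite mulrDr.
  rewrite (green lamE c mD mK gf gh) -(green lamE c mD mK gh gf) addrC -integD.
  by apply: eq_integ => p _; rewrite mulrDr.
(* Once the two equations are substituted, the terms [den * f * h] cancel. What remains is the
   integral of [f] on one side and, on the other, that of [kap * h] restricted to the lone root. *)
rewrite (eq_integ (g := fun S => den S * f S * h S + (-1) * f S)); last first.
  move=> p /plane_tree tp; case: (leqP (tree_size p.2) m) => mp.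
    have -> : Jsum h p.2 = den p.2 * h p.2 - 1 by rewrite hE // addrC addKr.
    ring.
  by rewrite f0 // !(mul0r, mulr0) addr0.
rewrite [RHS](eq_integ (g := fun S => den S * f S * h S + (-1) * (kap * (lone S * h S)))); last first.
  move=> p /plane_tree tp; case: (leqP (tree_size p.2) m) => mp.
    have -> : Jsum f p.2 = den p.2 * f p.2 - kap * lone p.2 by rewrite fE // addrC addKr.
    ring.
  by rewrite h0 // !(mul0r, mulr0) addr0.
rewrite !integD !integZ (@integ_lone _ _ _ _ _ _ (fun S => lone S * h S)); last 2 first.
- exact: leq_trans mK.
- by move=> S _ /negPf lS; rewrite /lone lS mul0r.
rewrite /lone.
have -> : leaf (root_tree c) [::].
  by rewrite lone_card ?tree_size_root_tree //; exact: is_tree_root_tree.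
by rewrite mul1r !mulN1r => /addrI/oppr_inj.
Qed.

End Dirichlet.

(** * The killed jump chain *)

Section Killing.
Variables (R : realType) (C : finType) (lam mu : C -> C -> R).
Hypotheses (lam_ge0 : forall c c', 0 <= lam c c') (mu_gt0 : forall c c', 0 < mu c c').
Implicit Types (c d : C) (T S : tree C) (f g h : tree C -> R) (a : pred (tree C)).
Implicit Types (m n k : nat).

Local Notation Jsum := (Jsum lam mu).
Local Notation q := (exit_rate lam mu).

(* kill a g n T is the mean of g at the n-th jump from T on the event that
   the chain did not visit a. *)
Fixpoint kill a g n T : R :=
  if a T then 0 else if n is n'.+1 then Jsum (kill a g n') T / q T else g T.

(** [survive] is the probability that the states 0 to [n] avoid [a]. [spent] adds the mean holding
    times 1 / q of the states 0 to [n - 1] met before [a], so that it is a real number whatever the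
    hitting time. *)
Definition survive a n T : R := kill a (fun=> 1) n T.
Definition spent a n T : R := \sum_(0 <= k < n) kill a (fun S => (q S)^-1) k T.

Lemma kill_target a g n T : a T -> kill a g n T = 0.
Proof. by case: n => [|n] /= ->. Qed.

Lemma kill_ge0 a g n T : (forall S, 0 <= g S) -> 0 <= kill a g n T.
Proof.
move=> g0; elim: n T => [|n IH] T /=; case: ifP => // _.
by rewrite divr_ge0 ?exit_rate_ge0 // Jsum_ge0.
Qed.

Lemma spent_ge0 a n T : 0 <= spent a n T.
Proof.
by apply: sumr_ge0 => k _; apply: kill_ge0 => S; rewrite invr_ge0 exit_rate_ge0.
Qed.

Lemma spent_target a n T : a T -> spent a n T = 0.
Proof. by move=> aT; apply: big1 => k _; rewrite kill_target. Qed.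

Lemma JsumM f T (k : R) : Jsum (fun S => f S * k) T = Jsum f T * k.
Proof. by rewrite mulrC -JsumZ; congr Jsum; apply/funext => S; rewrite mulrC. Qed.

Lemma Jsum_bigsum n (F : nat -> tree C -> R) T :
  Jsum (fun S => \sum_(0 <= k < n) F k S) T = \sum_(0 <= k < n) Jsum (F k) T.
Proof.
rewrite -sum_jumps; under eq_bigr do rewrite mulr_sumr.
by rewrite exchange_big; apply: eq_bigr => k _; rewrite sum_jumps.
Qed.

Lemma spentS a n T : ~~ a T ->
  spent a n.+1 T = (1 + Jsum (spent a n) T) / q T.
Proof.
move=> aT; rewrite /spent big_nat_recl //= (negPf aT) mulrDl mul1r; congr (_ + _).
by rewrite Jsum_bigsum mulr_suml.
Qed.

Lemma spent_le a n T : spent a n T <= spent a n.+1 T.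
Proof.
rewrite /spent big_nat_recr //= lerDl; apply: kill_ge0 => S.
by rewrite invr_ge0 exit_rate_ge0.
Qed.

Definition closed (Inv : tree C -> Prop) : Prop :=
  [/\ forall T, Inv T -> is_tree T,
      forall T v c, Inv T -> v \in domf T -> 0 < birth_rate lam T v c -> Inv (birth T v c)
    & forall T v, Inv T -> leaf T v -> v != [::] -> Inv (death T v)].

Lemma closed_is_tree : closed (@is_tree C).
Proof. by split=> // *; [exact: is_tree_birth | exact: is_tree_death]. Qed.

Lemma ler_Jsum_closed Inv f g T : closed Inv -> Inv T ->
  (forall S, Inv S -> f S <= g S) -> Jsum f T <= Jsum g T.
Proof.
move=> [_ ib id] iT fg; apply: ler_Jsum => //.
  by move=> v c vT r0; apply: fg; exact: ib.
by move=> v lv v0; apply: fg; exact: id.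
Qed.

Lemma survive_ge0 a n T : 0 <= survive a n T.
Proof. exact: kill_ge0. Qed.

Lemma kill_mono a a' g n T : (forall S, a S -> a' S) -> (forall S, 0 <= g S) ->
  kill a' g n T <= kill a g n T.
Proof.
move=> aa g0; elim: n T => [|n IH] T /=.
  by case aT: (a T); [rewrite aa | case: ifP].
case aT: (a T); first by rewrite aa.
case: ifP => _; first by rewrite divr_ge0 ?exit_rate_ge0 // Jsum_ge0 // => S; exact: kill_ge0.
by rewrite ler_wpM2r ?invr_ge0 ?exit_rate_ge0 // ler_Jsum.
Qed.

Lemma spent_mono a a' n T : (forall S, a S -> a' S) -> spent a' n T <= spent a n T.
Proof.
move=> aa; apply: ler_sum => k _; apply: kill_mono => // S.
by rewrite invr_ge0 exit_rate_ge0.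
Qed.

Definition max_rate : R := 1 + \sum_b \sum_c lam b c + \sum_b \sum_c mu b c.

Lemma max_rate_gt0 : 0 < max_rate.
Proof.
rewrite /max_rate -addrA ltr_wpDr // addr_ge0 //; do 2![apply: sumr_ge0 => ? _] => //.
exact: ltW.
Qed.

Lemma exit_rate_le T : q T <= max_rate * (tree_size T)%:R.
Proof.
rewrite exit_rateE mulrDl lerD //.
  apply: le_trans (birth_total_le lam_ge0 T) _.
  by rewrite ler_wpM2r // lerDr.
rewrite /tree_size -sum1_size natr_sum mulr_sumr /Dsum big_mkcond; apply: ler_sum => v _.
have mu0 : 0 <= \sum_b \sum_c mu b c by do 2![apply: sumr_ge0 => ? _]; exact: ltW.
rewrite !mulr1; case: ifP => // _; rewrite /death_rate.
case: fnd => // b; case: fnd => // c.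
rewrite (bigD1 b) //= (bigD1 c) //= -addrA lerDl addr_ge0 //.
  by apply: sumr_ge0 => *; exact: ltW.
by do 2![apply: sumr_ge0 => ? _]; exact: ltW.
Qed.

(** After [n] jumps the size is at most [tree_size T + n], so the exit rate is at most [max_rate]
    times this. *)
Lemma kill_survive Inv a n T : closed Inv -> (forall S, Inv S -> ~~ a S -> 0 < q S) ->
  Inv T -> survive a n T / (max_rate * (tree_size T + n)%:R) <= kill a (fun S => (q S)^-1) n T.
Proof.
move=> cI qI; have [tI _ _] := cI.
have Q0 := max_rate_gt0.
elim: n T => [|n IH] T iT; rewrite /survive /=; case: ifPn => [_|aT]; rewrite ?mul0r //.
  by rewrite mul1r addn0 lef_pV2 ?exit_rate_le ?posrE ?qI ?mulr_gt0 // ltr0n tree_size_gt0 //; exact: tI.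
rewrite mulrAC ler_pM2r ?invr_gt0 ?qI // -JsumM.
apply: (ler_Jsum _ _) => //; case: cI => _ ib id.
  move=> v c vT r0; apply: le_trans (IH _ (ib _ _ _ iT vT r0)).
  by rewrite tree_size_birth addSnnS.
move=> v lv v0; apply: le_trans (IH _ (id _ _ iT lv v0)).
have vT : v \in domf T by case/leafP: lv.
have dT : is_tree (death T v) by apply: is_tree_death => //; exact: tI.
have t0 := tree_size_gt0 dT.
rewrite ler_wpM2l ?survive_ge0 // lef_pV2 ?posrE ?mulr_gt0 ?ltr0n ?addn_gt0 ?t0 ?tree_size_gt0 //; last exact: tI.
by rewrite ler_pM2l // ler_nat (tree_size_death vT); lia.
Qed.

(* As the size grows by at most 1 per jump, the mean holding times are at least
   of the order of the terms of the harmonic series. *)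
Lemma survive_to0 Inv a T B : closed Inv -> (forall S, Inv S -> ~~ a S -> 0 < q S) ->
  Inv T -> (forall n, spent a n T <= B) ->
  forall e, 0 < e -> exists n, survive a n T <= e.
Proof.
move=> cI qI iT uB e e0; apply: contrapT => /forallNP H.
have Q0 := max_rate_gt0.
have t0 : (0 < tree_size T)%N by apply: tree_size_gt0; case: cI => + _ _; exact.
have k0 : 0 < e / (max_rate * (tree_size T)%:R) by rewrite divr_gt0 ?mulr_gt0 ?ltr0n.
(* If survival stays above [e], then [spent] dominates a multiple of the harmonic sums, since
   [tree_size T + k <= tree_size T * k.+1]. *)
apply: (@dvg_harmonic R); apply: (@bounded_cvg _ _ (B / (e / (max_rate * (tree_size T)%:R)))).
  by apply/nondecreasing_seqP => n; rewrite seriesSr lerDl /harmonic /= invr_ge0.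
move=> n; rewrite ler_pdivlMr //; apply: le_trans (uB n).
rewrite /series /= mulr_suml; apply: ler_sum => k _.
apply: le_trans (kill_survive k cI qI iT).
have /negP := H k; rewrite -ltNge => ek.
apply: (@le_trans _ _ (e / (max_rate * (tree_size T + k)%:R))); last first.
  by rewrite ler_wpM2r ?(ltW ek) // invr_ge0 mulr_ge0 // ltW.
rewrite mulrCA ler_pM2l // -invfM lef_pV2 ?posrE ?mulr_gt0 ?ltr0n ?addn_gt0 ?t0 //.
rewrite mulrCA ler_pM2l // -natrM ler_nat; nia.
Qed.

End Killing.

(** * Comparison along a subtree *)

Section Lifetime.
Variables (R : realType) (C : finType) (lam mu : C -> C -> R).
Hypotheses (lam_ge0 : forall c c', 0 <= lam c c') (mu_gt0 : forall c c', 0 < mu c c').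
Implicit Types (T S : tree C) (f g h : tree C -> R) (a : pred (tree C)).
Implicit Types (m n k : nat).

Local Notation Jsum := (Jsum lam mu).
Local Notation q := (exit_rate lam mu).
Local Notation rate := (rate lam mu).
Local Notation spent := (spent lam mu).
Local Notation survive := (survive lam mu).

Lemma JsumB f g T : Jsum (fun S => f S - g S) T = Jsum f T - Jsum g T.
Proof.
have -> : (fun S => f S - g S) = fun S => f S + (-1) * g S.
  by apply/funext => S; rewrite mulN1r.
by rewrite JsumD JsumZ mulN1r.
Qed.

Lemma rate_ge0 T T' : 0 <= rate T T'.
Proof. by rewrite rateE Jsum_ge0. Qed.

Lemma rate_le_Jsum f T T' : (forall S, 0 <= f S) -> rate T T' * f T' <= Jsum f T.
Proof.
move=> f0; rewrite rateE -JsumM; apply: ler_Jsum => // [v c _ _|v _ _].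
  by case: eqP => [->|_]; rewrite ?mul1r ?mul0r.
by case: eqP => [->|_]; rewrite ?mul1r ?mul0r.
Qed.

Lemma rate_le_exit T T' : rate T T' <= q T.
Proof. by have := @rate_le_Jsum (fun=> 1) T T' (fun=> ler01); rewrite mulr1 -exit_rateE. Qed.

Section Subtree.
Variables (v : vertex) (b c : C).
Hypothesis v0 : v != [::].

Local Notation kap := (mu b c).
Local Notation den := (den lam mu kap).
Local Notation lone := (@lone R C).

(** Nothing more is required once [v] has disappeared: its address may be used again with other
    classes, and the comparison stops at that moment. *)
Definition tracked T : Prop :=
  is_tree T /\ (v \in domf T -> T.[? v] = Some c /\ T.[? behead v] = Some b).

Definition absent T : bool := v \notin domf T.

Lemma tracked_birth T u d : tracked T -> v \in domf T -> u \in domf T ->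
  tracked (birth T u d).
Proof.
move=> [tT tv] vT uT; split; first exact: is_tree_birth.
have [Tc Tb] := tv vT.
have nb w : w \in domf T -> (w == newborn T u) = false.
  by apply: contraTF => /eqP->; exact: newborn_notin.
by rewrite !fnd_birth !nb //; case: tT => _; exact.
Qed.

Lemma tracked_death T u : tracked T -> v \in domf T -> leaf T u -> u != [::] ->
  tracked (death T u).
Proof.
move=> [tT tv] vT lu u0; split; first exact: is_tree_death.
have tD := is_tree_death tT lu u0; have [Tc Tb] := tv vT.
move=> vD; have := vD; rewrite mem_death => /andP[/negPf vu _].
have : behead v \in domf (death T u) by case: tD => _; exact.
by rewrite mem_death => /andP[/negPf bu _]; rewrite !fnd_death vu bu.
Qed.

Lemma ler_Jsum_tracked f g T : tracked T -> v \in domf T ->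
  (forall S, tracked S -> (tree_size S <= (tree_size T).+1)%N -> f S <= g S) ->
  Jsum f T <= Jsum g T.
Proof.
move=> tT vT fg; apply: ler_Jsum => // [u d uT _|u lu u0]; apply: fg.
- exact: tracked_birth.
- by rewrite tree_size_birth.
- exact: tracked_death.
have /tree_size_death -> : u \in domf T by case/leafP: lu.
by rewrite -addn2 leq_addr.
Qed.

Lemma sub_absent T : v \notin domf T -> is_tree T -> subtree v T = [fmap].
Proof.
move=> vT tT; apply/fmapP => x; rewrite fnd_sub fnd_fmap0 fnd_notin //.
by apply: contra vT; exact: mem_suffix_tree.
Qed.

(** [Jsum_sub] is applied to [f] minus its value at the present subtree. Seen through the subtree,
    the chain is the one killed at rate [mu b c], which sends it to the empty map. *)
Lemma Jsum_sub_gap f T : tracked T -> v \in domf T ->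
  Jsum (fun S => f (subtree v S)) T = q T * f (subtree v T) + Jsum f (subtree v T)
    - den (subtree v T) * f (subtree v T) + kap * lone (subtree v T) * f [fmap].
Proof.
move=> [tT tv] vT; have [Tc Tb] := tv vT.
pose g S := f S - f (subtree v T).
have := @Jsum_sub _ _ lam mu g T v b c tT v0 Tb Tc; rewrite {1}/g subrr.
move=> /(_ erefl); rewrite /g !JsumB !Jsum_cst /den /lone => E.
by apply/eqP; rewrite -subr_eq0; move/eqP: E; rewrite -subr_eq0 => /eqP E; apply/eqP;
  rewrite -E; ring.
Qed.

Lemma sub_tracked T : tracked T -> v \in domf T ->
  is_tree (subtree v T) /\ (tree_size (subtree v T) <= tree_size T)%N.
Proof. by move=> [tT _] vT; split; [exact: is_tree_sub | exact: tree_size_sub]. Qed.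

Lemma tracked_exit_gt0 T : tracked T -> ~~ absent T -> 0 < q T.
Proof.
move=> [tT _] /negPn vT; apply: exit_rate_gt0 => //; rewrite lone_card //.
apply/negP => /eqP T1; have [e Te] := tree_root tT.
by move: vT; rewrite (tree_size1 tT Te T1) mem_root_tree (negPf v0).
Qed.

Variable (m : nat) (h f : tree C -> R) (M : R).
Hypotheses (h_nil : h [fmap] = 0) (gh : good m h) (gf : good m f).
Hypothesis hE : forall T, is_tree T -> (tree_size T <= m)%N -> den T * h T = 1 + Jsum h T.
Hypothesis fE : forall T, is_tree T -> (tree_size T <= m)%N ->
  den T * f T = kap * lone T + Jsum f T.
Hypotheses (h_bnd : forall T, 0 <= h T <= M) (f_bnd : forall T, 0 <= f T <= 1).

Lemma Jsum_exit T : tracked T -> v \in domf T -> (tree_size (subtree v T) <= m)%N ->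
  Jsum (fun S => h (subtree v S)) T = q T * h (subtree v T) - 1.
Proof.
move=> tT vT mT; have [tS _] := sub_tracked tT vT.
by rewrite Jsum_sub_gap // hE // h_nil; ring.
Qed.

(** The size cannot exceed [m] within [n] jumps, so the truncated problem counts at least the time
    spent during these jumps. *)
Lemma spent_le_exit n T : tracked T -> (tree_size T + n <= m)%N ->
  spent absent n T <= h (subtree v T).
Proof.
elim: n T => [|n IH] T tT mT; first by rewrite /spent big_geq //; case/andP: (h_bnd (subtree v T)).
have [aT|aT] := boolP (absent T).
  by rewrite spent_target //; case/andP: (h_bnd (subtree v T)).
have q0 := tracked_exit_gt0 tT aT; move/negPn: (aT) => vT.
rewrite spentS // ler_pdivrMr // mulrC -lerBrDl.
have [_ sT] := sub_tracked tT vT.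
rewrite -Jsum_exit //; last by rewrite (leq_trans sT) // (leq_trans _ mT) // leq_addr.
apply: ler_Jsum_tracked => // S tS ST; apply: IH => //.
by rewrite (leq_trans _ mT) // -addSnnS leq_add2r.
Qed.

(** After [n] jumps the time still to come is at most [M], and it is counted only if [v] is still
    alive. *)
Lemma exit_le_spent n T : tracked T ->
  h (subtree v T) <= spent absent n T + M * survive absent n T.
Proof.
elim: n T => [|n IH] T tT.
  rewrite /spent big_geq // add0r /survive /=; case: ifPn => [aT|_].
    by rewrite sub_absent ?h_nil ?mulr0 //; case: tT.
  by rewrite mulr1; case/andP: (h_bnd (subtree v T)).
have [aT|aT] := boolP (absent T).
  by rewrite sub_absent ?h_nil ?addr_ge0 ?mulr_ge0 ?spent_ge0 ?survive_ge0 //;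
    [case/andP: (h_bnd [fmap]) => /le_trans; apply | case: tT].
have q0 := tracked_exit_gt0 tT aT; move/negPn: (aT) => vT.
have [tS sT] := sub_tracked tT vT.
have [mT|mT] := leqP (tree_size (subtree v T)) m; last first.
  have [_ h0] := gh; rewrite h0 // addr_ge0 ?mulr_ge0 ?spent_ge0 ?survive_ge0 //.
  by case/andP: (h_bnd [fmap]) => /le_trans; apply.
rewrite spentS // /survive /= (negPf aT) mulrA -mulrDl ler_pdivlMr // mulrC.
rewrite -addrA -lerBlDl -Jsum_exit // -JsumZ -JsumD.
by apply: ler_Jsum_tracked => // S tS' _; exact: IH.
Qed.

(** If [v] dies within [n] jumps, the size has had no time to exceed [m], so absorption comes before
    the exit. *)
Lemma absorb_ge_survive n T : tracked T -> v \in domf T -> (tree_size T + n <= m)%N ->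
  1 - survive absent n T <= f (subtree v T).
Proof.
(* The empty map stands for the dead vertex, where absorption has occurred. The value 1 there makes
   [f' (subtree v _)] harmonic as long as [v] is alive and its subtree has size at most [m]. *)
pose f' S := if S == [fmap] then 1 else f S.
have f'E S : is_tree S -> f' S = f S.
  by rewrite /f'; case: eqP => // -> [+ _]; rewrite domf0.
suff H : tracked T -> (tree_size T + n <= m)%N -> 1 - survive absent n T <= f' (subtree v T).
  move=> tT vT mT; rewrite -f'E; first exact: H.
  by case: (sub_tracked tT vT).
elim: n T => [|n IH] T tT mT.
  rewrite /survive /=; case: ifPn => [aT|aT].
    by rewrite sub_absent ?subr0 /f' ?eqxx //; case: tT.
  move/negPn: (aT) => vT; rewrite subrr f'E; last by case: (sub_tracked tT vT).
  by case/andP: (f_bnd (subtree v T)).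
have [aT|aT] := boolP (absent T).
  by rewrite /survive kill_target // sub_absent ?subr0 /f' ?eqxx //; case: tT.
have q0 := tracked_exit_gt0 tT aT; move/negPn: (aT) => vT.
have [tS sT] := sub_tracked tT vT.
rewrite /survive /= (negPf aT) lerBlDr -lerBlDl ler_pdivlMr // mulrBl mul1r.
have mS : (tree_size (subtree v T) <= m)%N.
  by rewrite (leq_trans sT) // (leq_trans _ mT) // leq_addr.
have JE : Jsum (fun S => f' (subtree v S)) T = q T * f' (subtree v T).
  rewrite Jsum_sub_gap // [in den _ * _]f'E // fE // /f' eqxx -/(f' _).
  rewrite (@eq_Jsum_tree _ _ _ _ lam_ge0 mu_gt0 f' f) //; ring.
rewrite [f' _ * _]mulrC -JE -[q T]mul1r -Jsum_cst -JsumB.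
apply: ler_Jsum_tracked => // S tS' ST.
rewrite lerBlDr -lerBlDl; apply: IH => //.
by rewrite (leq_trans _ mT) // -addSnnS leq_add2r.
Qed.

End Subtree.

End Lifetime.

(** * Lifetime of a new leaf *)

Section Family.
Variables (R : realType) (C : finType) (lam mu rho : C -> C -> R).
Hypotheses (lam_ge0 : forall c c', 0 <= lam c c') (mu_gt0 : forall c c', 0 < mu c c').
Hypothesis lamE : forall c d, lam c d = rho c d * mu c d.
Hypothesis rho_ge0 : forall c d, 0 <= rho c d.
Implicit Types (b c d : C) (T S : tree C) (a : pred (tree C)) (m n k : nat).

Local Notation Jsum := (Jsum lam mu).
Local Notation q := (exit_rate lam mu).
Local Notation rate := (rate lam mu).
Local Notation spent := (spent lam mu).
Local Notation mass := (mass rho).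
Local Notation plane := (plane rho).

(** [h] and [f] are those of the overview, for the killing rate [kap] and the size bound [m]; [M] is
    some bound on [h], which may depend on [m]. *)
Record solves (kap : R) m (M : R) (h f : tree C -> R) : Prop := Solves {
  exit_nil : h [fmap] = 0;
  exit_good : good m h;
  exit_eqn : forall T, is_tree T -> (tree_size T <= m)%N ->
    den lam mu kap T * h T = 1 + Jsum h T;
  exit_bnd : forall T, 0 <= h T <= M;
  absorb_good : good m f;
  absorb_eqn : forall T, is_tree T -> (tree_size T <= m)%N ->
    den lam mu kap T * f T = kap * lone R T + Jsum f T;
  absorb_bnd : forall T, 0 <= f T <= 1 }.

Lemma solves_family kap : 0 < kap -> exists (M : nat -> R) (h f : nat -> tree C -> R),
  forall m, solves kap m (M m) (h m) (f m).
Proof.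
move=> kap0.
have /choice[M /choice[h H]] := exit_problem lam_ge0 mu_gt0 kap0.
have /choice[f F] := absorption_problem lam_ge0 mu_gt0 kap0.
exists M, h, f => m; case: (H m) => gh h0 hE hb; case: (F m) => gf _ fE fb.
by split.
Qed.

Section Solved.
Variables (kap : R) (M : nat -> R) (h f : nat -> tree C -> R).
Hypothesis kap_gt0 : 0 < kap.
Hypothesis hf : forall m, solves kap m (M m) (h m) (f m).

Lemma exit_root_diag m c : (0 < m)%N ->
  kap * h m (root_tree c) = integ (plane m.+1 m c) (f m).
Proof.
move=> m0; have [_ gh hE _ gf fE _] := hf m.
by apply: (exit_root lamE _ m0) => //; exact: leqnSn.
Qed.

Lemma exit_root_le m c : (0 < m)%N -> kap * h m (root_tree c) <= mass m.+1 m c.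
Proof.
move=> m0; rewrite exit_root_diag //; apply: ler_integ => p; first exact: plane_ge0.
by move=> _; have [_ _ _ _ _ _ /(_ p.2) /andP[]] := hf m.
Qed.

Lemma birth_rate_rate S v d : birth_rate lam S v d <= rate S (birth S v d).
Proof.
have [vS|vS] := boolP (v \in domf S); last first.
  by rewrite /birth_rate fnd_notin // rate_ge0.
rewrite rateE -[leLHS]addr0 lerD ?Dsum_ge0 //.
rewrite /Bsum (bigD1_seq v) ?fset_uniq //= (bigD1 d) //= eqxx mulr1 -addrA lerDl.
rewrite addr_ge0 //; first by apply: sumr_ge0 => *; rewrite mulr_ge0 ?birth_rate_ge0.
by do 2![apply: sumr_ge0 => ? _]; rewrite mulr_ge0 ?birth_rate_ge0.
Qed.

(** The first move of the killed chain from [S] leads to [S'] with probability [rate S S' / den S],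
    so [1 - f m S'] is at most [den S / rate S S'] times [1 - f m S]. *)
Lemma absorb_step S S' : is_tree S -> 0 < rate S S' ->
  (f^~ S) @ \oo --> (1 : R) -> (f^~ S') @ \oo --> (1 : R).
Proof.
move=> tS r0 fS.
have : (fun m => 1 - (den lam mu kap S / rate S S') * (1 - f m S)) @ \oo --> (1 : R).
  rewrite -[X in _ --> X]subr0 -(mulr0 (den lam mu kap S / rate S S')) -(subrr 1).
  by apply: cvgB; [exact: cvg_cst | apply: cvgMr; apply: cvgB => //; exact: cvg_cst].
move=> H; apply: (squeeze_cvgr _ H (cvg_cst _)).
exists (tree_size S) => // m /= Sm; have [_ _ _ _ gf fE fb] := hf m.
have /andP[f0 ->] := fb S'; rewrite andbT.
rewrite lerBlDl -lerBlDr mulrAC ler_pdivlMr // mulrC.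
have : rate S S' * (1 - f m S') <= Jsum (fun T => 1 - f m T) S.
  apply: (@rate_le_Jsum _ _ _ _ lam_ge0 mu_gt0 (fun T => 1 - f m T)) => T.
  by rewrite subr_ge0; case/andP: (fb T).
move/le_trans; apply; rewrite JsumB -exit_rateE.
have -> : Jsum (f m) S = den lam mu kap S * f m S - kap * lone R S.
  by rewrite fE // addrC addKr.
rewrite /den; lra.
Qed.

End Solved.

(** Births alone suffice to reach the trees of nonzero weight, and they carry the limit 1 of [f]
    from the lone root to all of these. *)
Inductive grows : tree C -> tree C -> Prop :=
| grows_refl S : grows S S
| grows_birth S v d S' : v \in domf S -> 0 < birth_rate lam S v d ->
    grows (birth S v d) S' -> grows S S'.

Lemma grows_trans S1 S2 S3 : grows S1 S2 -> grows S2 S3 -> grows S1 S3.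
Proof.
elim=> // S v d S' vS r0 _ IH /IH; exact: grows_birth vS r0.
Qed.

Lemma grows_node c l1 (x x' : tree C) l2 : grows x x' ->
  grows (node c (l1 ++ x :: l2)) (node c (l1 ++ x' :: l2)).
Proof.
elim=> {x x'} [x|x v d x' vx r0 _ IH]; first exact: grows_refl.
have nx : nth [fmap] (l1 ++ x :: l2) (size l1) = x.
  by rewrite nth_cat ltnn subnn.
apply: (@grows_birth _ (rcons v (size l1)) d).
- by rewrite mem_node nx.
- by rewrite /birth_rate fnd_node nx.
rewrite birth_node ?nx; last by rewrite size_cat /= addnS ltnS leq_addr.
suff -> : set_nth [fmap] (l1 ++ x :: l2) (size l1) (birth x v d) = l1 ++ birth x v d :: l2 by [].
by elim: (l1) => //= y l ->.
Qed.

(** A nonzero weight has nonzero factors [rho], hence positive birth rates along every edge. *)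
Lemma plane_grows K D c p : p \in plane K D c -> p.1 != 0 -> grows (root_tree c) p.2.
Proof.
rewrite -node_nil; elim: D c p => [|D IH] c p /=.
  by rewrite inE => /eqP-> _; exact: grows_refl.
case/flatten_mapP => k _ /mapP[r rk ->] /=.
rewrite mulf_eq0 negb_or => /andP[r0 _].
(* The children are built from left to right: each appears as a lone root after the finished ones
   [l1] and is then grown completely. *)
suff : forall l1, trees l1 -> grows (node c l1) (node c (l1 ++ r.2)) by move/(_ [::]); apply.
elim: k r rk r0 => [|k IHk] r /=.
  by rewrite inE => /eqP-> _ l1 _; rewrite cats0; exact: grows_refl.
case/flatten_mapP => d _ /allpairsP[[p' r'] /= [pD rk ->]] /=.
rewrite !mulf_eq0 !negb_or => /andP[/andP[rho0 p0] r0] l1 tl1.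
apply: (@grows_trans _ (node c (rcons l1 (root_tree d)))).
  apply: (@grows_birth _ [::] d); first exact: mem_node0.
    by rewrite /birth_rate fnd_node0 lamE mulr_gt0 // lt0r rho0 rho_ge0.
  by rewrite birth_node0 //; exact: grows_refl.
apply: (@grows_trans _ (node c (rcons l1 p'.2))).
  by rewrite -!cats1; apply: grows_node; rewrite -node_nil; exact: IH pD p0.
rewrite -cat_rcons; apply: IHk => //.
by rewrite -cats1; apply: trees_cat => //; exact: plane_tree pD.
Qed.

Lemma absorb_grows kap M h f S S' :
  (forall m, solves kap m (M m) (h m) (f m)) -> is_tree S -> grows S S' ->
  (f^~ S) @ \oo --> (1 : R) -> (f^~ S') @ \oo --> (1 : R).
Proof.
move=> hf + g; elim: g => // {}S v d {}S' vS r0 _ IH tS fS.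
apply: IH; first exact: is_tree_birth.
apply: (absorb_step hf tS _ fS).
exact: lt_le_trans r0 (birth_rate_rate _ _ _).
Qed.

(** The truncation [n] is fixed while [m] grows: on the finitely many trees of [plane n.+1 n c] with
    nonzero weight [f m] tends to 1, while its integral is at most the one over [plane m.+1 m c],
    which is [kap * h m] at the lone root. *)
Lemma mass_le_exit kap M h f c B : 0 < kap ->
  (forall m, solves kap m (M m) (h m) (f m)) ->
  (f^~ (root_tree c)) @ \oo --> (1 : R) -> (forall m, h m (root_tree c) <= B) ->
  forall n, mass n.+1 n c <= kap * B.
Proof.
move=> kap0 hf f1 hB n.
have : (fun m => integ (plane n.+1 n c) (f m)) @ \oo --> mass n.+1 n c.
  (* Trees of weight 0 are discarded, as convergence of [f] to 1 is only known along births of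
     positive rate. *)
  have E g : integ (plane n.+1 n c) g =
      \sum_(p <- [seq p <- plane n.+1 n c | p.1 != 0]) p.1 * g p.2.
    rewrite big_filter big_mkcond; apply: eq_bigr => p _.
    by case: eqP => //= ->; rewrite mul0r.
  under eq_fun do rewrite E; rewrite /mass E.
  have sub1 (p : R * tree C) : p \in [seq p <- plane n.+1 n c | p.1 != 0] ->
      (f^~ p.2) @ \oo --> (1 : R).
    rewrite mem_filter => /andP[p0 pP].
    apply: (absorb_grows hf (is_tree_root_tree c) _ f1).
    exact: plane_grows pP p0.
  by apply: cvg_sum_seq => p /sub1 fp; apply: cvgMr.
move=> /cvgr_to_le; apply; exists n.+1 => // m /= nm.
apply: (@le_trans _ _ (kap * h m (root_tree c))); last by rewrite ler_pM2l.
rewrite (exit_root_diag hf) ?(leq_trans _ nm) //.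
apply: integ_plane_mono => //; first by rewrite ltnS ltnW.
  exact: ltnW.
by move=> T _; have [_ _ _ _ _ _ /(_ T) /andP[]] := hf m.
Qed.

Section NewLeaf.
Variables (v : vertex) (b c : C) (T : tree C).
Hypotheses (v0 : v != [::]) (tT : tracked v b c T) (vT : v \in domf T).
Hypothesis subT : subtree v T = root_tree c.

Let kap_gt0 : 0 < mu b c := mu_gt0 b c.

Lemma spent_le_mass n B : (forall m, mass m.+1 m c <= B) ->
  spent (absent v) n T <= B / mu b c.
Proof.
move=> mB; have [M [h [f hf]]] := solves_family kap_gt0.
pose m := (tree_size T + n)%N.
have m0 : (0 < m)%N by rewrite addn_gt0 tree_size_gt0 //; case: tT.
have [h0 gh hE hb gf fE fb] := hf m.
have := spent_le_exit lam_ge0 mu_gt0 v0 h0 hE hb tT (leqnn m).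
rewrite subT => /le_trans; apply; rewrite ler_pdivlMr // mulrC.
exact: le_trans (exit_root_le hf c m0) (mB m).
Qed.

(** A bounded mean time makes [v] die almost surely, by [survive_to0]. Then [f] tends to 1 at the
    lone root, and [h] is at most [B] there, up to an error made small by the decay of survival. *)
Lemma mass_le_spent B : (forall n, spent (absent v) n T <= B) ->
  forall n, mass n.+1 n c <= mu b c * B.
Proof.
move=> sB; have [M [h [f hf]]] := solves_family kap_gt0.
have qI S : is_tree S -> ~~ absent v S -> 0 < q S.
  move=> tS /negPn vS; apply: exit_rate_gt0 => //; rewrite lone_card //.
  apply/negP => /eqP S1; have [e Se] := tree_root tS.
  by move: vS; rewrite (tree_size1 tS Se S1) mem_root_tree (negPf v0).
have sv := survive_to0 lam_ge0 mu_gt0 (closed_is_tree lam) qI (proj1 tT) sB.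
apply: (mass_le_exit kap_gt0 hf).
  apply/cvgrPdist_le => e e0; have [n sn] := sv _ e0.
  exists (tree_size T + n)%N => // m /= mn.
  have [h0 gh hE hb gf fE fb] := hf m.
  have := absorb_ge_survive lam_ge0 mu_gt0 v0 fE fb tT vT mn.
  rewrite subT => H; have /andP[_ f1] := fb (root_tree c).
  rewrite ger0_norm ?subr_ge0 // lerBlDl -lerBlDr.
  by apply: le_trans H; rewrite lerD2l lerN2.
move=> m; have [h0 gh hE hb gf fE fb] := hf m.
have M0 : 0 <= M m by have /andP[/le_trans H /H] := hb T.
apply/ler_addgt0Pr => e e0.
(* The number of jumps is chosen after [m], since the bound [M m] depends on it. *)
have [n sn] := sv (e / (M m + 1)) (divr_gt0 e0 (ltr_wpDl M0 ltr01)).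
have := exit_le_spent lam_ge0 mu_gt0 v0 h0 gh hE hb n tT.
rewrite subT => /le_trans; apply; rewrite lerD //.
apply: (@le_trans _ _ (M m * (e / (M m + 1)))); first by rewrite ler_wpM2l.
rewrite mulrCA ger_pMr // ler_pdivrMr ?mul1r ?lerDl //.
by rewrite ltr_wpDl.
Qed.

End NewLeaf.

End Family.

(** * Hitting times of reachable trees *)

Section Recurrence.
Variables (R : realType) (C : finType) (lam mu rho : C -> C -> R).
Hypotheses (lam_ge0 : forall c c', 0 <= lam c c') (mu_gt0 : forall c c', 0 < mu c c').
Hypothesis lamE : forall c d, lam c d = rho c d * mu c d.
Hypothesis rho_ge0 : forall c d, 0 <= rho c d.
Implicit Types (b c d : C) (T S x y z : tree C) (a : pred (tree C)) (m n k : nat).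

Local Notation Jsum := (Jsum lam mu).
Local Notation q := (exit_rate lam mu).
Local Notation rate := (rate lam mu).
Local Notation spent := (spent lam mu).
Local Notation mass := (mass rho).
Local Notation reachable := (reachable lam mu).

Lemma rate_jump S S' : 0 < rate S S' ->
  (exists v d, [/\ v \in domf S, 0 < birth_rate lam S v d & S' = birth S v d])
  \/ exists2 v, leaf S v && (v != [::]) & S' = death S v.
Proof.
move=> r0; apply: contrapT => H; move: r0; apply/negP; rewrite -leNgt rateE.
rewrite -(mul0r (q S)) -Jsum_cst; apply: ler_Jsum => // [v d vS b0|v lv v0].
  by case: eqP => // E; case: H; left; exists v, d.
by case: eqP => // E; case: H; right; exists v; rewrite ?lv.
Qed.

Lemma death_rate_gt0 S v : is_tree S -> leaf S v -> v != [::] -> 0 < death_rate mu S v.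
Proof.
move=> [_ Sb] /leafP[vS _] _; have := Sb _ vS; move: vS.
by rewrite !fnd_mem /death_rate; case: (S.[? v]) => // c; case: (S.[? behead v]).
Qed.

Lemma death_rate_rate S v : leaf S v -> v != [::] -> death_rate mu S v <= rate S (death S v).
Proof.
move=> lv v0; have vS : v \in domf S by case/leafP: lv.
rewrite rateE -[leLHS]add0r lerD ?Bsum_ge0 //.
rewrite /Dsum big_mkcond (bigD1_seq v) ?fset_uniq //= lv v0 eqxx mulr1 lerDl.
by apply: sumr_ge0 => w _; case: ifP => // _; rewrite mulr_ge0 ?death_rate_ge0.
Qed.

Lemma reachable_refl T : reachable T T. Proof. by exists [::]. Qed.

Lemma reachable_rcons S T T' : reachable S T -> 0 < rate T T' -> reachable S T'.
Proof.
move=> [p [pS <-]] r0; exists (rcons p T'); rewrite rcons_path last_rcons.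
by split=> //; apply/andP.
Qed.

Lemma reachable_ind_r S (P : tree C -> Prop) : P S ->
  (forall T T', reachable S T -> P T -> 0 < rate T T' -> P T') ->
  forall T, reachable S T -> P T.
Proof.
move=> PS Pstep T [p]; elim/last_ind: p T => [|p T' IH] T /=; first by move=> [_ <-].
rewrite rcons_path last_rcons => -[/andP[pS r0] <-].
by apply: Pstep (r0); [exists p | apply: IH].
Qed.

Lemma reachable_ind_l T (P : tree C -> Prop) : P T ->
  (forall S S', 0 < rate S S' -> reachable S' T -> P S' -> P S) ->
  forall S, reachable S T -> P S.
Proof.
move=> PT Pstep S [p]; elim: p S => [|S' p IH] S /=; first by move=> [_ ->].
move=> [/andP[r0 pS'] pT].
by apply: Pstep (r0) _ _; [exists p | apply: IH].
Qed.

Lemma rate_tree S S' : is_tree S -> 0 < rate S S' -> is_tree S'.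
Proof.
move=> tS /rate_jump[[v [d [vS _ ->]]]|[v /andP[lv v0] ->]].
  exact: is_tree_birth.
exact: is_tree_death.
Qed.

Lemma rate_root S S' : is_tree S -> 0 < rate S S' -> S'.[? [::]] = S.[? [::]].
Proof.
move=> tS /rate_jump[[v [d [vS _ ->]]]|[v /andP[lv v0] ->]].
  by rewrite fnd_birth.
by rewrite fnd_death eq_sym (negPf v0).
Qed.

Section Root.
Variable c0 : C.
Local Notation o := (root_tree c0).

Lemma reach_tree T : reachable o T -> is_tree T /\ T.[? [::]] = Some c0.
Proof.
apply: (reachable_ind_r (P := fun T => is_tree T /\ T.[? [::]] = Some c0)).
  by split; [exact: is_tree_root_tree | rewrite fnd_root_tree].
move=> S S' _ [tS Sc] r0; split; first exact: rate_tree r0.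
by rewrite (rate_root tS r0).
Qed.

Lemma closed_reachable : closed lam (reachable o).
Proof.
split=> [T /reach_tree[]//|T v c oT vT r0|T v oT lv v0].
  by apply: (reachable_rcons oT); apply: lt_le_trans r0 _; exact: birth_rate_rate.
apply: (reachable_rcons oT); apply: lt_le_trans (death_rate_rate lv v0).
by apply: death_rate_gt0 => //; case: (reach_tree oT).
Qed.

Lemma reach_lone T : reachable o T -> T != o -> ~~ leaf T [::].
Proof.
move=> /reach_tree[tT Tc]; apply: contraNN; rewrite lone_card // => /eqP T1.
by apply/eqP; exact: tree_size1.
Qed.

Hypothesis q0 : 0 < q o.

Lemma reach_exit_gt0 T : reachable o T -> 0 < q T.
Proof.
move=> oT; have [->//|To] := eqVneq T o.
by apply: exit_rate_gt0 (reach_lone oT To) => //; case: (reach_tree oT).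
Qed.

Variable B : R.
Hypothesis mB : forall m, mass m.+1 m c0 <= B.

(* The auxiliary killing of the lone root, at rate 1, does not affect the time
   needed to come back to it. *)
Lemma spent_root_le_exit m M h f n T : solves lam mu 1 m M h f -> reachable o T ->
  (tree_size T + n <= m)%N -> spent (pred1 o) n T <= h T.
Proof.
move=> [_ _ hE hb _ _ _]; elim: n T => [|n IH] T oT Tm.
  by rewrite /spent big_geq //; case/andP: (hb T).
have [To|To] := boolP (pred1 o T).
  by rewrite spent_target //; case/andP: (hb T).
have [tT _] := reach_tree oT; have qT := reach_exit_gt0 oT.
have mT : (tree_size T <= m)%N by rewrite (leq_trans _ Tm) // leq_addr.
have := hE _ tT mT; rewrite /den /lone (negPf (reach_lone oT To)) mulr0 addr0 => E.
rewrite spentS // ler_pdivrMr // mulrC E lerD2l.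
have [_ ib id] := closed_reachable.
apply: ler_Jsum => // [v d vT r0|v lv v0]; apply: IH.
- exact: ib.
- by rewrite tree_size_birth addSnnS.
- exact: id.
have vT : v \in domf T by case/leafP: lv.
by move: Tm; rewrite (tree_size_death vT); lia.
Qed.

(** At the lone root the bound on [h m] is the mass, uniformly in [m]. The exit equation hands it on
    along jumps, as [rate S S' * h m S' <= den S * h m S] once [m] is at least the size of [S]. *)
Lemma spent_root_bounded T : reachable o T ->
  exists2 B', 0 <= B' & forall n, spent (pred1 o) n T <= B'.
Proof.
have [M [h [f hf]]] := solves_family lam_ge0 mu_gt0 (@ltr01 R).
move=> oT; suff [B' [m0 hB]] : exists B' m0, forall m, (m0 <= m)%N -> h m T <= B'.
  exists B'.
    by apply: le_trans (hB m0 _) => //; case: (hf m0) => _ _ _ /(_ T) /andP[].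
  move=> n; apply: le_trans (hB (maxn m0 (tree_size T + n)) (leq_maxl _ _)).
  by apply: spent_root_le_exit (hf _) oT _; rewrite leq_maxr.
move: T oT; apply: reachable_ind_r.
  exists B, 1%N => m m0; apply: le_trans (mB m).
  by rewrite -[leLHS]mul1r; apply: (exit_root_le lamE rho_ge0 hf).
move=> S S' oS [B' [m0 hB]] r0; have [tS _] := reach_tree oS.
exists (den lam mu 1 S * B' / rate S S'), (maxn m0 (tree_size S)) => m.
rewrite geq_max => /andP[m0m Sm]; have [h0 gh hE hb _ _ _] := hf m.
rewrite ler_pdivlMr // mulrC; apply: (@le_trans _ _ (den lam mu 1 S * h m S)).
  rewrite hE //; apply: (@le_trans _ _ (Jsum (h m) S)); last by rewrite lerDr.
  by apply: rate_le_Jsum => // T; case/andP: (hb T).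
by rewrite ler_wpM2l ?hB // ltW // den_gt0.
Qed.

(** Markov property at the first visit to the root: either [a] is met before, or the wait starts
    afresh from there. *)
Lemma spent_via_root a n T : reachable o T ->
  spent a n T <= spent (pred1 o) n T + spent a n o.
Proof.
elim: n T => [|n IH] T oT; first by rewrite /spent !big_geq // addr0.
have [aT|aT] := boolP (a T).
  by rewrite spent_target // addr_ge0 ?spent_ge0.
have [To|To] := boolP (pred1 o T).
  by rewrite (spent_target _ _ _ To) add0r (eqP To).
have qT := reach_exit_gt0 oT.
apply: (@le_trans _ _ (spent (pred1 o) n.+1 T + spent a n o)); last first.
  by rewrite lerD2l spent_le.
rewrite !spentS // -lerBlDr -(mulfK (lt0r_neq0 qT) (spent a n o)) -mulrBl.
rewrite ler_pM2r ?invr_gt0 // -addrA lerD2l lerBlDr -Jsum_cst -JsumD.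
by apply: (ler_Jsum_closed _ _ closed_reachable oT).
Qed.

(* Each excursion from the root reaches T with a probability at least e. *)
Lemma spent_reach_bounded T x : reachable o T -> reachable o x ->
  exists B', forall n, spent (pred1 T) n x <= B'.
Proof.
move=> oT ox.
have /choice[Bf HB] : forall z, exists Bz : R, 0 <= Bz /\ (reachable o z -> forall n, spent (pred1 o) n z <= Bz).
  move=> z; have [oz|noz] := pselect (reachable o z); last by exists 0.
  by have [Bz Bz0 zB] := spent_root_bounded oz; exists Bz.
(* At fixed [n] the value at the root is a real number, so this inequality can be solved for it: it
   is at most [C0 / e]. *)
suff [C0 [e [e0 Ho]]] : exists C0 e, 0 < e /\ forall n, spent (pred1 T) n o <= C0 + (1 - e) * spent (pred1 T) n o.
  exists (Bf x + C0 / e) => n; apply: le_trans (spent_via_root _ _ ox) _.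
  rewrite lerD ?(HB x).2 // ler_pdivlMr //.
  by have := Ho n; rewrite mulrBl mul1r addrCA -lerBlDl subrr subr_ge0 mulrC.
suff : forall S, reachable S T -> reachable o S -> exists C0 e, [/\ 0 <= C0, 0 < e &
    forall n, spent (pred1 T) n S <= C0 + (1 - e) * spent (pred1 T) n o].
  by move=> /(_ o oT (reachable_refl o))[C0 [e [_ e0 H]]]; exists C0, e.
apply: reachable_ind_l.
  exists 0, 1; split=> // n.
  by rewrite spent_target ?subrr ?mul0r ?addr0 //=.
move=> S S' r0 _ IH oS; have [C0 [e [C00 e0 HS']]] := IH (reachable_rcons oS r0).
have [aS|aS] := boolP (pred1 T S).
  by exists 0, 1; split=> // n; rewrite spent_target ?subrr ?mul0r ?addr0.
have qS := reach_exit_gt0 oS.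
pose p := rate S S' / q S; have p0 : 0 < p by rewrite divr_gt0.
(* With probability [p] the jump follows the path to [S']; after any other jump the chain goes back
   to the root, at a cost [Bf], and restarts. Thus [e] is the product of the jump probabilities
   along the path. *)
exists ((1 + Jsum Bf S) / q S + p * C0), (p * e); split.
- apply: addr_ge0; last by rewrite mulr_ge0 // ltW.
  apply: divr_ge0; last exact: ltW.
  by rewrite addr_ge0 // Jsum_ge0 // => z; case: (HB z).
- by rewrite mulr_gt0.
move=> n; apply: le_trans (spent_le _ _ _ _ _) _ => //.
rewrite spentS //; set U := spent (pred1 T) n o.
have -> : (1 + Jsum Bf S) / q S + p * C0 + (1 - p * e) * U =
  (1 + (Jsum Bf S + U * q S + rate S S' * (C0 - e * U))) / q S.
  by rewrite /p; field; rewrite gt_eqF.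
rewrite ler_pM2r ?invr_gt0 // lerD2l -Jsum_cst rateE -JsumM -!JsumD.
apply: (ler_Jsum_closed _ _ closed_reachable oS) => // z oz.
case: eqP => [->|_]; last first.
  rewrite mul0r addr0; apply: le_trans (spent_via_root _ _ oz) _.
  by rewrite lerD2r (HB z).2.
rewrite mul1r; apply: le_trans (HS' n) _; rewrite -/U.
have := (HB S').1; rewrite mulrBl mul1r; lra.
Qed.

End Root.

End Recurrence.

(** * Exponential holding times *)

Section LayerCake.
Local Open Scope classical_set_scope.
Local Open Scope ereal_scope.
Context d (W : measurableType d) (R : realType).
Variable P : probability W R.
Local Notation leb := (@lebesgue_measure R).

(** Tonelli for the region under the graph, made of the pairs of [w] in [E] and [t] with
    [0 <= t < H w]; the value +oo of [H] is allowed. *)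
Lemma layer_cake (E : set W) (H : W -> \bar R) :
  measurable E -> measurable_fun setT H -> (forall w, E w -> 0 <= H w) ->
  \int[P]_(w in E) H w =
  \int[leb]_(t in `[0%R, +oo[) P (E `&` [set w | t%:E < H w]).
Proof.
move=> mE mH H0.
pose A := [set z : W * R | [/\ E z.1, (0 <= z.2)%R & z.2%:E < H z.1]].
have mA : measurable A.
  rewrite (_ : A = (fst @^-1` E) `&` ((snd @^-1` `[0%R, +oo[) `&`
      [set z | 0 < H z.1 - z.2%:E])); last first.
    apply/seteqP; split=> -[w t]; rewrite /A /= in_itv /= andbT EFinN sube_gt0.
      by move=> [].
    by move=> [? []].
  apply: measurableI; first by rewrite -[X in measurable X]setTI; exact: measurable_fst.
  apply: measurableI; first by rewrite -[X in measurable X]setTI; exact: measurable_snd.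
  rewrite -[X in measurable X]setTI; apply: emeasurable_fun_o_infty => //.
  apply: emeasurable_funB; first exact: measurableT_comp.
  by apply: measurableT_comp => //; exact: measurable_snd.
have XE w t : xsection A w t <-> [/\ E w, (0 <= t)%R & t%:E < H w].
  by rewrite /xsection /= inE.
have YE w t : ysection A t w <-> [/\ E w, (0 <= t)%R & t%:E < H w].
  by rewrite /ysection /= inE.
have := @indic_fubini_tonelli _ _ _ _ R P leb A mA.
rewrite indic_fubini_tonelli_FE // indic_fubini_tonelli_GE // => FT.
transitivity (\int[P]_w leb (xsection A w)).
  rewrite integral_mkcond; apply: eq_integral => w _ /=.
  rewrite patchE; case: ifPn => [/set_mem Ew|Ew]; last first.
    rewrite (_ : xsection A w = set0) ?measure0 //.
    apply/seteqP; split=> // t /XE[Ew' _ _].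
    by move: Ew; rewrite notin_setE.
  have {}H0 := H0 _ Ew.
  case HE : (H w) H0 => [r| |] // r0.
    rewrite (_ : xsection A w = `[0%R, r[); last first.
      apply/seteqP; split=> t /=; rewrite in_itv /=.
        by move=> /XE[_ ->]; rewrite HE lte_fin => ->.
      by move=> /andP[t0 tr]; apply/XE; rewrite HE lte_fin.
    rewrite lebesgue_measure_itv /= lte_fin; case: ifPn => [_|]; first by rewrite sube0.
    by rewrite -leNgt => r0'; congr EFin; apply/eqP; rewrite eq_le r0' -lee_fin.
  rewrite (_ : xsection A w = `[0%R, +oo[); last first.
    apply/seteqP; split=> t /=; rewrite in_itv /= andbT; first by move=> /XE[].
    by move=> t0; apply/XE; rewrite HE ltry.
  by rewrite lebesgue_measure_itv /= ltry.
rewrite FT [RHS]integral_mkcond; apply: eq_integral => t _ /=.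
rewrite patchE; case: ifPn => [/set_mem|t0].
  rewrite /= in_itv /= andbT => t0; congr (P _).
  by apply/seteqP; split=> w; [move=> /YE[] | move=> [Ew tH]; apply/YE].
rewrite (_ : ysection A t = set0) ?measure0 //.
apply/seteqP; split=> // w /YE[_ t0' _].
by move: t0; rewrite notin_setE /= in_itv /= t0'.
Qed.

(** The joint tail with [E] is [P E / q] times the exponential density, whose integral is 1. *)
Lemma integral_exponential_tail (E : set W) (H : W -> \bar R) (q : R) :
  measurable E -> measurable_fun setT H -> (forall w, E w -> 0 <= H w) ->
  (0 < q)%R ->
  (forall t, (0 <= t)%R -> P (E `&` [set w | t%:E < H w]) = P E * (expR (- (q * t)))%:E) ->
  \int[P]_(w in E) H w = P E * (q^-1)%:E.
Proof.
move=> mE mH H0 q0 HE; rewrite layer_cake //.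
have PEf : P E \is a fin_num by exact: fin_num_measure.
transitivity (\int[leb]_(t in `[0%R, +oo[)
    ((P E * (q^-1)%:E) * (exponential_pdf q t)%:E)).
  apply: eq_integral => t /set_mem; rewrite /= in_itv /= andbT => t0.
  rewrite HE // exponential_pdfE // -muleA -EFinM mulNr mulKf //.
  by rewrite gt_eqF.
rewrite ge0_integralZl //; last 3 first.
- apply: measurable_funTS; apply/measurable_EFinP.
  exact: measurable_exponential_pdf.
- by move=> t _; rewrite lee_fin exponential_pdf_ge0 // ltW.
- by rewrite mule_ge0 // lee_fin invr_ge0 ltW.
rewrite (_ : \int[_]_(_ in _) _ = 1) ?mule1 //.
rewrite integral_mkcond -(integral_exponential_pdf q0).
apply: eq_integral => t _ /=; rewrite patchE; case: ifPn => // t0.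
by rewrite /exponential_pdf patchE (negPf t0).
Qed.

End LayerCake.

(** * Events prescribing the first states *)

Section Encoding.
Variable C : finType.

(** Countability of the states, which makes every set of trees a measurable event. *)
Definition tree_code (T : tree C) : nat :=
  choice.pickle ([seq (v, T.[? v]) | v <- domf T] : seq (seq nat * option C)).

Lemma tree_code_inj : injective tree_code.
Proof.
move=> T T' /(pcan_inj choice.pickleK) E; apply/fmapP => v.
have mE (S : tree C) : v \in domf S -> (v, S.[? v]) \in [seq (u, S.[? u]) | u <- domf S].
  by move=> vS; apply/mapP; exists v.
have [vT|vT] := boolP (v \in domf T).
  by have := mE T vT; rewrite E => /mapP[u _ [-> ->]].
have [vT'|vT'] := boolP (v \in domf T').
  by have := mE T' vT'; rewrite -E => /mapP[u _ [-> ->]].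
by rewrite !fnd_notin.
Qed.

End Encoding.

Section Paths.
Local Open Scope classical_set_scope.
Local Open Scope ereal_scope.
Variables (R : realType) (C : finType) (lam mu : C -> C -> R).
Hypotheses (lam_ge0 : forall c c', (0 <= lam c c')%R) (mu_gt0 : forall c c', (0 < mu c c')%R).
Context d (W : measurableType d).
Variables (Y : nat -> W -> tree C) (H : nat -> W -> \bar R).
Variables (P : probability W R) (nu : tree C -> R).
Hypothesis chain : is_chain lam mu Y H P nu.
Implicit Types (T S : tree C) (p : seq (tree C)) (n k : nat) (a : pred (tree C)).

Local Notation q := (exit_rate lam mu).
Local Notation jump_prob := (jump_prob lam mu).
Local Notation Jsum := (Jsum lam mu).
Local Notation rate := (rate lam mu).

Lemma measurable_state n (A : tree C -> Prop) : measurable [set w | A (Y n w)].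
Proof.
have [mY _ _] := chain.
rewrite (_ : [set w | A (Y n w)] =
    \bigcup_k [set w | A (Y n w) /\ tree_code (Y n w) = k]); last first.
  by apply/seteqP; split=> [w Aw|w [k _ []]] //; exists (tree_code (Y n w)).
apply: bigcup_measurable => k _.
have [[T [AT Tk]]|H0] := pselect (exists T, A T /\ tree_code T = k); last first.
  rewrite (_ : [set w | _] = set0) //; apply/seteqP; split=> // w [Aw wk].
  by case: H0; exists (Y n w).
rewrite (_ : [set w | _] = [set w | Y n w = T]) //.
apply/seteqP; split=> w /=; last by move=> ->.
by rewrite -Tk => -[_ /tree_code_inj].
Qed.

Lemma measurable_H n : measurable_fun setT (H n).
Proof. by case: chain. Qed.

Lemma measurable_H_gt n t : measurable [set w | t < H n w].
Proof.
rewrite -[X in measurable X]setTI; apply: emeasurable_fun_o_infty => //.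
exact: measurable_H.
Qed.

(** [ev (T :: p)] fixes the states 0 to [size p], so the current state is [last T p] and its holding
    time is [H (size p)]. Positive holding times are included because [is_chain] evaluates only
    events with strict lower bounds on them. *)
Definition ev p : set W :=
  [set w | forall k, (k < size p)%N -> Y k w = nth [fmap] p k /\ 0 < H k w].

Lemma measurable_ev p : measurable (ev p).
Proof.
rewrite (_ : ev p = \bigcap_(k in [set k | (k < size p)%N])
    ([set w | Y k w = nth [fmap] p k] `&` [set w | 0 < H k w])); last first.
  by apply/seteqP; split.
apply: bigcap_measurableType => k _; apply: measurableI; last exact: measurable_H_gt.
exact: (measurable_state k (fun T => T = _)).
Qed.

Lemma ev_rcons_sub p S : ev (rcons p S) `<=` ev p.
Proof.
move=> w Ew k kp; have := Ew k; rewrite size_rcons nth_rcons kp.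
by apply; exact: ltnW.
Qed.

Lemma ev_nth p k w : ev p w -> (k < size p)%N -> Y k w = nth [fmap] p k.
Proof. by move=> pw kp; case: (pw k kp). Qed.

Lemma prob_ev_tail T p t : (0 <= t)%R ->
  P (ev (T :: p) `&` [set w | t%:E < H (size p) w]) =
  (nu T * \prod_(k < size p) jump_prob (nth [fmap] (T :: p) k) (nth [fmap] p k)
   * expR (- (q (last T p) * t)))%:E.
Proof.
move=> t0; have [_ _ Pch] := chain.
pose ts k := if (k == size p)%N then t else 0%R.
have ts0 k : (0 <= ts k)%R by rewrite /ts; case: eqP.
have tsn : ts (size p) = t by rewrite /ts eqxx.
have := Pch (size p) (nth [fmap] (T :: p)) ts ts0.
rewrite big_ord_recr /= tsn [X in (_ * (X * _))%R]big1 ?mul1r; last first.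
  by move=> k _; rewrite /ts ltn_eqF // mulr0 oppr0 expR0.
rewrite -[nth _ (T :: p) _]last_nth => <-; congr (P _).
apply/seteqP; split=> w /=.
  move=> [Ew tH] k kp; have [-> Hk] := Ew k kp; split=> //.
  by rewrite /ts; case: eqP => [->|].
move=> Ew; split; last by have [_] := Ew _ (leqnn _); rewrite /ts eqxx.
move=> k kp; have [-> Hk] := Ew k kp; split=> //.
by apply: le_lt_trans Hk; rewrite lee_fin.
Qed.

Lemma prob_ev T p : P (ev (T :: p)) =
  (nu T * \prod_(k < size p) jump_prob (nth [fmap] (T :: p) k) (nth [fmap] p k))%:E.
Proof.
rewrite -[LHS](_ : P (ev (T :: p) `&` [set w | 0%:E < H (size p) w]) = _).
  by rewrite prob_ev_tail // mulr0 oppr0 expR0 mulr1.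
congr (P _); apply/seteqP; split=> w /=; first by case.
by move=> Ew; split=> //; have [] := Ew (size p) (leqnn _).
Qed.

Lemma prob_ev_H T p t : (0 <= t)%R ->
  P (ev (T :: p) `&` [set w | t%:E < H (size p) w]) =
  P (ev (T :: p)) * (expR (- (q (last T p) * t)))%:E.
Proof. by move=> t0; rewrite prob_ev_tail // prob_ev EFinM. Qed.

Lemma prob_ev_rcons T p S : P (ev (T :: rcons p S)) =
  P (ev (T :: p)) * (jump_prob (last T p) S)%:E.
Proof.
rewrite !prob_ev size_rcons big_ord_recr /= -EFinM mulrA; congr EFin.
congr (_ * _ * _)%R; last first.
  rewrite nth_rcons ltnn eqxx -rcons_cons nth_rcons /= ltnS leqnn.
  by rewrite -[nth _ (T :: p) _]last_nth.
apply: eq_bigr => k _; rewrite -rcons_cons !nth_rcons /= ltn_ord.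
by rewrite ltnS ltnW.
Qed.

Lemma integral_H T p : (0 < q (last T p))%R ->
  \int[P]_(w in ev (T :: p)) H (size p) w = P (ev (T :: p)) * ((q (last T p))^-1)%:E.
Proof.
move=> q0; apply: integral_exponential_tail => //.
- exact: measurable_ev.
- exact: measurable_H.
- by move=> w Ew; have [_ /ltW] := Ew (size p) (leqnn _).
by move=> t; exact: prob_ev_H.
Qed.

(** A finite list that carries the jump law, so that conditioning on the next state is a finite sum;
    an absorbing state is its own successor. *)
Definition successors T : seq (tree C) :=
  if q T == 0%R then [:: T] else undup [seq j.1 | j <- jumps lam mu T & (0 < j.2)%R].

Lemma jumps_ge0 T j : j \in jumps lam mu T -> (0 <= j.2)%R.
Proof.
rewrite mem_cat => /orP[/allpairsP[[v c] [_ _ ->]]|/mapP[v _ ->]] /=.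
  exact: birth_rate_ge0.
exact: death_rate_ge0.
Qed.

Lemma jump_rate_le T j : j \in jumps lam mu T -> (j.2 <= rate T j.1)%R.
Proof.
move=> jT; rewrite /Defs.rate (big_rem j) //= eqxx lerDl.
rewrite big_seq_cond; apply: sumr_ge0 => i /andP[ij _].
by apply: (@jumps_ge0 T); exact: mem_rem ij.
Qed.

Lemma succ_rate T S : q T != 0%R -> S \in successors T -> (0 < rate T S)%R.
Proof.
rewrite /successors => /negPf->; rewrite mem_undup => /mapP[j]; rewrite mem_filter.
by move=> /andP[j0 jT] ->; exact: lt_le_trans (jump_rate_le jT).
Qed.

Lemma succ_uniq T : uniq (successors T).
Proof. by rewrite /successors; case: ifP => // _; exact: undup_uniq. Qed.

Lemma sum_succ (f : tree C -> R) T : q T != 0%R ->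
  (\sum_(S <- successors T) jump_prob T S * f S = Jsum f T / q T)%R.
Proof.
move=> q0; rewrite /Defs.jump_prob /successors (negPf q0) -sum_jumps mulr_suml.
transitivity (\sum_(S <- undup [seq j.1 | j <- jumps lam mu T & (0 < j.2)%R])
   \sum_(j <- jumps lam mu T) (if j.1 == S then j.2 * f j.1 / q T else 0))%R.
  apply: eq_bigr => S _; rewrite -big_mkcond /Defs.rate -mulrA mulr_suml.
  by apply: eq_bigr => j /eqP->; rewrite mulrA mulrAC.
rewrite exchange_big !big_seq; apply: eq_bigr => j jT.
have := jumps_ge0 jT; rewrite le_eqVlt => /orP[/eqP<-|j0].
  by rewrite !mul0r big1 // => S _; case: ifP.
rewrite (bigD1_seq j.1) ?undup_uniq //=; last first.
  by rewrite mem_undup; apply/mapP; exists j; rewrite // mem_filter j0.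
rewrite eqxx big1 ?addr0 // => S /negPf; rewrite eq_sym => ->.
by [].
Qed.

Lemma sum_succ1 T : (\sum_(S <- successors T) jump_prob T S = 1)%R.
Proof.
have [q0|q0] := eqVneq (q T) 0%R.
  by rewrite /successors q0 eqxx big_seq1 /Defs.jump_prob q0 eqxx eqxx.
have := sum_succ (fun=> 1%R) q0; rewrite -exit_rateE divff // => <-.
by apply: eq_bigr => S _; rewrite mulr1.
Qed.

Lemma jump_prob_ge0 T S : (0 <= jump_prob T S)%R.
Proof.
rewrite /Defs.jump_prob; case: ifP => // _.
by rewrite divr_ge0 ?rate_ge0 ?exit_rate_ge0.
Qed.

Lemma trivIset_ev T p : trivIset [set` successors (last T p)] (fun S => ev (T :: rcons p S)).
Proof.
move=> S S' _ _ [w [Sw S'w]].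
have := ev_nth Sw (k := (size p).+1); rewrite /= size_rcons => /(_ (leqnn _)).
have := ev_nth S'w (k := (size p).+1); rewrite /= size_rcons => /(_ (leqnn _)) ->.
by rewrite !nth_rcons ltnn eqxx.
Qed.

Definition ev_succ T p : set W :=
  \big[setU/set0]_(S <- successors (last T p)) ev (T :: rcons p S).

Lemma ev_succE T p w : ev_succ T p w <->
  exists2 S, S \in successors (last T p) & ev (T :: rcons p S) w.
Proof. by rewrite /ev_succ -bigcup_seq; split=> -[S SS Ew]; exists S. Qed.

Lemma measurable_ev_succ T p : measurable (ev_succ T p).
Proof. by apply: bigsetU_measurable => S _; exact: measurable_ev. Qed.

(** The jump probabilities towards the successors add up to 1. *)
Lemma ev_succ_null T p : P (ev (T :: p) `\` ev_succ T p) = 0.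
Proof.
have mE := measurable_ev (T :: p); have mU := measurable_ev_succ T p.
have UE : ev_succ T p `<=` ev (T :: p).
  by move=> w /ev_succE[S _]; rewrite -rcons_cons; exact: ev_rcons_sub.
rewrite measureD //; last by rewrite ltey_eq fin_num_measure.
have -> : ev (T :: p) `&` ev_succ T p = ev_succ T p by rewrite setIC; exact/setIidPl.
suff PU : P (ev_succ T p) = P (ev (T :: p)).
  by rewrite [X in _ - X]PU subee // fin_num_measure.
transitivity (\int[P]_(w in ev_succ T p) 1).
  by rewrite integral_cst // mul1e.
rewrite /ev_succ ge0_integral_bigsetU ?succ_uniq //; last exact: trivIset_ev.
  transitivity (\sum_(S <- successors (last T p)) P (ev (T :: p)) * (jump_prob (last T p) S)%:E).
    apply: eq_bigr => S _; rewrite (integral_cst _ (measurable_ev _)) mul1e.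
    exact: prob_ev_rcons.
  rewrite -ge0_sume_distrr; last by move=> S _; rewrite lee_fin jump_prob_ge0.
  by rewrite sumEFin sum_succ1 mule1.
by move=> S; exact: measurable_ev.
Qed.

Lemma integral_ev_succ T p (D : set W) (G : W -> \bar R) :
  measurable D -> measurable_fun setT G -> (forall w, 0 <= G w) ->
  \int[P]_(w in ev (T :: p) `&` D) G w =
  \sum_(S <- successors (last T p)) \int[P]_(w in ev (T :: rcons p S) `&` D) G w.
Proof.
move=> mD mG G0; have mE := measurable_ev (T :: p); have mU := measurable_ev_succ T p.
rewrite (@ge0_negligible_integral _ _ _ _ _ (ev (T :: p) `\` ev_succ T p)) //;
  last 4 first.
- exact: measurableD.
- exact: measurableI.
- exact: measurable_funTS.
- exact: ev_succ_null.
rewrite -ge0_integral_bigsetU ?succ_uniq //; last 3 first.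
- by move=> S; apply: measurableI => //; exact: measurable_ev.
- by move=> S S' SS S'S [w [[Sw _] [S'w _]]]; apply: (@trivIset_ev T p) => //; exists w.
- exact: measurable_funTS.
congr (integral _ _ _); rewrite -bigcup_seq.
apply/seteqP; split=> w.
  move=> [[Ew Dw] nU]; have /ev_succE[S SS Sw] : ev_succ T p w.
    by apply: contrapT => nw; apply: nU.
  by exists S.
move=> [S SS [Sw Dw]]; split.
  by split=> //; move: Sw; rewrite -rcons_cons; exact: ev_rcons_sub.
by move=> [_]; apply; apply/ev_succE; exists S.
Qed.

Definition avoids a n k : set W := [set w | forall j, (j <= k)%N -> ~~ a (Y (n + j) w)].

Lemma measurable_avoids a n k : measurable (avoids a n k).
Proof.
rewrite (_ : avoids a n k = \bigcap_(j in [set j | (j <= k)%N])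
    [set w | ~~ a (Y (n + j) w)]); last by apply/seteqP; split.
by apply: bigcap_measurableType => j _; exact: (measurable_state _ (fun T => ~~ a T)).
Qed.

(** Markov property of the embedded chain, by splitting over the next state. It is used with the
    holding times, where [psi] is 1 / q, and with the constant 1, which gives survival
    probabilities. *)
Lemma integral_kill (Inv : tree C -> Prop) a (g : nat -> W -> \bar R) (psi : tree C -> R) :
  (forall T, (0 <= psi T)%R) ->
  (forall T S, Inv T -> (0 < rate T S)%R -> Inv S) ->
  (forall T, Inv T -> ~~ a T -> (0 < q T)%R) ->
  (forall n, measurable_fun setT (g n)) -> (forall n w, 0 <= g n w) ->
  (forall T p, Inv (last T p) -> ~~ a (last T p) ->
    \int[P]_(w in ev (T :: p)) g (size p) w = P (ev (T :: p)) * (psi (last T p))%:E) ->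
  forall k T p, Inv (last T p) ->
  \int[P]_(w in ev (T :: p) `&` avoids a (size p) k) g (size p + k)%N w =
  P (ev (T :: p)) * (kill lam mu a psi k (last T p))%:E.
Proof.
move=> psi0 Inv_step qI mg g0 base; elim=> [|k IH] T p iT /=; case: ifPn => aT.
- rewrite mule0 (_ : _ `&` _ = set0) ?integral_set0 //.
  apply/seteqP; split=> // w [Ew /(_ 0%N (leqnn _))].
  by rewrite addn0 (ev_nth Ew) // -last_nth aT.
- rewrite addn0 (_ : _ `&` _ = ev (T :: p)); first exact: base.
  apply/seteqP; split=> [w []//|w Ew]; split=> // -[|//] _.
  by rewrite addn0 (ev_nth Ew) // -last_nth.
- rewrite mule0 (_ : _ `&` _ = set0) ?integral_set0 //.
  apply/seteqP; split=> // w [Ew /(_ 0%N (leq0n _))].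
  by rewrite addn0 (ev_nth Ew) // -last_nth aT.
have q0 : q (last T p) != 0%R by rewrite gt_eqF ?qI.
rewrite integral_ev_succ //; last exact: measurable_avoids.
rewrite -sum_succ // -sumEFin ge0_sume_distrr; last first.
  move=> S _; rewrite lee_fin mulr_ge0 ?jump_prob_ge0 //.
  by apply: kill_ge0.
rewrite big_seq [RHS]big_seq; apply: eq_bigr => S SS.
have iS : Inv S by apply: Inv_step iT _; exact: succ_rate SS.
rewrite (_ : _ `&` _ = ev (T :: rcons p S) `&` avoids a (size (rcons p S)) k); last first.
  rewrite size_rcons; apply/seteqP; split=> w [Sw av]; split=> // j jk.
    by rewrite addSnnS; exact: av.
  case: j jk => [_|j jk]; last by rewrite -addSnnS; exact: av.
  have Ew := ev_rcons_sub (p := T :: p) Sw.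
  by rewrite addn0 (ev_nth Ew) // -last_nth.
have := IH T (rcons p S); rewrite last_rcons size_rcons addSnnS => /(_ iS) ->.
by rewrite prob_ev_rcons EFinM muleA.
Qed.

End Paths.

(** * First passage times along a trajectory *)

Section Times.
Local Open Scope classical_set_scope.
Local Open Scope ereal_scope.
Variables (R : realType) (C : finType).
Context d (W : measurableType d).
Variables (Y : nat -> W -> tree C) (H : nat -> W -> \bar R).
Implicit Types (T S : tree C) (n k : nat) (a : pred (tree C)) (w : W).

Local Notation J := (jump_time H).

Lemma jump_timeS n w : J n.+1 w = J n w + H n w.
Proof. by rewrite /jump_time big_ord_recr. Qed.

(** [maxe] makes this non-negative on the whole space, as the holding times are positive only almost
    surely. *)
Definition elapsed a n k w : \bar R :=
  if `[< avoids Y a n k w >] then maxe (H (n + k)%N w) 0 else 0.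

Lemma elapsed_ge0 a n k w : 0 <= elapsed a n k w.
Proof. by rewrite /elapsed; case: ifP => // _; rewrite le_max lexx orbT. Qed.

Section Pointwise.
Variable w : W.
Hypothesis H_gt0 : forall k, 0 < H k w.

Lemma jump_time_nd m n : (m <= n)%N -> J m w <= J n w.
Proof.
move=> /subnK <-; elim: (n - m)%N => // k IH.
by rewrite addSn jump_timeS (le_trans IH) // leeDl // ltW.
Qed.

Lemma jump_time_ge0 n : 0 <= J n w.
Proof. by apply: sume_ge0 => k _; exact: ltW. Qed.

Lemma elapsedE a n k :
  elapsed a n k w = if `[< avoids Y a n k w >] then H (n + k)%N w else 0.
Proof. by rewrite /elapsed; case: ifP => // _; rewrite max_l // ltW. Qed.

Lemma elapsed_le_jump_time a n K k : a (Y (n + k) w) ->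
  J n w + \sum_(0 <= i < K) elapsed a n i w <= J (n + k)%N w.
Proof.
move=> ak; elim: K => [|K IH].
  by rewrite big_geq // adde0 jump_time_nd // leq_addr.
have [Kk|kK] := ltnP K k; last first.
  rewrite big_nat_recr //= elapsedE asboolF ?adde0 //.
  by move=> /(_ k kK); rewrite ak.
apply: (@le_trans _ _ (J (n + K.+1)%N w)); last by rewrite jump_time_nd // leq_add2l.
elim: K.+1 => [|i IHi]; first by rewrite big_geq // adde0 addn0.
rewrite big_nat_recr //= addeA addnS jump_timeS leeD //.
by rewrite elapsedE; case: ifP => // _; exact: ltW.
Qed.

(** For a trajectory that never visits [a] from the n-th state on, explosive or not, the right-hand
    side is the infimum of the empty set, that is +oo. *)
Lemma elapsed_le_first_time a n K :
  J n w + \sum_(0 <= i < K) elapsed a n i w <= first_time Y H n [set T | a T] w.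
Proof.
apply: le_ereal_inf_tmp => _ [t [nt [T [[k [kt tk <-]]] /= ak]]] <-.
apply: le_trans kt; have [nk|kn] := leqP n k.
  by rewrite -(subnKC nk); apply: elapsed_le_jump_time; rewrite subnKC.
by have := lt_le_trans tk (le_trans (jump_time_nd kn) nt); rewrite ltxx.
Qed.

Lemma first_time_le a n N : a (Y (n + N) w) -> J (n + N)%N w < +oo ->
  first_time Y H n [set T | a T] w <= J (n + N)%N w.
Proof.
move=> aN JN.
have Jf : J (n + N)%N w \is a fin_num by rewrite ge0_fin_numE // jump_time_ge0.
apply: ereal_inf_lbound; exists (fine (J (n + N)%N w)); last by rewrite fineK.
rewrite /= fineK //; split; first by rewrite jump_time_nd // leq_addr.
exists (Y (n + N)%N w); split=> //; exists (n + N)%N; split; rewrite ?fineK //.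
by rewrite jump_timeS lteDl.
Qed.

Lemma first_timeE a n N : a (Y (n + N) w) -> (forall j, (j < N)%N -> ~~ a (Y (n + j) w)) ->
  J n w < +oo -> (forall k, elapsed a n k w < +oo) ->
  first_time Y H n [set T | a T] w = J n w + \sum_(0 <= i <oo) elapsed a n i w.
Proof.
move=> aN av Jn Hf.
have JE i : (i <= N)%N -> J (n + i)%N w = J n w + \sum_(0 <= j < i) elapsed a n j w.
  elim: i => [|i IH] iN; first by rewrite addn0 big_geq // adde0.
  rewrite addnS jump_timeS IH; last exact: ltnW.
  rewrite big_nat_recr //= addeA; congr (_ + _).
  by rewrite elapsedE asboolT // => j ji; apply: av; exact: leq_ltn_trans ji iN.
have sE : \sum_(0 <= i <oo) elapsed a n i w = \sum_(0 <= i < N) elapsed a n i w.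
  rewrite (nneseries_split 0 N) /=; last by move=> *; exact: elapsed_ge0.
  rewrite add0n eseries0 ?adde0 // => i Ni _.
  by rewrite elapsedE asboolF // => /(_ N Ni); rewrite aN.
rewrite sE; apply/eqP; rewrite eq_le elapsed_le_first_time andbT -JE //.
apply: first_time_le => //; rewrite JE // lte_add_pinfty //.
by apply: lte_sum_pinfty => i _; exact: Hf.
Qed.

End Pointwise.

Section Measurable.
Hypothesis mY : forall n (A : tree C -> Prop), measurable [set w | A (Y n w)].
Hypothesis mH : forall n, measurable_fun setT (H n).

Lemma measurable_jump_time n : measurable_fun setT (J n).
Proof. by apply: emeasurable_sum => k; exact: mH. Qed.

(** The infimum over real times becomes countable, hence measurable: during the k-th holding
    interval the earliest admissible time is the larger of [J n] and [J k]. *)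
Lemma first_time_einfs n (A : set (tree C)) w : first_time Y H n A w =
  einfs (fun k => if `[< A (Y k w) /\ maxe (J n w) (J k w) < J k.+1 w >]
                  then maxe (J n w) (J k w) else +oo) 0%N.
Proof.
apply/eqP; rewrite eq_le; apply/andP; split; apply/ereal_infP.
  move=> _ [k _ <-]; case: asboolP => [[Ak Mk]|]; last by rewrite leey.
  have H1 t : maxe (J n w) (J k w) <= t%:E -> t%:E < J k.+1 w ->
      first_time Y H n A w <= t%:E.
    rewrite ge_max => /andP[nt kt] tk; apply: ereal_inf_lbound; exists t => //.
    by split=> //; exists (Y k w); split=> //; exists k.
  move: Mk H1; case: maxe => [t| |] Mk H1.
  - exact: H1.
  - by move: Mk; rewrite ltNge leey.
  - rewrite (@eq_ninfty _ (first_time _ _ _ _ _)) // => r.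
    case E : (J k.+1 w) Mk => [s| |] // _; last first.
      by apply: H1; rewrite ?leNye // E ltry.
    apply: (@le_trans _ _ (Num.min r (s - 1))%:E); last by rewrite lee_fin ge_min lexx.
    apply: H1; rewrite ?leNye // E lte_fin gt_min; apply/orP; right.
    by rewrite ltrBlDr ltrDl.
move=> _ [t [nt [T [[k [kt tk YT]] AT]]] <-].
apply: ge_ereal_inf; eexists; first by exists k.
have Mt : maxe (J n w) (J k w) <= t%:E by rewrite ge_max nt.
by rewrite asboolT // YT; split=> //; exact: le_lt_trans tk.
Qed.

Lemma measurable_first_time n (A : set (tree C)) :
  measurable_fun setT (first_time Y H n A).
Proof.
rewrite (_ : first_time Y H n A = fun w => einfs (fun k =>
    if `[< A (Y k w) /\ maxe (J n w) (J k w) < J k.+1 w >]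
    then maxe (J n w) (J k w) else +oo) 0%N); last first.
  by apply/funext => w; exact: first_time_einfs.
apply: (measurable_fun_einfs (f := fun k w =>
    if `[< A (Y k w) /\ maxe (J n w) (J k w) < J k.+1 w >]
    then maxe (J n w) (J k w) else +oo)) => k.
have mM : measurable_fun setT (fun w => maxe (J n w) (J k w)).
  by apply: measurable_maxe; exact: measurable_jump_time.
apply: measurable_fun_ifT => //.
apply: (measurable_fun_bool true); rewrite setTI.
rewrite (_ : _ @^-1` _ = [set w | A (Y k w)] `&`
    [set w | 0 < J k.+1 w - maxe (J n w) (J k w)]); last first.
  apply/seteqP; split=> w /=; rewrite sube_gt0.
    by move=> /asboolP.
  by move=> ?; apply/asboolP.
apply: measurableI; first exact: (mY k A).
rewrite -[X in measurable X]setTI; apply: emeasurable_fun_o_infty => //.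
by apply: emeasurable_funB => //; exact: measurable_jump_time.
Qed.

Lemma measurable_elapsed a n k : measurable_fun setT (elapsed a n k).
Proof.
apply: measurable_fun_ifT => //.
  apply: (measurable_fun_bool true); rewrite setTI.
  rewrite (_ : _ @^-1` _ = avoids Y a n k); last first.
    by apply/seteqP; split=> w /= /asboolP.
  rewrite (_ : avoids _ _ _ _ = \bigcap_(j in [set j | (j <= k)%N])
      [set w | ~~ a (Y (n + j) w)]); last by apply/seteqP; split.
  by apply: bigcap_measurableType => j _; exact: (mY _ (fun T => ~~ a T)).
by apply: measurable_maxe => //; exact: mH.
Qed.

End Measurable.

End Times.

(** * Mean first passage times *)

Section Hitting.
Local Open Scope classical_set_scope.
Local Open Scope ereal_scope.
Variables (R : realType) (C : finType) (lam mu : C -> C -> R).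
Hypotheses (lam_ge0 : forall c c', (0 <= lam c c')%R) (mu_gt0 : forall c c', (0 < mu c c')%R).
Context d (W : measurableType d).
Variables (Y : nat -> W -> tree C) (H : nat -> W -> \bar R).
Variables (P : probability W R) (nu : tree C -> R).
Hypothesis chain : is_chain lam mu Y H P nu.
Implicit Types (T S : tree C) (p : seq (tree C)) (n k : nat) (a : pred (tree C)).

Local Notation q := (exit_rate lam mu).
Local Notation rate := (rate lam mu).
Local Notation ev := (ev Y H).
Local Notation succ := (successors lam mu).
Local Notation J := (jump_time H).
Local Notation clock := (elapsed Y H).
Local Notation spent := (spent lam mu).

Let mev p : measurable (ev p) := measurable_ev chain p.
Let mH n : measurable_fun setT (H n) := measurable_H chain n.
Let mY n (A : tree C -> Prop) : measurable [set w | A (Y n w)] := measurable_state chain n A.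

Lemma prob_ev_split T p (D : set W) : measurable D ->
  P (ev (T :: p) `&` D) = \sum_(S <- succ (last T p)) P (ev (T :: rcons p S) `&` D).
Proof.
move=> mD; have E p' : P (ev p' `&` D) = \int[P]_(w in ev p' `&` D) 1.
  by rewrite integral_cst ?mul1e //; exact: measurableI.
rewrite E (integral_ev_succ lam_ge0 mu_gt0 chain) //.
by apply: eq_bigr => S _; rewrite -E.
Qed.

Lemma ae_ev_succ T p (Q : W -> Prop) :
  (forall S, S \in succ (last T p) -> {ae P, forall w, ev (T :: rcons p S) w -> Q w}) ->
  {ae P, forall w, ev (T :: p) w -> Q w}.
Proof.
move=> HQ.
have H1 : {ae P, forall w i, (i < size (succ (last T p)))%N ->
    ev (T :: rcons p (nth [fmap] (succ (last T p)) i)) w -> Q w}.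
  apply/ae_foralln => i; have [il|il] := ltnP i (size (succ (last T p))).
    apply: filterS (HQ _ (mem_nth [fmap] il)) => w Hw _; exact: Hw.
  exact: aeW.
have H2 : {ae P, forall w, ev (T :: p) w -> ev_succ lam mu Y H T p w}.
  exists (ev (T :: p) `\` ev_succ lam mu Y H T p); split.
  - apply: measurableD => //; exact: (measurable_ev_succ chain).
  - exact: (ev_succ_null lam_ge0 mu_gt0 chain).
  - by move=> w /= /not_implyP.
apply: filterS2 H1 H2 => w H1 H2 /H2/ev_succE[S SS]; rewrite -(nth_index [fmap] SS).
by apply: H1; rewrite index_mem.
Qed.

(** [ev (T :: p)] contains positivity up to [size p]; for later indices the event is split over the
    possible continuations. *)
Lemma ae_H_gt0 T p : {ae P, forall w, ev (T :: p) w -> forall k, 0 < H k w}.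
Proof.
suff H1 : forall k, {ae P, forall w, ev (T :: p) w -> 0 < H k w}.
  have /ae_foralln := H1.
  by apply: filterS => w Hw Ew k; exact: Hw.
move=> k; have [kp|] := leqP k (size p).
  by apply: aeW => w Ew; have [] := Ew k kp.
move=> /ltnW/subnKC <-; move: (k - size p)%N => j; elim: j T p => [|j IH] T p.
  by apply: aeW => w Ew; rewrite addn0; have [] := Ew (size p) (leqnn _).
apply: ae_ev_succ => S _; have := IH T (rcons p S).
by rewrite size_rcons addSnnS.
Qed.

Lemma ae_H_lty T p : (0 < q (last T p))%R ->
  {ae P, forall w, ev (T :: p) w -> H (size p) w < +oo}.
Proof.
move=> q0; have : P.-integrable (ev (T :: p)) (H (size p)).
  apply/integrableP; split; first exact: measurable_funTS.
  rewrite (eq_integral (H (size p))) => [|w /set_mem Ew].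
    rewrite (integral_H chain q0) lte_mul_pinfty ?fin_num_measure ?ltry //.
  by rewrite gee0_abs // ltW //; have [] := Ew (size p) (leqnn _).
move=> /integrable_ae => /(_ (mev _)); apply: filterS => w Hw /Hw.
by move=> /fin_numPlt /andP[].
Qed.

Lemma ae_jump_time_lty T p : (forall k, (k < size p)%N -> (0 < q (nth [fmap] (T :: p) k))%R) ->
  {ae P, forall w, ev (T :: p) w -> J (size p) w < +oo}.
Proof.
move=> qp.
have H1 : {ae P, forall w k, (k < size p)%N -> ev (T :: p) w -> H k w < +oo}.
  apply/ae_foralln => k; have [kp|kp] := ltnP k (size p); last first.
    exact: aeW.
  have sk : size (take k p) = k by rewrite size_takel // ltnW.
  have lk : last T (take k p) = nth [fmap] (T :: p) k.
    by rewrite (last_nth [fmap]) sk -[T :: take k p]/(take k.+1 (T :: p)) nth_take.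
  have := @ae_H_lty T (take k p); rewrite lk sk => /(_ (qp _ kp)).
  apply: filterS => w Hw _ Ew; apply: Hw => i ik; rewrite /= sk in ik.
  have il : (i < (size p).+1)%N by lia.
  have [-> Hi] := Ew i il; split=> //.
  by rewrite -[T :: take k p]/(take k.+1 (T :: p)) nth_take.
apply: filterS H1 => w Hw Ew; apply: lte_sum_pinfty => i _; exact: Hw.
Qed.

Section Target.
Variables (Inv : tree C -> Prop) (a : pred (tree C)).
Hypothesis Inv_step : forall T S, Inv T -> (0 < rate T S)%R -> Inv S.
Hypothesis qI : forall T, Inv T -> ~~ a T -> (0 < q T)%R.

Lemma integral_elapsed T p k : Inv (last T p) ->
  \int[P]_(w in ev (T :: p)) clock a (size p) k w =
  P (ev (T :: p)) * (kill lam mu a (fun S => (q S)^-1) k (last T p))%:E.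
Proof.
move=> iT.
rewrite -(integral_kill (P := P) lam_ge0 mu_gt0 chain (Inv := Inv)
  (g := fun n w => maxe (H n w) 0)) //.
- rewrite integral_mkcondr; apply: eq_integral => w _.
  by rewrite /elapsed patchE; congr (if _ then _ else _); rewrite -in_setE asboolb.
- by move=> S; rewrite invr_ge0 exit_rate_ge0.
- by move=> n; apply: measurable_maxe.
- by move=> n w; rewrite le_max lexx orbT.
move=> T' p' iT' aT'; rewrite -(integral_H chain) ?qI //.
apply: eq_integral => w /set_mem Ew; rewrite max_l // ltW //.
by have [] := Ew (size p') (leqnn _).
Qed.

Lemma prob_avoids T p k : Inv (last T p) ->
  P (ev (T :: p) `&` avoids Y a (size p) k) =
  P (ev (T :: p)) * (survive lam mu a k (last T p))%:E.
Proof.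
move=> iT; rewrite /survive.
rewrite -(integral_kill (P := P) lam_ge0 mu_gt0 chain (Inv := Inv)
  (g := fun _ _ => 1)) //.
  by rewrite integral_cst ?mul1e //; apply: measurableI => //; exact: (measurable_avoids chain).
by move=> T' p' _ _; rewrite integral_cst // mul1e mule1.
Qed.

Lemma ae_hit T p : Inv (last T p) ->
  (forall e, (0 < e)%R -> exists n, (survive lam mu a n (last T p) <= e)%R) ->
  {ae P, forall w, ev (T :: p) w -> exists N, a (Y (size p + N) w)}.
Proof.
move=> iT s0.
pose B := ev (T :: p) `&` \bigcap_k avoids Y a (size p) k.
have mB : measurable B.
  by apply: measurableI => //; apply: bigcapT_measurable => k; exact: (measurable_avoids chain).
exists B; split=> //.
- apply/eqP; rewrite -measure_le0; apply/lee_addgt0Pr => e e0; rewrite add0e.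
  have [n sn] := s0 e e0.
  apply: (@le_trans _ _ (P (ev (T :: p) `&` avoids Y a (size p) n))).
    apply: le_measure; rewrite ?inE //; first by apply: measurableI => //; exact: (measurable_avoids chain).
    by move=> w [Ew av]; split=> //; exact: av.
  rewrite prob_avoids // -[leRHS]mul1e lee_pmul //.
  + by rewrite lee_fin survive_ge0.
  + exact: probability_le1.
move=> w /= /not_implyP[Ew nN]; split=> // k _ j _.
by apply/negP => aj; apply: nN; exists j.
Qed.

Lemma integral_elapseds T p L : Inv (last T p) ->
  (fun n => spent a n (last T p)) @ \oo --> L ->
  \int[P]_(w in ev (T :: p)) (\sum_(0 <= i <oo) clock a (size p) i w) =
  P (ev (T :: p)) * L%:E.
Proof.
move=> iT sL; rewrite integral_nneseries //; first last.
- by move=> n w _; exact: elapsed_ge0.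
- by move=> n; apply: measurable_funTS; exact: (measurable_elapsed mY mH).
under eq_eseriesr do rewrite integral_elapsed //.
have PE : P (ev (T :: p)) = (fine (P (ev (T :: p))))%:E.
  by rewrite fineK // fin_num_measure.
rewrite PE nneseriesZl; last first.
  by move=> k _; rewrite lee_fin; apply: kill_ge0 => // S; rewrite invr_ge0 exit_rate_ge0.
congr (_ * _); apply: cvg_lim => //.
under eq_fun do rewrite sumEFin.
by apply: cvg_EFin => //; exact: nearW.
Qed.

(** Vanishing survival forces a hit after finitely many jumps, and finite means make the holding
    times involved finite. *)
Lemma ae_first_time T p B : Inv (last T p) ->
  (forall k, (k < size p)%N -> (0 < q (nth [fmap] (T :: p) k))%R) ->
  (forall e, (0 < e)%R -> exists n, (survive lam mu a n (last T p) <= e)%R) ->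
  (forall n, (spent a n (last T p) <= B)%R) ->
  {ae P, forall w, ev (T :: p) w ->
    [/\ J (size p) w < +oo, 0 <= J (size p) w &
      first_time Y H (size p) [set T | a T] w =
      J (size p) w + \sum_(0 <= i <oo) clock a (size p) i w]}.
Proof.
move=> iT qp s0 sB.
have H1 : {ae P, forall w k, ev (T :: p) w -> clock a (size p) k w < +oo}.
  apply/ae_foralln => k.
  have : P.-integrable (ev (T :: p)) (clock a (size p) k).
    apply/integrableP; split; first by apply: measurable_funTS; exact: (measurable_elapsed mY mH).
    rewrite (eq_integral (clock a (size p) k)) => [|w _].
      by rewrite integral_elapsed // lte_mul_pinfty ?fin_num_measure ?ltry.
    by rewrite gee0_abs // elapsed_ge0.
  move=> /integrable_ae => /(_ (mev _)); apply: filterS => w Hw /Hw.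
  by move=> /fin_numPlt /andP[].
have H2 := ae_hit iT s0; have H3 := ae_jump_time_lty qp; have H4 := ae_H_gt0 T p.
apply: filterS2 (filterI H1 H2) (filterI H3 H4) => w [{}H1 {}H2] [{}H3 {}H4] Ew.
have Hp := H4 Ew; split; [exact: H3 | exact: jump_time_ge0 |].
have [N aN Nmin] := ex_minnP (H2 Ew).
apply: (@first_timeE _ _ _ _ _ _ _ Hp a (size p) N) => //.
- by move=> j jN; apply/negP => /Nmin; rewrite leqNgt jN.
- exact: H3.
- by move=> k; exact: H1.
Qed.

End Target.

End Hitting.

(** * Return times *)

Section Integrals.
Local Open Scope classical_set_scope.
Local Open Scope ereal_scope.
Variables (R : realType) (C : finType) (lam mu : C -> C -> R).
Hypotheses (lam_ge0 : forall c c', (0 <= lam c c')%R) (mu_gt0 : forall c c', (0 < mu c c')%R).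
Context d (W : measurableType d).
Variables (Y : nat -> W -> tree C) (H : nat -> W -> \bar R).
Variable P : probability W R.
Implicit Types (T S : tree C) (p : seq (tree C)) (n k : nat) (a : pred (tree C)).

Local Notation q := (exit_rate lam mu).
Local Notation rate := (rate lam mu).
Local Notation ev := (ev Y H).
Local Notation succ := (successors lam mu).
Local Notation J := (jump_time H).
Local Notation clock := (elapsed Y H).
Local Notation spent := (spent lam mu).

Lemma jump_time1 w : J 1 w = H 0%N w.
Proof. by rewrite /jump_time big_ord_recl big_ord0 adde0. Qed.

Lemma rate_succ T S : q T != 0%R -> (0 < rate T S)%R -> S \in succ T.
Proof.
move=> q0; apply: contraTT => nS; rewrite -leNgt /Defs.rate big_seq_cond.
apply: sumr_le0 => j /andP[jT /eqP jS]; rewrite leNgt; apply: contra nS => j0.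
rewrite /successors (negPf q0) mem_undup -jS; apply/mapP; exists j => //.
by rewrite mem_filter j0.
Qed.

Lemma spent_cvg a T B : (forall n, (spent a n T <= B)%R) ->
  (fun n => spent a n T) @ \oo --> limn (fun n => spent a n T).
Proof.
by apply: bounded_cvg; apply/nondecreasing_seqP => n; exact: spent_le.
Qed.

Lemma set1_pred1 T : [set T] = [set S | pred1 T S].
Proof. by apply/seteqP; split=> S /= => [->|/eqP]. Qed.

Section Return.
Variable T : tree C.
Hypothesis chain : is_chain lam mu Y H P (dirac_law R T).

Let mY n (A : tree C -> Prop) : measurable [set w | A (Y n w)] := measurable_state chain n A.
Let mH n : measurable_fun setT (H n) := measurable_H chain n.

Lemma prob_start : P (ev [:: T]) = 1.
Proof. by rewrite (prob_ev chain) big_ord0 mulr1 /dirac_law eqxx. Qed.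

Lemma prob_start_rcons S : P (ev [:: T; S]) = (jump_prob lam mu T S)%:E.
Proof. by rewrite (prob_ev_rcons chain T [::] S) prob_start mul1e. Qed.

Lemma start_null : P (~` ev [:: T]) = 0.
Proof.
by rewrite probability_setC ?prob_start ?subee //; exact: (measurable_ev chain).
Qed.

Lemma ae_start (Q : W -> Prop) :
  {ae P, forall w, ev [:: T] w -> Q w} -> {ae P, forall w, Q w}.
Proof.
have H1 : {ae P, forall w, ev [:: T] w}.
  exists (~` ev [:: T]); split=> //; first by apply: measurableC; exact: (measurable_ev chain).
  exact: start_null.
by move=> H2; apply: filterS2 H1 H2 => w Ew; exact.
Qed.

Let measurable_return : measurable_fun setT (return_time Y H T).
Proof. exact: measurable_first_time. Qed.

(** The return time is the first holding time plus the time to reach [T] from the next state, and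
    there are finitely many possible next states. *)
Lemma return_lty (Inv : tree C -> Prop) : closed lam Inv ->
  (forall S S', Inv S -> (0 < rate S S')%R -> Inv S') ->
  (forall S, Inv S -> (0 < q S)%R) -> Inv T ->
  (forall S, Inv S -> exists B, forall n, (spent (pred1 T) n S <= B)%R) ->
  \int[P]_w return_time Y H T w < +oo.
Proof.
move=> cI Istep qI iT sB; have qT := qI _ iT.
pose G w := \sum_(0 <= i <oo) clock (pred1 T) 1 i w.
pose F w := maxe (H 0%N w) 0 + G w.
have G0 w : 0 <= G w by apply: nneseries_ge0 => *; exact: elapsed_ge0.
have F0 w : 0 <= F w by rewrite adde_ge0 // le_max lexx orbT.
have mG : measurable_fun setT G.
  by apply: ge0_emeasurable_sum => [k w _ _|k _]; [exact: elapsed_ge0 | exact: (measurable_elapsed mY mH)].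
have mF : measurable_fun setT F.
  by apply: emeasurable_funD => //; apply: measurable_maxe.
have iS S : S \in succ T -> Inv S.
  by move=> SS; apply: Istep iT _; apply: (succ_rate lam_ge0 mu_gt0) SS; rewrite gt_eqF.
have ae : {ae P, forall w, return_time Y H T w = F w}.
  apply: ae_start; apply: (ae_ev_succ lam_ge0 mu_gt0 chain) => S SS.
  have [B HB] := sB S (iS _ SS).
  have H1 := ae_first_time lam_ge0 mu_gt0 chain (Inv := Inv) (a := pred1 T) Istep
    (fun S iS _ => qI S iS) (T := T) (p := [:: S]) (iS _ SS).
  have H2 := ae_H_gt0 lam_ge0 mu_gt0 chain T [:: S].
  have qk k : (k < size [:: S])%N -> (0 < q (nth [fmap] [:: T; S] k))%R.
    by case: k => [_|].
  have {}H1 := H1 B qk (survive_to0 lam_ge0 mu_gt0 cI (fun S iS _ => qI S iS) (iS _ SS) HB) HB.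
  apply: filterS2 H1 H2 => w H1 H2 Ew; have [_ _] := H1 Ew.
  rewrite /return_time set1_pred1 => ->; rewrite jump_time1 /F /G max_l // ltW //.
  exact: H2.
rewrite (ae_eq_integral F) //; last first.
  by apply: filterS ae => w Hw _.
rewrite (@ge0_negligible_integral _ _ _ _ _ (~` ev [:: T])) //; last 2 first.
- by apply: measurableC; exact: (measurable_ev chain).
- exact: start_null.
rewrite setTD setCK ge0_integralD //; last 4 first.
- exact: (measurable_ev chain).
- by move=> w _; rewrite le_max lexx orbT.
- by apply: measurable_funTS; apply: measurable_maxe.
- exact: measurable_funTS.
apply: lte_add_pinfty.
  rewrite (eq_integral (H 0%N)) => [|w /set_mem Ew].
    by rewrite (integral_H chain (T := T) (p := [::])) // prob_start mul1e ltry.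
  by rewrite max_l // ltW //; have [] := Ew 0%N (leqnn _).
rewrite -[ev _]setIT (integral_ev_succ lam_ge0 mu_gt0 chain T [::]) //=.
rewrite big_seq; apply: lte_sum_pinfty => S SS; rewrite setIT.
have [B HB] := sB S (iS _ SS).
rewrite (integral_elapseds lam_ge0 mu_gt0 chain (Inv := Inv) Istep
  (fun S iS _ => qI S iS) (T := T) (p := [:: S]) (iS _ SS) (spent_cvg HB)).
by rewrite prob_start_rcons -EFinM ltry.
Qed.

(** Restricting to a first jump to [S] keeps a factor [jump_prob T S > 0], and the clock after this
    jump is bounded by the return time. *)
Lemma return_spent (Inv : tree C -> Prop) S :
  (forall S S', Inv S -> (0 < rate S S')%R -> Inv S') ->
  (forall S, Inv S -> (0 < q S)%R) -> Inv T -> S \in succ T ->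
  \int[P]_w return_time Y H T w < +oo ->
  exists B, forall n, (spent (pred1 T) n S <= B)%R.
Proof.
move=> Istep qI iT SS fin; have qT := qI _ iT.
have rS : (0 < rate T S)%R by apply: (succ_rate lam_ge0 mu_gt0) SS; rewrite gt_eqF.
have iS : Inv S by exact: Istep iT rS.
pose f := return_time Y H T.
(* Non-negative everywhere and almost surely equal to the return time. *)
pose g w := maxe (f w) 0.
have mg : measurable_fun setT g by apply: measurable_maxe.
have g0 w : 0 <= g w by rewrite le_max lexx orbT.
have lb : {ae P, forall w, forall N, J 1 w + \sum_(0 <= i < N) clock (pred1 T) 1 i w <= f w /\ 0 <= J 1 w}.
  apply: ae_start; have H2 := ae_H_gt0 lam_ge0 mu_gt0 chain T [::].
  apply: filterS H2 => w Hw Ew N; rewrite /f /return_time set1_pred1; split.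
    by apply: elapsed_le_first_time; exact: Hw.
  by apply: jump_time_ge0; exact: Hw.
have fg : \int[P]_w g w < +oo.
  rewrite (ae_eq_integral f) //; apply: filterS lb => w Hw _.
  have [] := Hw 0%N; rewrite big_geq // adde0 => J1 J0.
  by rewrite /g max_l // (le_trans J0).
have gp : \int[P]_(w in ev [:: T; S]) g w < +oo.
  apply: le_lt_trans fg; apply: ge0_subset_integral => //.
  exact: (measurable_ev chain).
have jp : (0 < jump_prob lam mu T S)%R.
  by rewrite /jump_prob gt_eqF // divr_gt0.
exists (fine (\int[P]_(w in ev [:: T; S]) g w) / jump_prob lam mu T S)%R => N.
rewrite ler_pdivlMr // -lee_fin fineK; last by rewrite ge0_fin_numE // integral_ge0.
rewrite mulrC EFinM -prob_start_rcons /spent -sumEFin ge0_sume_distrr; last first.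
  by move=> k _; rewrite lee_fin; apply: kill_ge0 => // X; rewrite invr_ge0 exit_rate_ge0.
under eq_bigr => k _.
  rewrite -(integral_elapsed lam_ge0 mu_gt0 chain (Inv := Inv) (a := pred1 T) Istep
    (fun S iS _ => qI S iS) (T := T) (p := [:: S]) k iS).
  over.
rewrite -ge0_integral_sum //; last 3 first.
- exact: (measurable_ev chain).
- by move=> k; apply: measurable_funTS; exact: (measurable_elapsed mY mH).
- by move=> k w _; exact: elapsed_ge0.
apply: ae_ge0_le_integral => //.
- exact: (measurable_ev chain).
- by move=> w _; apply: sume_ge0 => k _; exact: elapsed_ge0.
- apply: measurable_funTS; apply: emeasurable_sum => k; exact: (measurable_elapsed mY mH).
- exact: measurable_funTS.
apply: filterS lb => w Hw _; have [H1 J0] := Hw N.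
rewrite /g le_max; apply/orP; left; apply: le_trans H1.
by rewrite leeDr.
Qed.

End Return.

End Integrals.

(** * Mean lifetimes *)

Section NewLeafShape.
Variables (R : realType) (C : finType) (lam mu : C -> C -> R).
Hypotheses (lam_ge0 : forall c c', 0 <= lam c c') (mu_gt0 : forall c c', 0 < mu c c').
Implicit Types (T S : tree C).

(** A vertex below [v] would have had [v] as an ancestor already in [T], so none exists just after
    the birth. *)
Lemma sub_new_leaf T S (v : vertex) (c : C) : is_tree T -> 0 < rate lam mu T S ->
  v \notin domf T -> S.[? v] = Some c -> subtree v S = root_tree c.
Proof.
move=> tT rS vT Sv; apply/fmapP => x; rewrite fnd_sub fnd_root_tree.
case: eqP => [->//|x0]; apply/fnd_notin/negP => xS.
have vS : v \in domf S by rewrite fnd_mem Sv.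
move: vS xS; case: (rate_jump lam_ge0 mu_gt0 rS) => [[u [e [uT _ ->]]]|[u _ ->]].
  rewrite !mem_birth (negPf vT) orbF => /eqP vn; case/orP => [/eqP xn|xT].
    have : size (x ++ v) = size v by rewrite xn -vn.
    by rewrite size_cat; case: x x0 {xn} => //= i x _; lia.
  by move/negP: vT; apply; exact: mem_suffix_tree xT.
by rewrite mem_death (negPf vT) andbF.
Qed.

End NewLeafShape.

Section Lifetimes.
Local Open Scope classical_set_scope.
Local Open Scope ereal_scope.
Variables (R : realType) (C : finType) (lam mu rho : C -> C -> R) (pi : C -> R).
Hypotheses (lam_ge0 : forall c c', (0 <= lam c c')%R) (mu_gt0 : forall c c', (0 < mu c c')%R).
Hypothesis lamE : forall c d, (lam c d = rho c d * mu c d)%R.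
Hypothesis rho_ge0 : forall c d, (0 <= rho c d)%R.
Hypothesis pi_sum1 : (\sum_c pi c = 1)%R.
Context d (W : measurableType d).
Variables (Y : nat -> W -> tree C) (H : nat -> W -> \bar R).
Variable P : probability W R.
Hypothesis chain : is_chain lam mu Y H P (root_law pi).
Implicit Types (T S : tree C) (p : seq (tree C)) (n k : nat) (a : pred (tree C)).

Local Notation q := (exit_rate lam mu).
Local Notation rate := (rate lam mu).
Local Notation ev := (ev Y H).
Local Notation succ := (successors lam mu).
Local Notation clock := (elapsed Y H).
Local Notation spent := (spent lam mu).

Let mY n (A : tree C -> Prop) : measurable [set w | A (Y n w)] := measurable_state chain n A.
Let mH n : measurable_fun setT (H n) := measurable_H chain n.

Lemma root_tree_inj : injective (@root_tree C).
Proof.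
by move=> c c' /(congr1 (fun T : tree C => T.[? [::]])); rewrite !fnd_root_tree /= => -[].
Qed.

Lemma integral_start (D : set W) (G : W -> \bar R) :
  measurable D -> measurable_fun setT G -> (forall w, 0 <= G w) ->
  \int[P]_(w in D) G w = \sum_(c <- enum C) \int[P]_(w in ev [:: root_tree c] `&` D) G w.
Proof.
move=> mD mG G0.
pose U := \big[setU/set0]_(c <- enum C) ev [:: root_tree c].
have mE c : measurable (ev [:: root_tree c]) by exact: (measurable_ev chain).
have mU : measurable U by apply: bigsetU_measurable => c _.
have tE : trivIset [set` enum C] (fun c => ev [:: root_tree c]).
  move=> c c' _ _ [w [Ec Ec']]; apply: root_tree_inj.
  have [/= <- _] := Ec 0%N (leqnn _); by have [/= <- _] := Ec' 0%N (leqnn _).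
have PU : P U = 1.
  transitivity (\int[P]_(w in U) 1); first by rewrite integral_cst // mul1e.
  rewrite /U ge0_integral_bigsetU ?enum_uniq //.
  transitivity (\sum_(c <- enum C) (pi c)%:E).
    apply: eq_bigr => c _; rewrite (integral_cst _ (mE c)) mul1e.
    transitivity (root_law pi (root_tree c))%:E.
      by rewrite [LHS](prob_ev chain) big_ord0 mulr1.
    rewrite /root_law (bigD1 c) //= eqxx mulr1 big1 ?addr0 // => c' c'c.
    by rewrite (inj_eq root_tree_inj) eq_sym (negPf c'c) mulr0.
  by rewrite sumEFin big_enum /= pi_sum1.
have PN : P (~` U) = 0 by rewrite probability_setC // PU subee.
rewrite (@ge0_negligible_integral _ _ _ _ _ (~` U)) //; last 2 first.
- exact: measurableC.
- exact: measurable_funTS.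
rewrite -ge0_integral_bigsetU ?enum_uniq //; last 3 first.
- by move=> c; apply: measurableI.
- by move=> c c' cC c'C [w [[Ec _] [Ec' _]]]; apply: tE => //; exists w.
- exact: measurable_funTS.
congr (integral _ _ _); rewrite setDE setCK /U -!bigcup_seq.
apply/seteqP; split=> [w [Dw [c cC Ew]]|w [c cC [Ew Dw]]].
  by exists c.
by split=> //; exists c.
Qed.

Lemma prob_integral (D : set W) : measurable D -> P D = \int[P]_(w in D) 1.
Proof. by move=> mD; rewrite integral_cst // mul1e. Qed.

(** Both sides are additive over the histories of [n] jumps, so the identity can be checked on each
    history. *)
Lemma integral_paths n (D : set W) (G : W -> \bar R) (K : R) :
  measurable D -> measurable_fun setT G -> (forall w, 0 <= G w) -> (0 <= K)%R ->
  (forall T p, size p = n -> is_tree T -> path (fun A S => S \in succ A) T p ->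
    \int[P]_(w in ev (T :: p) `&` D) G w = P (ev (T :: p) `&` D) * K%:E) ->
  \int[P]_(w in D) G w = P D * K%:E.
Proof.
move=> mD mG G0 K0 base.
have step : forall j T p, (size p + j)%N = n -> is_tree T ->
    path (fun A S => S \in succ A) T p ->
    \int[P]_(w in ev (T :: p) `&` D) G w = P (ev (T :: p) `&` D) * K%:E.
  elim=> [|j IH] T p pj tT pp; first by apply: base => //; rewrite addn0 in pj.
  rewrite (integral_ev_succ lam_ge0 mu_gt0 chain) //.
  rewrite (prob_ev_split lam_ge0 mu_gt0 chain) // ge0_sume_distrl; last first.
    by move=> S _; exact: measure_ge0.
  rewrite !big_seq; apply: eq_bigr => S SS; apply: IH => //.
    by rewrite size_rcons addSnnS.
  by rewrite rcons_path pp.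
rewrite integral_start // [P D]prob_integral // integral_start // ge0_sume_distrl; last first.
  by move=> c _; exact: integral_ge0.
apply: eq_bigr => c _; rewrite -prob_integral; last first.
  by apply: measurableI => //; exact: (measurable_ev chain).
apply: (step n) => //; exact: is_tree_root_tree.
Qed.

Lemma path_succ_tree T p : is_tree T -> path (fun A S => S \in succ A) T p ->
  is_tree (last T p).
Proof.
elim: p T => //= S p IH T tT /andP[SS pp]; apply: IH => //.
have [q0|q0] := eqVneq (q T) 0%R.
  by move: SS; rewrite /successors q0 eqxx inE => /eqP->.
exact: rate_tree (succ_rate lam_ge0 mu_gt0 q0 SS).
Qed.

(* A state with exit rate 0 is never left. *)
Lemma path_succ_exit T p : path (fun A S => S \in succ A) T p -> q (last T p) != 0%R ->
  forall k, (k < (size p).+1)%N -> q (nth [fmap] (T :: p) k) != 0%R.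
Proof.
elim: p T => [|S p IH] T /=; first by move=> _ qT [|].
move=> /andP[SS pp] ql; have H1 := IH S pp ql; case=> [_|k kp]; last exact: H1.
apply/eqP => q0; move: SS; rewrite /successors q0 eqxx inE => /eqP ST.
by have := H1 0%N isT; rewrite /= ST q0 eqxx.
Qed.

Variable r : C -> R.
Hypothesis mass_r : forall c, (fun m => mass rho m.+1 m c) @ \oo --> expR (r c).

Lemma mass_le_r c m : (mass rho m.+1 m c <= expR (r c))%R.
Proof.
rewrite -(cvg_lim (@Rhausdorff R) (@mass_r c)); apply: nondecreasing_cvgn_le.
  exact: diag_mass_nd.
by apply/cvg_ex; exists (expR (r c)).
Qed.

(** The limit is squeezed between the two comparisons of [spent] with the masses, whatever the tree
    around the new leaf. *)
Lemma spent_new_leaf (v : vertex) b c T : v != [::] -> tracked v b c T ->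
  v \in domf T -> subtree v T = root_tree c ->
  (fun n => spent (absent v) n T) @ \oo --> (expR (r c) / mu b c)%R.
Proof.
move=> v0 tT vT sT.
have sB n : (spent (absent v) n T <= expR (r c) / mu b c)%R.
  exact: (spent_le_mass lam_ge0 mu_gt0 lamE rho_ge0 v0 tT sT) (mass_le_r c).
have sL := spent_cvg lam_ge0 mu_gt0 sB.
suff <- : limn (fun n => spent (absent v) n T) = (expR (r c) / mu b c)%R by [].
apply/eqP; rewrite eq_le; apply/andP; split.
  by apply: limr_le; [exact: sL | exact: nearW].
rewrite ler_pdivrMr // mulrC.
have sl n : (spent (absent v) n T <= limn (fun n => spent (absent v) n T))%R.
  apply: nondecreasing_cvgn_le; last exact: sL.
  by apply/nondecreasing_seqP => k; exact: spent_le.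
have := mass_le_spent lam_ge0 mu_gt0 lamE rho_ge0 v0 tT vT sT sl.
by move=> mL; apply: (cvgr_to_le (@mass_r c)); exact: nearW.
Qed.

Lemma mean_lifetimeE n v b c : P (birth_event Y n v b c) <> 0 ->
  mean_lifetime Y H P n v b c = ((mu b c)^-1 * expR (r c))%:E.
Proof.
move=> PB0; pose B := birth_event Y n v b c; pose f := lifetime Y H n v.
pose L := (expR (r c) / mu b c)%R.
have L0 : (0 <= L)%R by rewrite divr_ge0 ?expR_ge0 // ltW.
have mB : measurable B.
  have [v0|v0] := eqVneq v [::].
    rewrite (_ : B = set0) //; apply/seteqP; split=> // w [].
    by rewrite v0.
  rewrite (_ : B = [set w | v \notin domf (Y n w)] `&`
    [set w | (Y n.+1 w).[? v] = Some c /\ (Y n.+1 w).[? behead v] = Some b]); last first.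
    by apply/seteqP; split=> w; [case | case=> ? []].
  apply: measurableI; first exact: (mY n (fun T => v \notin domf T)).
  exact: (mY n.+1 (fun T => T.[? v] = Some c /\ T.[? behead v] = Some b)).
have mf : measurable_fun setT f.
  apply: emeasurable_funB; last exact: measurable_jump_time.
  exact: measurable_first_time.
(* A history of [n.+1] jumps decides whether the birth takes place; if so, the lifetime is almost
   surely the clock of [absent v] from the newborn state on. *)
have key T p : size p = n.+1 -> is_tree T -> path (fun A S => S \in succ A) T p ->
    ev (T :: p) `&` B = set0 \/ ev (T :: p) `&` B = ev (T :: p) /\
    {ae P, forall w, ev (T :: p) w -> f w = \sum_(0 <= i <oo) clock (absent v) n.+1 i w} /\
    \int[P]_(w in ev (T :: p)) (\sum_(0 <= i <oo) clock (absent v) n.+1 i w) =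
    P (ev (T :: p)) * L%:E.
  case/lastP: p => // p S; rewrite size_rcons => -[pn] tT pp.
  have YE w : ev (T :: rcons p S) w -> Y n w = last T p /\ Y n.+1 w = S.
    move=> Ew; have Yk k : (k <= n.+1)%N -> Y k w = nth [fmap] (T :: rcons p S) k.
      by move=> kn; apply: ev_nth Ew _; rewrite /= size_rcons pn.
    rewrite !Yk // -rcons_cons !nth_rcons /= pn ltnn eqxx ltnSn.
    by rewrite (last_nth [fmap]) pn.
  pose good := [/\ v != [::], v \notin domf (last T p), S.[? v] = Some c
    & S.[? behead v] = Some b].
  have [[v0 vT Sc Sb]|ng] := pselect good; last first.
    left; apply/seteqP; split=> // w [/YE[Yn Yn1]].
    by rewrite /B /birth_event /= Yn Yn1.
  right; split.
    apply/seteqP; split=> [w []//|w Ew]; split=> //; have [Yn Yn1] := YE _ Ew.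
    by rewrite /B /birth_event /= Yn Yn1.
  move: pp; rewrite rcons_path => /andP[pp SS].
  have tl := path_succ_tree tT pp.
  have ql : q (last T p) != 0%R.
    apply/eqP => q0; move: SS; rewrite /successors q0 eqxx inE => /eqP ST.
    by move: vT; rewrite -ST fnd_mem Sc.
  have rS := succ_rate lam_ge0 mu_gt0 ql SS.
  have tS : is_tree S by exact: rate_tree rS.
  have sS := sub_new_leaf lam_ge0 mu_gt0 tl rS vT Sc.
  have vS : v \in domf S by rewrite fnd_mem Sc.
  have trS : tracked v b c S by split.
  have sL := spent_new_leaf v0 trS vS sS.
  have qI X : is_tree X -> ~~ absent v X -> (0 < q X)%R.
    move=> tX /negPn vX; apply: exit_rate_gt0 => //; rewrite lone_card //.
    apply/negP => /eqP X1; have [e Xe] := tree_root tX.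
    by move: vX; rewrite (tree_size1 tX Xe X1) mem_root_tree (negPf v0).
  have Istep X X' : is_tree X -> (0 < rate X X')%R -> is_tree X' by exact: rate_tree.
  have sB k : (spent (absent v) k S <= L)%R.
    exact: (spent_le_mass lam_ge0 mu_gt0 lamE rho_ge0 v0 trS sS) (mass_le_r c).
  have lS : last T (rcons p S) = S by rewrite last_rcons.
  have szp : size (rcons p S) = n.+1 by rewrite size_rcons pn.
  split; last first.
    have := integral_elapseds lam_ge0 mu_gt0 chain Istep qI (T := T) (p := rcons p S) (L := L).
    by rewrite lS szp; exact.
  have := ae_first_time lam_ge0 mu_gt0 chain Istep qI (T := T) (p := rcons p S) (B := L).
  rewrite lS szp => /(_ tS) H1.
  have {}H1 := H1 _ (survive_to0 lam_ge0 mu_gt0 (closed_is_tree lam) qI tS sB) sB.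
  have qk k : (k < n.+1)%N -> (0 < q (nth [fmap] (T :: rcons p S) k))%R.
    move=> kn; rewrite lt0r exit_rate_ge0 // andbT -rcons_cons nth_rcons /= pn kn.
    by apply: path_succ_exit pp ql _ _; rewrite pn.
  apply: filterS (H1 qk) => w Hw Ew; have [Jlt J0 fE] := Hw Ew.
  rewrite /f /lifetime fE addeAC subee ?add0e //.
  by rewrite ge0_fin_numE.
(* The lifetime is non-negative only almost surely on the event, so its positive and negative parts
   are integrated separately. *)
have fp : \int[P]_(w in B) (f^\+ w) = P B * L%:E.
  apply: (@integral_paths n.+1) => //; first exact: measurable_funepos.
  move=> T p pn tT pp; have [->|[-> [ae <-]]] := key T p pn tT pp.
    by rewrite integral_set0 measure0 mul0e.
  apply: ae_eq_integral.
  - exact: (measurable_ev chain).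
  - by apply: measurable_funTS; exact: measurable_funepos.
  - apply: measurable_funTS; apply: ge0_emeasurable_sum => [k w _ _|k _].
      exact: elapsed_ge0.
    exact: (measurable_elapsed mY mH).
  apply: filterS ae => w Hw /Hw fE; rewrite funeposE fE max_l //.
  by apply: nneseries_ge0 => *; exact: elapsed_ge0.
have fn : \int[P]_(w in B) (f^\- w) = P B * 0%:E.
  apply: (@integral_paths n.+1) => //; first exact: measurable_funeneg.
  move=> T p pn tT pp; have [->|[-> [ae _]]] := key T p pn tT pp.
    by rewrite integral_set0 measure0 mul0e.
  rewrite mule0 -(integral0 P (ev (T :: p))); apply: ae_eq_integral.
  - exact: (measurable_ev chain).
  - by apply: measurable_funTS; exact: measurable_funeneg.
  - exact: measurable_cst.
  apply: filterS ae => w Hw /Hw fE; rewrite funenegE fE max_r //.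
  by rewrite oppe_le0; apply: nneseries_ge0 => *; exact: elapsed_ge0.
rewrite /mean_lifetime -/B -/f integralE fp fn mule0 sube0 muleA.
have PBf : P B \is a fin_num by exact: fin_num_measure.
rewrite -{2}(fineK PBf) -EFinM mulVf; first by rewrite mul1r /L mulrC.
by apply/eqP => PB; apply: PB0; rewrite -/B -(fineK PBf) PB.
Qed.

End Lifetimes.

(** * The criterion *)

(** A left eigenvector [v] is paired with [y] through s = \sum_i |v_i| y_i: [rho * s] is at most
    \sum_ij |v_i| A_ij y_j, hence at most [B * s]. *)
Lemma perron_frobenius_le (R : realType) n (A : 'M[R]_n) (y : 'I_n -> R) (B rho : R) :
  (forall i j, 0 <= A i j) -> (forall i, 0 <= y i) -> 0 <= B ->
  (forall i, \sum_j A i j * y j <= B * y i) ->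
  (forall i, y i = 0 -> forall j, A i j = 0) ->
  0 <= rho -> eigenvalue A rho -> rho <= B.
Proof.
move=> A0 y0 B0 Ay yA rho0 /eigenvalueP[v vA v0].
pose s := \sum_i `|v 0 i| * y i.
have s0 : 0 <= s by apply: sumr_ge0 => i _; rewrite mulr_ge0.
have rs : rho * s <= B * s.
  rewrite /s !mulr_sumr.
  apply: (@le_trans _ _ (\sum_j \sum_i `|v 0 i| * A i j * y j)).
    apply: ler_sum => j _; rewrite mulrA -[rho]ger0_norm // -normrM.
    have -> : rho * v 0 j = \sum_i v 0 i * A i j.
      by have := congr1 (fun u : 'rV_n => u 0 j) vA; rewrite !mxE => ->.
    rewrite -mulr_suml ler_wpM2r //; apply: le_trans (ler_norm_sum _ _ _) _.
    by apply: ler_sum => i _; rewrite normrM (ger0_norm (A0 _ _)).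
  rewrite exchange_big; apply: ler_sum => i _.
  rewrite mulrCA; under eq_bigr do rewrite -mulrA.
  by rewrite -mulr_sumr ler_wpM2l.
have [s_gt0|] := ltP 0 s; first by rewrite -(ler_pM2r s_gt0).
(* If [s = 0], then for each [i] either the entry of [v] or the row of [A] vanishes, so [v] is
   mapped to 0 and [rho = 0]. *)
move=> s_le0; have sE : s = 0 by apply/eqP; rewrite eq_le s_le0.
suff -> : rho = 0 by [].
have : rho *: v = 0.
  rewrite -vA; apply/rowP => j; rewrite !mxE big1 // => i _.
  have /eqP : `|v 0 i| * y i = 0.
    by move: sE => /eqP; rewrite psumr_eq0 => [/allP/(_ i (mem_index_enum _))/eqP|k _];
      rewrite ?mulr_ge0.
  rewrite mulf_eq0 normr_eq0 => /orP[/eqP->|/eqP/yA->]; first by rewrite mul0r.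
  by rewrite mulr0.
by move=> /eqP; rewrite scaler_eq0 (negPf v0) orbF => /eqP.
Qed.

Section Ergodicity.
Variables (R : realType) (C : finType) (lam mu : C -> C -> R).
Hypotheses (lam_ge0 : forall c c', 0 <= lam c c') (mu_gt0 : forall c c', 0 < mu c c').
Context d (W : measurableType d).
Variables (Y : nat -> W -> tree C) (H : nat -> W -> \bar R) (P : tree C -> probability W R).
Hypothesis chainP : forall T, is_tree T -> is_chain lam mu Y H (P T) (dirac_law R T).
Variable rho : C -> C -> R.
Hypothesis rhoE : forall c c', rho c c' = lam c c' / mu c c'.

Local Notation q := (exit_rate lam mu).

Let lamE c e : lam c e = rho c e * mu c e.
Proof. by rewrite rhoE divfK // gt_eqF. Qed.

Let rho_ge0 c e : 0 <= rho c e.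
Proof. by rewrite rhoE divr_ge0 // ltW. Qed.

Lemma reachable_absorbed c T : q (root_tree c) = 0 -> reachable lam mu (root_tree c) T ->
  T = root_tree c.
Proof.
move=> q0; move: T; apply: reachable_ind_r => // S S' _ -> r0.
by have := lt_le_trans r0 (rate_le_exit lam_ge0 mu_gt0 _ _); rewrite q0 ltxx.
Qed.

Lemma reachable_step c S S' : reachable lam mu (root_tree c) S -> 0 < rate lam mu S S' ->
  reachable lam mu (root_tree c) S'.
Proof. exact: reachable_rcons. Qed.

Lemma ergodic_of_mass : (forall c, exists B, forall m, mass rho m.+1 m c <= B) ->
  ergodic lam mu Y H P.
Proof.
move=> mB c T cT; have [qT|qT] := eqVneq (q T) 0; [by left | right].
have q0 : 0 < q (root_tree c).
  rewrite lt0r exit_rate_ge0 // andbT; apply: contraNneq qT => q0.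
  by rewrite (reachable_absorbed q0 cT) q0.
have [B HB] := mB c.
have [tT _] := reach_tree lam_ge0 mu_gt0 cT.
apply: (return_lty lam_ge0 mu_gt0 (chainP tT) (Inv := reachable lam mu (root_tree c))) => //.
- exact: closed_reachable.
- exact: reachable_step.
- by move=> S cS; apply: reach_exit_gt0 cS.
by move=> S cS; exact: (spent_reach_bounded lam_ge0 mu_gt0 lamE rho_ge0 q0 HB cT cS).
Qed.

(** From the lone root of class [b] the first jump may be the birth of a leaf of class [c]; the
    chain cannot be back before this leaf dies, so the mean time to its death is finite. *)
Lemma mass_of_ergodic_pos b c : 0 < lam b c -> ergodic lam mu Y H P ->
  exists B, forall m, mass rho m.+1 m c <= B.
Proof.
move=> lam0 erg; pose o := root_tree b; pose S := birth o [::] c.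
have o0 : [::] \in domf o by rewrite mem_root_tree.
have rS : 0 < rate lam mu o S.
  apply: lt_le_trans (birth_rate_rate lam_ge0 mu_gt0 o [::] c).
  by rewrite /birth_rate fnd_root_tree.
have q0 : 0 < q o by apply: lt_le_trans rS (rate_le_exit lam_ge0 mu_gt0 _ _).
have to : is_tree o by exact: is_tree_root_tree.
have oo : reachable lam mu o o by exact: reachable_refl.
have [qo|fin] := erg b o oo; first by rewrite qo ltxx in q0.
have [B HB] : exists B, forall n, spent lam mu (pred1 o) n S <= B.
  apply: (return_spent lam_ge0 mu_gt0 (chainP to) (Inv := reachable lam mu o)) => //.
  - exact: reachable_step.
  - by move=> X oX; apply: reach_exit_gt0 oX.
  - by apply: rate_succ rS; rewrite gt_eqF.
pose v := newborn o [::].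
have v0 : v != [::] by [].
have vo : v \notin domf o by rewrite mem_root_tree.
have Sv : S.[? v] = Some c by rewrite fnd_birth eqxx.
have vS : v \in domf S by rewrite fnd_mem Sv.
have tS : tracked v b c S.
  split; first exact: is_tree_birth.
  by move=> _; split; rewrite // fnd_birth /= fnd_root_tree.
have sS := sub_new_leaf lam_ge0 mu_gt0 to rS vo Sv.
exists (mu b c * B) => m.
apply: (mass_le_spent lam_ge0 mu_gt0 lamE rho_ge0 v0 tS vS sS) => n.
apply: le_trans (HB n); apply: spent_mono => // X /eqP->.
by rewrite /absent mem_root_tree.
Qed.

(** A class that is never born is handled through its children: [massS] bounds the mass of [c] by
    those of the classes [e] with [lam c e > 0], the others having weight 0. *)
Lemma mass_of_ergodic : ergodic lam mu Y H P ->
  forall c, exists B, forall m, mass rho m.+1 m c <= B.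
Proof.
move=> erg c.
have /choice[B HB] : forall e, exists B, 0 < lam c e -> forall m, mass rho m.+1 m e <= B.
  move=> e; have [l0|_] := ltP 0 (lam c e); last by exists 0.
  by have [B HB] := mass_of_ergodic_pos l0 erg; exists B.
exists (expR (\sum_e rho c e * B e)) => m.
apply: (le_trans (diag_mass_nd rho_ge0 c (leqnSn m))).
rewrite massS; apply: (le_trans (exp_trunc_le _ _)).
  by apply: sumr_ge0 => e _; rewrite mulr_ge0 ?mass_ge0.
rewrite ler_expR; apply: ler_sum => e _.
have := lam_ge0 c e; rewrite le_eqVlt => /orP[/eqP l0|l0].
  by rewrite rhoE -l0 !mul0r.
rewrite ler_wpM2l //; apply: le_trans (HB e l0 m.+1).
exact: mass_mono.
Qed.

End Ergodicity.

Theorem theorem5p1 (R : realType) (C : finType)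
    (lam mu : C -> C -> R) (pi : C -> R)
    (lam_ge0 : forall c c', 0 <= lam c c')
    (mu_gt0 : forall c c', 0 < mu c c')
    (pi_ge0 : forall c, 0 <= pi c)
    (pi_sum1 : \sum_c pi c = 1)
    (d : measure_display) (W : measurableType d)
    (Y : nat -> W -> tree C) (H : nat -> W -> \bar R)
    (P : tree C -> probability W R) (Ppi : probability W R)
    (chainP : forall T, is_tree T -> is_chain lam mu Y H (P T) (dirac_law R T))
    (chainPpi : is_chain lam mu Y H Ppi (root_law pi))
    (rho2 : C -> C -> R) (rho2E : forall c c', rho2 c c' = lam c c' / mu c c')
    (rho1 : C -> R) (rho1E : forall c, rho1 c = \sum_c' rho2 c c') :
  [/\ (* 1 *)
      (ergodic lam mu Y H P <-> exists y : C -> R, solution rho2 y)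
      /\ (ergodic lam mu Y H P ->
          exists r : C -> R,
            [/\ smallest_solution rho2 r,
                forall c, rho1 c <= r c
              & forall n v b c, Ppi (birth_event Y n v b c) <> 0%E ->
                  mean_lifetime Y H Ppi n v b c
                  = ((mu b c)^-1 * expR (r c))%:E]),
      (* 2 *)
      (forall c, rho1 c <= (expR 1)^-1) ->
      ergodic lam mu Y H P
      /\ (forall r, smallest_solution rho2 r ->
            forall c, r c <= rho1 c * expR 1)
    & (* 3 *)
      forall rho : R, perron_frobenius (class_mx rho2) rho ->
        ergodic lam mu Y H P -> rho <= (expR 1)^-1].
Proof.
have rho_ge0 c e : 0 <= rho2 c e by rewrite rho2E divr_ge0 // ltW.
have lamE c e : lam c e = rho2 c e * mu c e by rewrite rho2E divfK // gt_eqF.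
have erg_mass := mass_of_ergodic lam_ge0 mu_gt0 chainP rho2E.
have mass_erg := ergodic_of_mass lam_ge0 mu_gt0 chainP rho2E.
have sol_mass y : (forall c, \sum_e rho2 c e * expR (y e) <= y c) ->
    forall c, exists B, forall m, mass rho2 m.+1 m c <= B.
  by move=> yS c; exists (expR (y c)) => m; exact: mass_le_super.
have sol_ge0 y : solution rho2 y -> forall c, 0 <= y c.
  by move=> yS c; rewrite yS; apply: sumr_ge0 => e _; rewrite mulr_ge0 ?expR_ge0.
split.
- split.
    split=> [erg|[y yS]].
      by have [r [rS _] _] := mass_solution rho_ge0 (erg_mass erg); exists r.
    by apply: mass_erg; apply: (sol_mass y) => c; rewrite -yS.
  move=> erg; have [r rS mr] := mass_solution rho_ge0 (erg_mass erg).
  exists r; split=> // [c|n v b c].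
    rewrite rho1E rS.1; apply: ler_sum => e _.
    by rewrite ler_peMr // -expR0 ler_expR sol_ge0 //; case: rS.
  exact: (mean_lifetimeE lam_ge0 mu_gt0 lamE rho_ge0 pi_sum1 chainPpi mr).
- move=> rho_le.
  (* [y = e * rho1] is a supersolution: [rho1 <= 1/e] gives [y <= 1], hence [exp y <= e]. *)
  have ySup c : \sum_e rho2 c e * expR (rho1 e * expR 1) <= rho1 c * expR 1.
    rewrite [in leRHS]rho1E mulr_suml; apply: ler_sum => e _.
    by rewrite ler_wpM2l // ler_expR -ler_pdivlMr ?expR_gt0 // mul1r.
  have [r rS mr] := mass_solution rho_ge0 (sol_mass _ ySup).
  split; first exact: mass_erg (sol_mass _ ySup).
  move=> r' [r'S r'min] c; apply: le_trans (r'min r rS.1 c) _.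
  rewrite -ler_expR; apply: (cvgr_to_le (mr c)); apply: nearW => m.
  exact: (mass_le_super rho_ge0 m.+1 m c ySup).
move=> rho [rho0 rhoev _] erg.
have [y [yS _] _] := mass_solution rho_ge0 (erg_mass erg).
(* The smallest solution is the test vector: [e * y <= exp y] bounds the image of [y] under the
   matrix by [y / e]. *)
apply: (perron_frobenius_le (A := class_mx rho2) (y := fun i => y (enum_val i))) => //.
- by move=> i j; rewrite mxE.
- by move=> i; exact: sol_ge0.
- move=> i; rewrite mulrC ler_pdivlMr ?expR_gt0 // [leRHS]yS mulr_suml.
  rewrite [leRHS](reindex (fun j : 'I_#|C| => enum_val j)) /=; last first.
    by exists enum_rank => x _; rewrite ?enum_valK ?enum_rankK.
  apply: ler_sum => j _; rewrite mxE -mulrA ler_wpM2l //.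
  (* [e * z <= exp z] is [1 + x <= exp x] at [x = z - 1]. *)
  set z := y _; have -> : expR z = expR (z - 1) * expR 1 by rewrite -expRD subrK.
  rewrite ler_wpM2r ?expR_ge0 //; apply: le_trans (expR_ge1Dx _).
  by rewrite addrC subrK.
(* If [y] vanishes at a class, so do all the non-negative terms of its equation, hence its row of
   [rho2]. *)
move=> i yi j; rewrite mxE; move: yi; rewrite yS => /eqP.
rewrite psumr_eq0 => [/allP/(_ (enum_val j) (mem_index_enum _))|e _]; last first.
  by rewrite mulr_ge0 ?expR_ge0.
by rewrite mulf_eq0 (gt_eqF (expR_gt0 _)) orbF => /eqP.
Qed.
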